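(* Let $S$ be a set of $n$ points in the plane and $P$ a simple polygon with $m$ vertices. Given a set $\Lambda$ in the plane, consider the problem of finding a point $r\in\Lambda$ and an angle $\theta\in[0,2\pi)$ such that, after rotating $P$ clockwise around $r$ by $\theta$, the number of points of $S$ contained in $P$ is maximized (over all choices of $r\in\Lambda$ and $\theta$). (1) If $\Lambda$ is a line, the problem can be solved in $O(n^2m^2\log(nm))$ time and $O(n^2m^2)$ space. (2) If $\Lambda$ is a polygonal chain with $s$ line segments, the problem can be solved in $O(s\,n^2m^2\log(nm))$ time and $O(n^2m^2)$ space.
   Context: A simple polygon $P$ is understood as the closed planar region bounded by it. Time and space are worst-case in the usual real-RAM model of computational geometry (exact real arithmetic and elementary geometric operations, including computing the real roots of polynomials of bounded degree, at unit cost). *)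

(* Defs.v *)
From HB Require Import structures.
From mathcomp Require Import all_boot all_order all_algebra.
From mathcomp Require Import polyrcf.
From mathcomp Require Import all_classical all_reals all_analysis.
Set Implicit Arguments.
Unset Strict Implicit.
Unset Printing Implicit Defensive.
Import Order.TTheory GRing.Theory Num.Theory.
Import numFieldNormedType.Exports.
Local Open Scope classical_set_scope.
Local Open Scope ring_scope.

Section Geometry.
Variable R : realType.
Implicit Types (a b r x : R * R) (v pts : seq (R * R)) (theta : R).

Definition affine_comb a b (t : R) : R * R :=
  (a.1 + t * (b.1 - a.1), a.2 + t * (b.2 - a.2)).

Definition line_through a b : set (R * R) := range (affine_comb a b).

Definition segment a b : set (R * R) := affine_comb a b @` `[0, 1].

Definition vtx v (i : nat) : R * R := nth (0, 0) v i.

(* Indices of a polygon's vertices are cyclic. *)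
Definition next_idx v (i : nat) : nat := (i.+1 %% size v)%N.

Definition edge v (i : nat) : set (R * R) :=
  segment (vtx v i) (vtx v (next_idx v i)).

(* The only common points of two different edges are the vertices shared by
   consecutive edges.  A straight angle at a vertex is allowed. *)
Definition simple_polygon v : Prop :=
  [/\ (2 < size v)%N, uniq v &
      forall i j x, (i < size v)%N -> (j < size v)%N -> i != j ->
        edge v i x -> edge v j x ->
        (j = next_idx v i /\ x = vtx v j) \/
        (i = next_idx v j /\ x = vtx v i)].

Definition polygon_boundary v : set (R * R) :=
  \bigcup_(i in [set i | (i < size v)%N]) edge v i.

(* The closed region bounded by the polygon: the boundary together with the
   bounded connected components of its complement. *)
Definition polygon_region v : set (R * R) :=
  polygon_boundary v `|`
  [set x | (~` polygon_boundary v) x /\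
           bounded_set (connected_component (~` polygon_boundary v) x)].

(* Chain q_0, ..., q_s with s segments [q_i, q_(i+1)], none of them reduced to
   a point; the chain may cross itself or be closed. *)
Definition polygonal_chain (s : nat) v : Prop :=
  [/\ (0 < s)%N, size v = s.+1 &
      forall i, (i < s)%N -> vtx v i != vtx v i.+1].

Definition chain_points (s : nat) v : set (R * R) :=
  \bigcup_(i in [set i | (i < s)%N]) segment (vtx v i) (vtx v i.+1).

Definition rotate_cw r theta x : R * R :=
  (r.1 + cos theta * (x.1 - r.1) + sin theta * (x.2 - r.2),
   r.2 - sin theta * (x.1 - r.1) + cos theta * (x.2 - r.2)).

Definition captured pts v r theta : nat :=
  count (fun x => `[< (rotate_cw r theta @` polygon_region v) x >]) pts.

Definition optimal_rotation (Lambda : set (R * R)) pts v r theta : Prop :=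
  [/\ Lambda r, 0 <= theta < 2 * pi &
      forall r' theta', Lambda r' -> 0 <= theta' < 2 * pi ->
        (captured pts v r' theta' <= captured pts v r theta)%N].

End Geometry.

(* A structured unit-cost real RAM.  A program has two memories: cells holding naturals (used for addresses and
   counters) and cells holding exact reals.  The input reals sit in a separate
   read-only array, which is not counted as space.  A natural can be cast to a
   real, but not conversely, and naturals have neither division nor bit
   operations, so there is no floor function in disguise. *)

Inductive operand :=
| Dir of nat   (* the cell with this fixed address *)
| Ind of nat.  (* the cell whose address is stored in that natural cell *)

Inductive nat_op := NAdd | NSub | NMul.
Inductive real_op := RAdd | RSub | RMul | RDiv.

(* First operand = destination. *)
Inductive instr :=
| NConst of operand & nat
| NMove of operand & operand
| NOp of nat_op & operand & operand & operand
| RInput of operand & operand     (* input real at an index held as a natural *)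
| ROfNat of operand & operand
| RMove of operand & operand
| ROp of real_op & operand & operand & operand
(* The next two take the coefficients, constant term first, of a nonzero
   polynomial.  The operand list is part of the program text, so the degree is
   bounded independently of the input. *)
| NRootCount of operand & seq operand
| RRoot of operand & nat & seq operand  (* k-th smallest distinct real root *)
(* Angles are transcendental in the coordinates, hence not obtainable from
   polynomial roots. *)
| RAcos of operand & operand.

Inductive test :=
| NLe of operand & operand
| NLt of operand & operand
| RLe of operand & operand
| RLt of operand & operand.

Inductive program :=
| Skip
| Do of instr
| Seq of program & program
| If of test & program & program
| While of test & program.

Section Semantics.
Variable R : realType.

Record state := State { nmem : nat -> nat ; rmem : nat -> R }.

Definition upd (T : Type) (m : nat -> T) (a : nat) (x : T) : nat -> T :=
  fun b => if b == a then x else m b.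

Definition nset st a k := State (upd (nmem st) a k) (rmem st).
Definition rset st a x := State (nmem st) (upd (rmem st) a x).

(* [space] is the number of cells of each of the two memories; [input] is the
   read-only array.  [None] means that the machine crashes: access outside the
   memory or the input, division by zero, root of the zero polynomial or beyond
   the last root, arc cosine outside [-1, 1]. *)
Variables (space : nat) (input : seq R).

Definition check (T : Type) (b : bool) (x : T) : option T :=
  if b then Some x else None.

Definition addr st (o : operand) : option nat :=
  match o with
  | Dir a => check (a < space)%N a
  | Ind a => check ((a < space)%N && (nmem st a < space)%N) (nmem st a)
  end.

Definition nget st o : option nat := omap (nmem st) (addr st o).
Definition rget st o : option R := omap (rmem st) (addr st o).

Definition nput st o (k : nat) : option state :=
  omap (fun a => nset st a k) (addr st o).
Definition rput st o (x : R) : option state :=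
  omap (fun a => rset st a x) (addr st o).

Fixpoint rgets st (os : seq operand) : option (seq R) :=
  if os is o :: os' then
    obind (fun x => omap (cons x) (rgets st os')) (rget st o)
  else Some [::].

Definition nat_op_sem (op : nat_op) (a b : nat) : nat :=
  match op with
  | NAdd => (a + b)%N
  | NSub => (a - b)%N
  | NMul => (a * b)%N
  end.

Definition real_op_sem (op : real_op) (x y : R) : option R :=
  match op with
  | RAdd => Some (x + y)
  | RSub => Some (x - y)
  | RMul => Some (x * y)
  | RDiv => check (y != 0) (x / y)
  end.

Definition step (i : instr) (st : state) : option state :=
  match i with
  | NConst d k => nput st d k
  | NMove d o => obind (nput st d) (nget st o)
  | NOp op d o1 o2 =>
      obind (fun a => obind (fun b => nput st d (nat_op_sem op a b))
                            (nget st o2)) (nget st o1)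
  | RInput d o =>
      obind (fun a => obind (rput st d)
                            (check (a < size input)%N (nth 0 input a)))
            (nget st o)
  | ROfNat d o => obind (fun a => rput st d a%:R) (nget st o)
  | RMove d o => obind (rput st d) (rget st o)
  | ROp op d o1 o2 =>
      obind (fun x => obind (fun y => obind (rput st d) (real_op_sem op x y))
                            (rget st o2)) (rget st o1)
  | NRootCount d os =>
      obind (fun c => obind (fun p => nput st d (size (rootsR p)))
                            (check (Poly c != 0) (Poly c)))
            (rgets st os)
  | RRoot d k os =>
      obind (fun c => obind (rput st d)
                            (check ((Poly c != 0) &&
                                    (k < size (rootsR (Poly c)))%N)
                                   (nth 0 (rootsR (Poly c)) k)))
            (rgets st os)
  | RAcos d o =>
      obind (fun x => obind (rput st d) (check (-1 <= x <= 1) (acos x)))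
            (rget st o)
  end.

Definition test_sem (t : test) (st : state) : option bool :=
  match t with
  | NLe o1 o2 => obind (fun a => omap (fun b => a <= b)%N (nget st o2))
                       (nget st o1)
  | NLt o1 o2 => obind (fun a => omap (fun b => a < b)%N (nget st o2))
                       (nget st o1)
  | RLe o1 o2 => obind (fun x => omap (fun y => x <= y) (rget st o2))
                       (rget st o1)
  | RLt o1 o2 => obind (fun x => omap (fun y => x < y) (rget st o2))
                       (rget st o1)
  end.

(* [exec p st t st']: started in [st], [p] halts in [st'] after [t] unit-cost
   steps; every executed instruction and every evaluated test costs one. *)
Inductive exec : program -> state -> nat -> state -> Prop :=
| exec_skip st : exec Skip st 0 st
| exec_do i st st' : step i st = Some st' -> exec (Do i) st 1 st'
| exec_seq p1 p2 st st1 st2 t1 t2 :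
    exec p1 st t1 st1 -> exec p2 st1 t2 st2 ->
    exec (Seq p1 p2) st (t1 + t2) st2
| exec_if b (v : bool) p1 p2 st st' t :
    test_sem b st = Some v -> exec (if v then p1 else p2) st t st' ->
    exec (If b p1 p2) st t.+1 st'
| exec_while_false b p st :
    test_sem b st = Some false -> exec (While b p) st 1 st
| exec_while_true b p st st1 st2 t1 t2 :
    test_sem b st = Some true -> exec p st t1 st1 ->
    exec (While b p) st1 t2 st2 ->
    exec (While b p) st (t1 + t2).+1 st2.

End Semantics.

(* The sizes are initially in the first natural cells; all else is zero. *)
Definition init_state (R : realType) (sizes : seq nat) : state R :=
  State (nth 0%N sizes) (fun=> 0).

(* On the given sizes and input array, the program halts within the given
   time, without crashing in the given space, and leaves an acceptable center
   and angle in the first three real cells. *)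
Definition computes_within (R : realType) (p : program) (time : R)
    (space : nat) (sizes : seq nat) (input : seq R)
    (answer : R * R -> R -> Prop) : Prop :=
  exists (t : nat) (st : state R),
    [/\ exec space input p (init_state R sizes) t st,
        t%:R <= time &
        answer (rmem st 0%N, rmem st 1%N) (rmem st 2%N)].

Definition coordinates (R : realType) (pts : seq (R * R)) : seq R :=
  flatten [seq [:: x.1; x.2] | x <- pts].

(* Main.v *)
Require Import Defs.
From mathcomp Require Import all_boot all_order all_algebra.
From mathcomp Require Import polyrcf zify ring lra.
From mathcomp Require Import all_classical all_reals all_analysis.
Set Implicit Arguments.
Unset Strict Implicit.
Unset Printing Implicit Defensive.
Import Order.TTheory GRing.Theory Num.Theory.
Import numFieldNormedType.Exports.
Local Open Scope classical_set_scope.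
Local Open Scope ring_scope.

(* Represent an angle in ]0, 2 pi[ by its half cotangent w, and a center on a
   line by its parameter t.  For a fixed w, a center that moves along the line
   keeps its captured points until one of them is about to leave through an
   edge, or the end t = 1 of a segment is reached.  The configurations that put
   a given point on the line through a given edge form a curve
   t = - H(w) / G(w) with G linear and H quadratic, so it is enough to maximize
   over n m curves and the curve t = 1.  Along a curve the side of an edge on
   which a moving point lies is given by the signs of polynomials in w of degree
   at most 6; these have O(n m) roots, and since the polygon is closed, the
   maximum over the curve is attained at a root.  A point is in the polygon
   if and only if it is on the boundary or a ray from it crosses an odd number
   of edges.  Hence a sweep along the curve, over the sorted roots, needs
   constant time for each root to maintain, for each point, the number of
   crossings and incidences, and the number of captured points; sorting
   dominates with O(n m log(n m)).  The angle 0 is treated separately.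

   The algorithm is a program in a language with expressions and arrays, which
   is compiled to the RAM with constant slowdown. *)

(** * A compiler to the RAM *)

(** The half cotangent, rather than the half tangent, leaves out exactly the angle 0, where the
    rotation is the identity whatever the center. For a fixed [w] all moved points translate with
    the same velocity as the center moves, so that their incidence with the line of an edge is an
    affine condition on [t]. The delicate case is [G(w) = 0]: the motion is then parallel to the
    edge, and no curve tells when a point leaves along it. None is needed, because a point whose
    incident edges are all parallel to the motion can slide a little further within the polygon; at
    a vertex this holds because consecutive edges of a simple polygon do not fold back. The region
    is specified by bounded components of the complement of the boundary, so that the parity
    criterion requires a Jordan theorem: every component has the whole boundary in its closure,
    hence all components of even parity reach the midpoint of one edge, on the same side. All curves
    and segments reuse the same memory, whose tables have O(n m) and O(m^2) entries; this keeps [s]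
    out of the space bound. *)

Inductive nexp := NK of nat | NV of nat & nexp | NB of nat_op & nexp & nexp.

Inductive rexp :=
| RV of nat & nexp
| RN of nexp
| RI of nexp
| RB of real_op & rexp & rexp.

Inductive bexp :=
| BNle of nexp & nexp
| BNlt of nexp & nexp
| BRle of rexp & rexp
| BRlt of rexp & rexp
| BAnd of bexp & bexp
| BNot of bexp.

Inductive cmd :=
| CN of nat & nexp & nexp
| CR of nat & nexp & rexp
| CCount of nat & nat & nat
| CRoot of nat & nat & nat & nat
| CAcos of nat & nat
| CSkip
| CSeq of cmd & cmd
| CIf of bexp & cmd & cmd
| CWhile of bexp & cmd.

(* Addresses below [ntemp] hold the temporaries of expression evaluation.
   Above them the memory is a table with [ncol] columns of unbounded height:
   a variable is a column, an array is a column, and entry [i] of column [a]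
   has address [cell a i]. *)
Notation ntemp := 30%N.
Notation ncol := 40%N.
Definition cell (a i : nat) : nat := (ntemp + ncol * i + a)%N.

Section Compile.

Definition mul_ncol (k a : nat) : program :=
  Seq (Do (NConst (Dir k.+1) ncol))
  (Seq (Do (NOp NMul (Dir k) (Dir k) (Dir k.+1)))
  (Seq (Do (NConst (Dir k.+1) (ntemp + a)))
       (Do (NOp NAdd (Dir k) (Dir k) (Dir k.+1))))).

(* The code of an expression leaves its value in the temporary [k] and may
   overwrite the later ones. *)
Fixpoint comp_n (k : nat) (e : nexp) : program :=
  match e with
  | NK c => Do (NConst (Dir k) c)
  | NV a i => Seq (comp_n k i) (Seq (mul_ncol k a) (Do (NMove (Dir k) (Ind k))))
  | NB op e1 e2 => Seq (comp_n k e1) (Seq (comp_n k.+1 e2)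
                     (Do (NOp op (Dir k) (Dir k) (Dir k.+1))))
  end.

Fixpoint comp_r (k : nat) (e : rexp) : program :=
  match e with
  | RV a i => Seq (comp_n k i) (Seq (mul_ncol k a) (Do (RMove (Dir k) (Ind k))))
  | RN e => Seq (comp_n k e) (Do (ROfNat (Dir k) (Dir k)))
  | RI e => Seq (comp_n k e) (Do (RInput (Dir k) (Dir k)))
  | RB op e1 e2 => Seq (comp_r k e1) (Seq (comp_r k.+1 e2)
                     (Do (ROp op (Dir k) (Dir k) (Dir k.+1))))
  end.

Definition comp_test (k : nat) (p q : program) (t : test) : program :=
  Seq p (Seq q (If t (Do (NConst (Dir k) 1)) (Do (NConst (Dir k) 0)))).

Fixpoint comp_b (k : nat) (b : bexp) : program :=
  match b with
  | BNle e1 e2 =>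
      comp_test k (comp_n k e1) (comp_n k.+1 e2) (NLe (Dir k) (Dir k.+1))
  | BNlt e1 e2 =>
      comp_test k (comp_n k e1) (comp_n k.+1 e2) (NLt (Dir k) (Dir k.+1))
  | BRle e1 e2 =>
      comp_test k (comp_r k e1) (comp_r k.+1 e2) (RLe (Dir k) (Dir k.+1))
  | BRlt e1 e2 =>
      comp_test k (comp_r k e1) (comp_r k.+1 e2) (RLt (Dir k) (Dir k.+1))
  | BAnd b1 b2 => Seq (comp_b k b1) (Seq (comp_b k.+1 b2)
                    (Do (NOp NMul (Dir k) (Dir k) (Dir k.+1))))
  | BNot b1 => Seq (comp_b k b1) (Seq (Do (NConst (Dir k.+1) 1))
                 (Do (NOp NSub (Dir k) (Dir k.+1) (Dir k))))
  end.

(** A RAM test only compares two cells, so the truth value is left in temporary 0 next to the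
    constant 1 in temporary 1. *)
Definition comp_cond (b : bexp) : program :=
  Seq (comp_b 0 b) (Do (NConst (Dir 1) 1)).

Definition coef_cells (a d : nat) : seq operand :=
  [seq Dir (cell a i) | i <- iota 0 d].

(** No instruction can be executed as part of a loop test. The code of a loop condition is therefore
    run once before the loop and again at the end of each iteration. *)
Fixpoint compile (c : cmd) : program :=
  match c with
  | CN a i e => Seq (comp_n 0 e) (Seq (comp_n 1 i) (Seq (mul_ncol 1 a)
                  (Do (NMove (Ind 1) (Dir 0)))))
  | CR a i e => Seq (comp_r 0 e) (Seq (comp_n 1 i) (Seq (mul_ncol 1 a)
                  (Do (RMove (Ind 1) (Dir 0)))))
  | CCount v a d => Do (NRootCount (Dir (cell v 0)) (coef_cells a d))
  | CRoot v k a d => Do (RRoot (Dir (cell v 0)) k (coef_cells a d))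
  | CAcos v a => Do (RAcos (Dir (cell v 0)) (Dir (cell a 0)))
  | CSkip => Skip
  | CSeq p q => Seq (compile p) (compile q)
  | CIf b p q => Seq (comp_cond b)
                   (If (NLe (Dir 1) (Dir 0)) (compile p) (compile q))
  | CWhile b p => Seq (comp_cond b)
      (While (NLe (Dir 1) (Dir 0)) (Seq (compile p) (comp_cond b)))
  end.

Fixpoint time_n (e : nexp) : nat :=
  match e with
  | NK _ => 1
  | NV _ i => time_n i + 5
  | NB _ e1 e2 => time_n e1 + time_n e2 + 1
  end.

Fixpoint time_r (e : rexp) : nat :=
  match e with
  | RV _ i => time_n i + 5
  | RN e | RI e => time_n e + 1
  | RB _ e1 e2 => time_r e1 + time_r e2 + 1
  end.

Fixpoint time_b (b : bexp) : nat :=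
  match b with
  | BNle e1 e2 | BNlt e1 e2 => time_n e1 + time_n e2 + 2
  | BRle e1 e2 | BRlt e1 e2 => time_r e1 + time_r e2 + 2
  | BAnd b1 b2 => time_b b1 + time_b b2 + 1
  | BNot b1 => time_b b1 + 2
  end.

(** The source semantics charges one step per assignment and per guard, so a maximum over the
    program text suffices. In [time_b b + 2] one unit sets the constant of [comp_cond] and one is
    the RAM test. *)
Fixpoint slowdown (c : cmd) : nat :=
  match c with
  | CN _ i e => time_n i + time_n e + 5
  | CR _ i e => time_n i + time_r e + 5
  | CSeq p q => maxn (slowdown p) (slowdown q)
  | CIf b p q => maxn (time_b b + 2) (maxn (slowdown p) (slowdown q))
  | CWhile b p => maxn (time_b b + 2) (slowdown p)
  | _ => 1
  end.

Fixpoint wf_n (k : nat) (e : nexp) : bool :=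
  match e with
  | NK _ => (k < ntemp)%N
  | NV a i => [&& wf_n k i, (a < ncol)%N & (k.+1 < ntemp)%N]
  | NB _ e1 e2 => wf_n k e1 && wf_n k.+1 e2
  end.

Fixpoint wf_r (k : nat) (e : rexp) : bool :=
  match e with
  | RV a i => [&& wf_n k i, (a < ncol)%N & (k.+1 < ntemp)%N]
  | RN e | RI e => wf_n k e
  | RB _ e1 e2 => wf_r k e1 && wf_r k.+1 e2
  end.

Fixpoint wf_b (k : nat) (b : bexp) : bool :=
  match b with
  | BNle e1 e2 | BNlt e1 e2 => wf_n k e1 && wf_n k.+1 e2
  | BRle e1 e2 | BRlt e1 e2 => wf_r k e1 && wf_r k.+1 e2
  | BAnd b1 b2 => wf_b k b1 && wf_b k.+1 b2
  | BNot b1 => wf_b k b1 && (k.+1 < ntemp)%N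
  end.

Fixpoint wf (c : cmd) : bool :=
  match c with
  | CN a i e => [&& wf_n 0 e, wf_n 1 i & (a < ncol)%N]
  | CR a i e => [&& wf_r 0 e, wf_n 1 i & (a < ncol)%N]
  | CCount v a _ => (v < ncol)%N && (a < ncol)%N
  | CRoot v _ a _ => (v < ncol)%N && (a < ncol)%N
  | CAcos v a => (v < ncol)%N && (a < ncol)%N
  | CSkip => true
  | CSeq p q => wf p && wf q
  | CIf b p q => [&& wf_b 0 b, wf p & wf q]
  | CWhile b p => wf_b 0 b && wf p
  end.

(** A syntactic bound on the modified columns. Through [hx_agree] it acts as a frame rule whose side
    conditions are settled by computation. *)
Fixpoint writes_n (c : cmd) (a : nat) : bool :=
  match c with
  | CN v _ _ | CCount v _ _ => a == v
  | CSeq p q | CIf _ p q => writes_n p a || writes_n q a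
  | CWhile _ p => writes_n p a
  | _ => false
  end.

Fixpoint writes_r (c : cmd) (a : nat) : bool :=
  match c with
  | CR v _ _ | CRoot v _ _ _ | CAcos v _ => a == v
  | CSeq p q | CIf _ p q => writes_r p a || writes_r q a
  | CWhile _ p => writes_r p a
  | _ => false
  end.

End Compile.

(** * Semantics of the source language *)

Record memory (R : Type) := Mem { na : nat -> nat -> nat ; ra : nat -> nat -> R }.

Definition setN R (h : memory R) a i x :=
  Mem (fun b j => if (b == a) && (j == i) then x else na h b j) (ra h).
Definition setR R (h : memory R) a i x :=
  Mem (na h) (fun b j => if (b == a) && (j == i) then x else ra h b j).

Section BigStep.
Variables (R : realType) (height : nat) (input : seq R).
Implicit Types h : memory R.

Fixpoint evN h (e : nexp) : nat :=
  match e with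
  | NK c => c
  | NV a i => na h a (evN h i)
  | NB op e1 e2 => nat_op_sem op (evN h e1) (evN h e2)
  end.

Definition rop (op : real_op) (x y : R) : R :=
  match op with
  | RAdd => x + y | RSub => x - y | RMul => x * y | RDiv => x / y
  end.

Fixpoint evR h (e : rexp) : R :=
  match e with
  | RV a i => ra h a (evN h i)
  | RN e => (evN h e)%:R
  | RI e => nth 0 input (evN h e)
  | RB op e1 e2 => rop op (evR h e1) (evR h e2)
  end.

Fixpoint evB h (b : bexp) : bool :=
  match b with
  | BNle e1 e2 => (evN h e1 <= evN h e2)%N
  | BNlt e1 e2 => (evN h e1 < evN h e2)%N
  | BRle e1 e2 => evR h e1 <= evR h e2
  | BRlt e1 e2 => evR h e1 < evR h e2
  | BAnd b1 b2 => evB h b1 && evB h b2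
  | BNot b => ~~ evB h b
  end.

Fixpoint okN h (e : nexp) : bool :=
  match e with
  | NK _ => true
  | NV _ i => okN h i && (evN h i < height)%N
  | NB _ e1 e2 => okN h e1 && okN h e2
  end.

Definition okdiv (op : real_op) (y : R) : bool :=
  if op is RDiv then y != 0 else true.

Fixpoint okR h (e : rexp) : bool :=
  match e with
  | RV _ i => okN h i && (evN h i < height)%N
  | RN e => okN h e
  | RI e => okN h e && (evN h e < size input)%N
  | RB op e1 e2 => [&& okR h e1, okR h e2 & okdiv op (evR h e2)]
  end.

(** Conjunction does not short-circuit, so both operands must be safe. In particular the guard of
    [pass] may read the entry just after the last event. *)
Fixpoint okB h (b : bexp) : bool :=
  match b with
  | BNle e1 e2 | BNlt e1 e2 => okN h e1 && okN h e2
  | BRle e1 e2 | BRlt e1 e2 => okR h e1 && okR h e2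
  | BAnd b1 b2 => okB h b1 && okB h b2
  | BNot b => okB h b
  end.

Definition colpoly h (a d : nat) : {poly R} := \poly_(i < d) ra h a i.

Inductive hx : cmd -> memory R -> nat -> memory R -> Prop :=
| hx_n a i e h : okN h e -> okN h i -> (evN h i < height)%N ->
    hx (CN a i e) h 1 (setN h a (evN h i) (evN h e))
| hx_r a i e h : okR h e -> okN h i -> (evN h i < height)%N ->
    hx (CR a i e) h 1 (setR h a (evN h i) (evR h e))
| hx_count v a d h : (0 < height)%N -> (d <= height)%N -> colpoly h a d != 0 ->
    hx (CCount v a d) h 1 (setN h v 0 (size (rootsR (colpoly h a d))))
| hx_root v k a d h : (0 < height)%N -> (d <= height)%N -> colpoly h a d != 0 ->
    (k < size (rootsR (colpoly h a d)))%N ->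
    hx (CRoot v k a d) h 1 (setR h v 0 (nth 0 (rootsR (colpoly h a d)) k))
| hx_acos v a h : (0 < height)%N -> -1 <= ra h a 0%N <= 1 ->
    hx (CAcos v a) h 1 (setR h v 0 (acos (ra h a 0%N)))
| hx_skip h : hx CSkip h 0 h
| hx_seq p q h h1 h2 t1 t2 : hx p h t1 h1 -> hx q h1 t2 h2 ->
    hx (CSeq p q) h (t1 + t2) h2
| hx_if b p q h h' t : okB h b -> hx (if evB h b then p else q) h t h' ->
    hx (CIf b p q) h t.+1 h'
| hx_while0 b p h : okB h b -> evB h b = false -> hx (CWhile b p) h 1 h
| hx_while1 b p h h1 h2 t1 t2 : okB h b -> evB h b -> hx p h t1 h1 ->
    hx (CWhile b p) h1 t2 h2 -> hx (CWhile b p) h (t1 + t2).+1 h2.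

Definition agree (c : cmd) h0 h : Prop :=
  (forall a, ~~ writes_n c a -> na h a = na h0 a) /\
  (forall a, ~~ writes_r c a -> ra h a = ra h0 a).

Lemma hx_agree c h t h' : hx c h t h' -> agree c h h'.
Proof.
elim=> {c h t h'}.
- move=> a i e h _ _ _; split=> b //= /negbTE nb.
  by apply/funext => j; rewrite nb.
- move=> a i e h _ _ _; split=> b //= /negbTE nb.
  by apply/funext => j; rewrite nb.
- move=> v a d h _ _ _; split=> b //= /negbTE nb.
  by apply/funext => j; rewrite nb.
- move=> v k a d h _ _ _ _; split=> b //= /negbTE nb.
  by apply/funext => j; rewrite nb.
- move=> v a h _ _; split=> b //= /negbTE nb.
  by apply/funext => j; rewrite nb.
- by [].
- move=> p q h h1 h2 t1 t2 _ [n1 r1] _ [n2 r2]; split=> a /=.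
    by rewrite negb_or => /andP[p1 p2]; rewrite n2 // n1.
  by rewrite negb_or => /andP[p1 p2]; rewrite r2 // r1.
- move=> b p q h h' t _ _ [n1 r1]; split=> a /=.
    by rewrite negb_or => /andP[? ?]; apply: n1; case: evB.
  by rewrite negb_or => /andP[? ?]; apply: r1; case: evB.
- by [].
- move=> b p h h1 h2 t1 t2 _ _ _ [n1 r1] _ [n2 r2]; split=> a /= ?.
    by rewrite n2 // n1.
  by rewrite r2 // r1.
Qed.

End BigStep.

(** * Correctness of the compiler *)

Section Correctness.
Variables (R : realType) (height space : nat) (input : seq R).
Hypothesis space_ge : (ntemp + ncol * height <= space)%N.
Implicit Types st : state R.

Local Notation exec := (exec space input).
Local Notation okN := (okN height).
Local Notation okR := (okR height input).
Local Notation okB := (okB height input).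
Local Notation evR := (evR input).
Local Notation evB := (evB input).

(** Columns from [ncol] on are read as zero, because their addresses coincide with those of smaller
    columns in later rows; only so does a store change a single entry of the view. *)
Definition view st : memory R :=
  Mem (fun a i => if (a < ncol)%N then nmem st (cell a i) else 0%N)
      (fun a i => if (a < ncol)%N then rmem st (cell a i) else 0).

Lemma cell_lt a i : (a < ncol)%N -> (i < height)%N -> (cell a i < space)%N.
Proof. rewrite /cell => ha hi; nia. Qed.

Lemma temp_lt k : (k < ntemp)%N -> (k < space)%N.
Proof. by move=> ?; apply: leq_trans space_ge; lia. Qed.

Lemma cell_eq a i b j : (a < ncol)%N -> (b < ncol)%N ->
  (cell b j == cell a i) = (b == a) && (j == i).
Proof.
rewrite /cell => ha hb; apply/eqP/andP => [e|[/eqP-> /eqP->]//].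
have e1 : (ncol * j + b = ncol * i + a)%N by lia.
have : (j = i)%N by nia.
by move=> eji; split; apply/eqP; lia.
Qed.

Lemma temp_cell k a i : (k < ntemp)%N -> (cell a i == k) = false.
Proof. by rewrite /cell => hk; apply/negbTE/eqP; lia. Qed.

Lemma view_nset_temp st k x : (k < ntemp)%N -> view (nset st k x) = view st.
Proof.
move=> hk; congr Mem; apply/funext => a; apply/funext => i /=.
by rewrite /upd temp_cell.
Qed.

Lemma view_rset_temp st k x : (k < ntemp)%N -> view (rset st k x) = view st.
Proof.
move=> hk; congr Mem; apply/funext => a; apply/funext => i /=.
by rewrite /upd temp_cell.
Qed.

Lemma view_nset st a i x : (a < ncol)%N ->
  view (nset st (cell a i) x) = setN (view st) a i x.
Proof.
move=> ha; congr Mem; apply/funext => b; apply/funext => j /=.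
rewrite /upd; case: ltnP => hb; first by rewrite cell_eq.
by case: (b =P a) => // ba; move: hb; rewrite ba leqNgt ha.
Qed.

Lemma view_rset st a i x : (a < ncol)%N ->
  view (rset st (cell a i) x) = setR (view st) a i x.
Proof.
move=> ha; congr Mem; apply/funext => b; apply/funext => j /=.
rewrite /upd; case: ltnP => hb; first by rewrite cell_eq.
by case: (b =P a) => // ba; move: hb; rewrite ba leqNgt ha.
Qed.

(** Guarantees that the first operand, left in temporary [k], survives the evaluation of the second
    one in [k.+1]. *)
Definition below (k : nat) st st' : Prop :=
  forall j, (j < k)%N -> nmem st' j = nmem st j /\ rmem st' j = rmem st j.

Lemma below_trans k st1 st2 st3 : below k st1 st2 -> below k st2 st3 ->
  below k st1 st3.
Proof.
by move=> b1 b2 j hj; have [-> ->] := b2 j hj; exact: b1.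
Qed.

Lemma below_leq k k' st st' : (k <= k')%N -> below k' st st' -> below k st st'.
Proof. by move=> kk' b j hj; apply: b; exact: leq_trans hj kk'. Qed.

Lemma below_nset k j st x : (k <= j)%N -> below k st (nset st j x).
Proof. by move=> kj i ik; split=> //=; rewrite /upd ifN//; apply/eqP; lia. Qed.

Lemma below_rset k j st x : (k <= j)%N -> below k st (rset st j x).
Proof. by move=> kj i ik; split=> //=; rewrite /upd ifN//; apply/eqP; lia. Qed.

Lemma nget_dir st k : (k < space)%N -> nget space st (Dir k) = Some (nmem st k).
Proof. by move=> hk; rewrite /nget /= /check hk. Qed.

Lemma rget_dir st k : (k < space)%N -> rget space st (Dir k) = Some (rmem st k).
Proof. by move=> hk; rewrite /rget /= /check hk. Qed.

Lemma nput_dir st k x : (k < space)%N -> nput space st (Dir k) x = Some (nset st k x).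
Proof. by move=> hk; rewrite /nput /= /check hk. Qed.

Lemma rput_dir st k x : (k < space)%N -> rput space st (Dir k) x = Some (rset st k x).
Proof. by move=> hk; rewrite /rput /= /check hk. Qed.

Lemma addr_ind st k a : (k < space)%N -> nmem st k = a -> (a < space)%N ->
  addr space st (Ind k) = Some a.
Proof. by move=> hk <- ha; rewrite /= /check hk ha. Qed.

Lemma exec_mul_ncol st k a i : (k.+1 < ntemp)%N -> nmem st k = i ->
  exists st', [/\ exec (mul_ncol k a) st 4 st', view st' = view st,
    nmem st' k = cell a i & below k st st'].
Proof.
move=> hk ei.
have h0 : (k < space)%N by apply: temp_lt; lia.
have h1 : (k.+1 < space)%N by apply: temp_lt.
pose st1 := nset st k.+1 ncol.
pose st2 := nset st1 k (i * ncol)%N.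
pose st3 := nset st2 k.+1 (ntemp + a)%N.
pose st4 := nset st3 k (i * ncol + (ntemp + a))%N.
exists st4; split.
- have -> : 4%N = (1 + (1 + (1 + 1)))%N by [].
  apply: (exec_seq (st1 := st1)); first by apply: exec_do; rewrite /= nput_dir.
  apply: (exec_seq (st1 := st2)).
    apply: exec_do; rewrite /= !nget_dir //= nput_dir // /upd eqxx.
    by rewrite ifN ?ei//; apply/eqP; lia.
  apply: (exec_seq (st1 := st3)); first by apply: exec_do; rewrite /= nput_dir.
  apply: exec_do; rewrite /= !nget_dir //= nput_dir // /upd !eqxx.
  by rewrite ifN//; apply/eqP; lia.
- by rewrite !view_nset_temp//; lia.
- by rewrite /= /upd eqxx /cell; lia.
- rewrite /st4 /st3 /st2 /st1.
  by do 3![apply: below_trans; last by apply: below_nset; lia]; apply: below_nset; lia.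
Qed.

Lemma wf_n_lt k e : wf_n k e -> (k < ntemp)%N.
Proof.
elim: e k => [c|a i IH|op f1 IH1 f2 IH2] k //=.
  by case/and3P=> /IH.
by case/andP=> /IH1.
Qed.

Lemma exec_comp_n e k st : wf_n k e -> okN (view st) e ->
  exists t st', [/\ exec (comp_n k e) st t st', (t <= time_n e)%N,
    view st' = view st, nmem st' k = evN (view st) e & below k st st'].
Proof.
elim: e k st => [c|a i IH|op e1 IH1 e2 IH2] k st /=.
- move=> hk _; have h0 := temp_lt hk.
  exists 1%N, (nset st k c); split=> //.
  + by apply: exec_do; rewrite /= nput_dir.
  + by rewrite view_nset_temp.
  + by rewrite /= /upd eqxx.
  + exact: below_nset.
- case/and3P=> wi ha hk /andP[oi hi].
  have [t [st1 [x1 t1 v1 e1 b1]]] := IH _ _ wi oi.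
  have [st2 [x2 v2 e2 b2]] := exec_mul_ncol a hk e1.
  have h0 : (k < space)%N by apply: temp_lt; lia.
  have hc := cell_lt ha hi.
  exists (t + (4 + 1))%N, (nset st2 k (nmem st2 (cell a (evN (view st) i)))).
  split.
  + apply: exec_seq x1 _; apply: exec_seq x2 _; apply: exec_do => /=.
    by rewrite /nget (addr_ind h0 e2 hc) /= nput_dir.
  + lia.
  + by rewrite view_nset_temp; [rewrite v2|lia].
  + have : na (view st2) a (evN (view st) i) = na (view st) a (evN (view st) i).
      by rewrite v2 v1.
    by rewrite /= /upd eqxx ha.
  + apply: below_trans b1 _; apply: below_trans b2 _.
    exact: below_nset.
- case/andP=> w1 w2 /andP[ok1 ok2].
  have [t1 [st1 [x1 tt1 v1 e1' b1]]] := IH1 _ _ w1 ok1.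
  rewrite -v1 in ok2.
  have [t2 [st2 [x2 tt2 v2 e2' b2]]] := IH2 _ _ w2 ok2.
  have hk := wf_n_lt w2.
  have h0 : (k < space)%N by apply: temp_lt; lia.
  have h1 : (k.+1 < space)%N by apply: temp_lt.
  exists (t1 + (t2 + 1))%N,
    (nset st2 k (nat_op_sem op (nmem st2 k) (nmem st2 k.+1))).
  split.
  + apply: exec_seq x1 _; apply: exec_seq x2 _; apply: exec_do => /=.
    by rewrite !nget_dir //= nput_dir.
  + lia.
  + by rewrite view_nset_temp; [rewrite v2|lia].
  + rewrite /= /upd eqxx e2' v1; congr nat_op_sem.
    by have [-> _] := b2 k (leqnn _).
  + apply: below_trans b1 _; apply: below_trans (below_leq (leqnSn k) b2) _.
    exact: below_nset.
Qed.

Lemma wf_r_lt k e : wf_r k e -> (k < ntemp)%N.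
Proof.
elim: e k => [a i|e|e|op f1 IH1 f2 IH2] k //=.
- by case/and3P=> /wf_n_lt.
- exact: wf_n_lt.
- exact: wf_n_lt.
- by case/andP => /IH1.
Qed.

Lemma wf_b_lt k b : wf_b k b -> (k < ntemp)%N.
Proof.
elim: b k => [e1 e2|e1 e2|e1 e2|e1 e2|b1 IH1 b2 IH2|b1 IH] k /= /andP[].
- by move/wf_n_lt.
- by move/wf_n_lt.
- by move/wf_r_lt.
- by move/wf_r_lt.
- by move/IH1.
- by move/IH.
Qed.

Lemma exec_comp_r e k st : wf_r k e -> okR (view st) e ->
  exists t st', [/\ exec (comp_r k e) st t st', (t <= time_r e)%N,
    view st' = view st, rmem st' k = evR (view st) e & below k st st'].
Proof.
elim: e k st => [a i|e|e|op e1 IH1 e2 IH2] k st /=.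
- case/and3P=> wi ha hk /andP[oi hi].
  have [t [st1 [x1 t1 v1 e1 b1]]] := exec_comp_n wi oi.
  have [st2 [x2 v2 e2 b2]] := exec_mul_ncol a hk e1.
  have h0 : (k < space)%N by apply: temp_lt; lia.
  have hc := cell_lt ha hi.
  exists (t + (4 + 1))%N, (rset st2 k (rmem st2 (cell a (evN (view st) i)))).
  split.
  + apply: exec_seq x1 _; apply: exec_seq x2 _; apply: exec_do => /=.
    by rewrite /rget (addr_ind h0 e2 hc) /= rput_dir.
  + lia.
  + by rewrite view_rset_temp; [rewrite v2|lia].
  + have : ra (view st2) a (evN (view st) i) = ra (view st) a (evN (view st) i).
      by rewrite v2 v1.
    by rewrite /= /upd eqxx ha.
  + apply: below_trans b1 _; apply: below_trans b2 _.
    exact: below_rset.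
- move=> we oe; have h0 := temp_lt (wf_n_lt we).
  have [t [st1 [x1 t1 v1 e1 b1]]] := exec_comp_n we oe.
  exists (t + 1)%N, (rset st1 k (nmem st1 k)%:R); split.
  + apply: exec_seq x1 _; apply: exec_do => /=.
    by rewrite nget_dir //= rput_dir.
  + lia.
  + by rewrite view_rset_temp; [rewrite v1|exact: (wf_n_lt we)].
  + by rewrite /= /upd eqxx e1.
  + by apply: below_trans b1 _; exact: below_rset.
- move=> we /andP[oe lte]; have h0 := temp_lt (wf_n_lt we).
  have [t [st1 [x1 t1 v1 e1 b1]]] := exec_comp_n we oe.
  exists (t + 1)%N, (rset st1 k (nth 0 input (nmem st1 k))); split.
  + apply: exec_seq x1 _; apply: exec_do => /=.
    by rewrite nget_dir //= /check e1 lte /= rput_dir.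
  + lia.
  + by rewrite view_rset_temp; [rewrite v1|exact: (wf_n_lt we)].
  + by rewrite /= /upd eqxx e1.
  + by apply: below_trans b1 _; exact: below_rset.
- case/andP=> w1 w2 /and3P[ok1 ok2 okd].
  have [t1 [st1 [x1 tt1 v1 e1' b1]]] := IH1 _ _ w1 ok1.
  rewrite -v1 in ok2.
  have [t2 [st2 [x2 tt2 v2 e2' b2]]] := IH2 _ _ w2 ok2.
  have hk := wf_r_lt w2.
  have h0 : (k < space)%N by apply: temp_lt; lia.
  have h1 : (k.+1 < space)%N by apply: temp_lt.
  have ek : rmem st2 k = evR (view st) e1.
    by have [_ ->] := b2 k (leqnn _).
  exists (t1 + (t2 + 1))%N,
    (rset st2 k (rop op (rmem st2 k) (rmem st2 k.+1))).
  split.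
  + apply: exec_seq x1 _; apply: exec_seq x2 _; apply: exec_do => /=.
    rewrite !rget_dir //= ek e2' v1.
    have -> : real_op_sem op (evR (view st) e1) (evR (view st) e2) =
      Some (rop op (evR (view st) e1) (evR (view st) e2)).
      by move: okd; case: (op) => //=; rewrite /check => ->.
    by rewrite /= rput_dir.
  + lia.
  + by rewrite view_rset_temp; [rewrite v2|lia].
  + by rewrite /= /upd eqxx e2' v1 ek.
  + apply: below_trans b1 _; apply: below_trans (below_leq (leqnSn k) b2) _.
    exact: below_rset.
Qed.

Lemma exec_comp_b b k st : wf_b k b -> okB (view st) b ->
  exists t st', [/\ exec (comp_b k b) st t st', (t <= time_b b)%N,
    view st' = view st, nmem st' k = evB (view st) b :> nat & below k st st'].
Proof.
elim: b k st => [e1 e2|e1 e2|e1 e2|e1 e2|b1 IH1 b2 IH2|b1 IH1] k st /=.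
1-4: case/andP=> w1 w2 /andP[ok1 ok2].
1-2: have [t1 [st1 [x1 tt1 v1 e1' b1]]] := exec_comp_n w1 ok1.
3-4: have [t1 [st1 [x1 tt1 v1 e1' b1]]] := exec_comp_r w1 ok1.
1-4: rewrite -v1 in ok2.
1-2: have [t2 [st2 [x2 tt2 v2 e2' b2]]] := exec_comp_n w2 ok2.
3-4: have [t2 [st2 [x2 tt2 v2 e2' b2]]] := exec_comp_r w2 ok2.
1-2: have hk := wf_n_lt w2.
3-4: have hk := wf_r_lt w2.
1-4: have h0 : (k < space)%N by apply: temp_lt; lia.
1-4: have h1 : (k.+1 < space)%N by apply: temp_lt.
1-4: have [bk1 bk2] := b2 k (leqnn _).
- exists (t1 + (t2 + 2))%N,
    (nset st2 k (evN (view st) e1 <= evN (view st) e2)%N).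
  split; [|lia|rewrite view_nset_temp; [by rewrite v2|lia]|by rewrite /= /upd eqxx|].
  + apply: exec_seq x1 _; apply: exec_seq x2 _.
    apply: (exec_if (v := (evN (view st) e1 <= evN (view st) e2)%N)).
      by rewrite /= !nget_dir //= bk1 e1' e2' v1.
    by case: leq; apply: exec_do; rewrite /= nput_dir.
  + apply: below_trans b1 _; apply: below_trans (below_leq (leqnSn k) b2) _.
    exact: below_nset.
- exists (t1 + (t2 + 2))%N,
    (nset st2 k (evN (view st) e1 < evN (view st) e2)%N).
  split; [|lia|rewrite view_nset_temp; [by rewrite v2|lia]|by rewrite /= /upd eqxx|].
  + apply: exec_seq x1 _; apply: exec_seq x2 _.
    apply: (exec_if (v := (evN (view st) e1 < evN (view st) e2)%N)).
      by rewrite /= !nget_dir //= bk1 e1' e2' v1.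
    by case: leq; apply: exec_do; rewrite /= nput_dir.
  + apply: below_trans b1 _; apply: below_trans (below_leq (leqnSn k) b2) _.
    exact: below_nset.
- exists (t1 + (t2 + 2))%N,
    (nset st2 k (evR (view st) e1 <= evR (view st) e2)%R).
  split; [|lia|rewrite view_nset_temp; [by rewrite v2|lia]|by rewrite /= /upd eqxx|].
  + apply: exec_seq x1 _; apply: exec_seq x2 _.
    apply: (exec_if (v := evR (view st) e1 <= evR (view st) e2)).
      by rewrite /= !rget_dir //= bk2 e1' e2' v1.
    by case: Order.le; apply: exec_do; rewrite /= nput_dir.
  + apply: below_trans b1 _; apply: below_trans (below_leq (leqnSn k) b2) _.
    exact: below_nset.
- exists (t1 + (t2 + 2))%N,
    (nset st2 k (evR (view st) e1 < evR (view st) e2)%R).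
  split; [|lia|rewrite view_nset_temp; [by rewrite v2|lia]|by rewrite /= /upd eqxx|].
  + apply: exec_seq x1 _; apply: exec_seq x2 _.
    apply: (exec_if (v := evR (view st) e1 < evR (view st) e2)).
      by rewrite /= !rget_dir //= bk2 e1' e2' v1.
    by case: Order.lt; apply: exec_do; rewrite /= nput_dir.
  + apply: below_trans b1 _; apply: below_trans (below_leq (leqnSn k) b2) _.
    exact: below_nset.
- case/andP=> w1 w2 /andP[ok1 ok2].
  have [t1 [st1 [x1 tt1 v1 e1' bb1]]] := IH1 _ _ w1 ok1.
  rewrite -v1 in ok2.
  have [t2 [st2 [x2 tt2 v2 e2' bb2]]] := IH2 _ _ w2 ok2.
  have hk := wf_b_lt w2.
  have h0 : (k < space)%N by apply: temp_lt; lia.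
  have h1 : (k.+1 < space)%N by apply: temp_lt.
  have [bk1 _] := bb2 k (leqnn _).
  exists (t1 + (t2 + 1))%N, (nset st2 k (evB (view st) b1 && evB (view st) b2)).
  split; [|lia|rewrite view_nset_temp; [by rewrite v2|lia]|by rewrite /= /upd eqxx|].
  + apply: exec_seq x1 _; apply: exec_seq x2 _; apply: exec_do => /=.
    by rewrite !nget_dir //= bk1 e1' e2' v1 nput_dir // mulnb.
  + apply: below_trans bb1 _; apply: below_trans (below_leq (leqnSn k) bb2) _.
    exact: below_nset.
- case/andP=> w1 hk ok1.
  have [t1 [st1 [x1 tt1 v1 e1' bb1]]] := IH1 _ _ w1 ok1.
  have h0 : (k < space)%N by apply: temp_lt; lia.
  have h1 : (k.+1 < space)%N by apply: temp_lt.
  exists (t1 + (1 + 1))%N, (nset (nset st1 k.+1 1%N) k (~~ evB (view st) b1)).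
  split; [|lia| |by rewrite /= /upd eqxx|].
  + apply: exec_seq x1 _; apply: (exec_seq (st1 := nset st1 k.+1 1%N)).
      by apply: exec_do; rewrite /= nput_dir.
    apply: exec_do; rewrite /= !nget_dir //= /upd eqxx ifN; last by apply/eqP; lia.
    by rewrite e1' nput_dir //; case: evB.
  + by rewrite !view_nset_temp; [rewrite v1|lia|lia].
  + apply: below_trans bb1 _; apply: below_trans (_ : below _ _ (nset st1 k.+1 1%N)) _.
      exact: below_nset.
    exact: below_nset.
Qed.

Lemma exec_comp_cond b st : wf_b 0 b -> okB (view st) b ->
  exists t st', [/\ exec (comp_cond b) st t st', (t <= (time_b b).+1)%N,
    view st' = view st &
    test_sem space (NLe (Dir 1) (Dir 0)) st' = Some (evB (view st) b)].
Proof.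
move=> wb ob; have [t [st1 [x1 tt1 v1 e1 _]]] := exec_comp_b wb ob.
have h0 : (0 < space)%N by exact: temp_lt.
have h1 : (1 < space)%N by exact: temp_lt.
exists (t + 1)%N, (nset st1 1 1%N); split.
- by apply: exec_seq x1 _; apply: exec_do; rewrite /= nput_dir.
- lia.
- by rewrite view_nset_temp.
- by rewrite /= !nget_dir //= /upd /= e1; case: evB.
Qed.

Lemma exec_store_n st a i x : wf_n 1 i -> (a < ncol)%N -> okN (view st) i ->
  (evN (view st) i < height)%N -> nmem st 0 = x ->
  exists t st', [/\ exec (Seq (comp_n 1 i) (Seq (mul_ncol 1 a)
       (Do (NMove (Ind 1) (Dir 0))))) st t st', (t <= time_n i + 5)%N &
       view st' = setN (view st) a (evN (view st) i) x].
Proof.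
move=> wi ha oi hi ex.
have [t [st1 [x1 t1 v1 e1 b1]]] := exec_comp_n wi oi.
have [st2 [x2 v2 e2 b2]] := exec_mul_ncol (k := 1) a isT e1.
have h0 : (0 < space)%N by exact: temp_lt.
have h1 : (1 < space)%N by exact: temp_lt.
have hc := cell_lt ha hi.
exists (t + (4 + 1))%N, (nset st2 (cell a (evN (view st) i)) x); split.
- apply: exec_seq x1 _; apply: exec_seq x2 _; apply: exec_do => /=.
  have [b20 _] := b2 0%N isT; have [b10 _] := b1 0%N isT.
  by rewrite nget_dir //= b20 b10 ex /nput (addr_ind h1 e2 hc).
- lia.
- by rewrite view_nset // v2 v1.
Qed.

Lemma exec_store_r st a i x : wf_n 1 i -> (a < ncol)%N -> okN (view st) i ->
  (evN (view st) i < height)%N -> rmem st 0 = x ->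
  exists t st', [/\ exec (Seq (comp_n 1 i) (Seq (mul_ncol 1 a)
       (Do (RMove (Ind 1) (Dir 0))))) st t st', (t <= time_n i + 5)%N &
       view st' = setR (view st) a (evN (view st) i) x].
Proof.
move=> wi ha oi hi ex.
have [t [st1 [x1 t1 v1 e1 b1]]] := exec_comp_n wi oi.
have [st2 [x2 v2 e2 b2]] := exec_mul_ncol (k := 1) a isT e1.
have h0 : (0 < space)%N by exact: temp_lt.
have h1 : (1 < space)%N by exact: temp_lt.
have hc := cell_lt ha hi.
exists (t + (4 + 1))%N, (rset st2 (cell a (evN (view st) i)) x); split.
- apply: exec_seq x1 _; apply: exec_seq x2 _; apply: exec_do => /=.
  have [_ b20] := b2 0%N isT; have [_ b10] := b1 0%N isT.
  by rewrite rget_dir //= b20 b10 ex /rput (addr_ind h1 e2 hc).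
- lia.
- by rewrite view_rset // v2 v1.
Qed.

Lemma rgets_coef st a d : (a < ncol)%N -> (d <= height)%N ->
  rgets space st (coef_cells a d) =
  Some [seq ra (view st) a i | i <- iota 0 d].
Proof.
move=> ha hd; rewrite /coef_cells.
have : all (fun i => (i < height)%N) (iota 0 d).
  by apply/allP => i; rewrite mem_iota => ?; lia.
elim: (iota 0 d) => [//|i s IH] /= /andP[hi hs].
by rewrite IH // /rget /= /check cell_lt //= ha.
Qed.

Lemma Poly_coef h a d : Poly [seq ra h a i | i <- iota 0 d] = colpoly h a d :> {poly R}.
Proof.
apply/polyP => i; rewrite coef_Poly coef_poly; case: ltnP => hi.
  by rewrite (nth_map 0%N) ?size_iota // nth_iota.
by rewrite nth_default // size_map size_iota.
Qed.

Lemma rgets_colpoly st a d : (a < ncol)%N -> (d <= height)%N ->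
  exists2 cs, rgets space st (coef_cells a d) = Some cs &
    Poly cs = colpoly (view st) a d.
Proof.
move=> ha hd; exists [seq ra (view st) a i | i <- iota 0 d].
  exact: rgets_coef.
exact: Poly_coef.
Qed.

Lemma exec_seqE p q st t st' : exec (Seq p q) st t st' ->
  exists t1 t2 st1, [/\ exec p st t1 st1, exec q st1 t2 st' & t = (t1 + t2)%N].
Proof. by move=> x; inversion x; subst; do 3 eexists; split; eauto. Qed.

(** Induction on the source execution. Linearity in [t] makes the constant independent of the number
    of iterations. *)
Theorem compile_correct c h t h' st : hx height input c h t h' -> wf c ->
  view st = h -> exists t' st', [/\ exec (compile c) st t' st',
    (t' <= slowdown c * t)%N & view st' = h'].
Proof.
move=> H; elim: H st => {c h t h'}.
- move=> a i e h oe oi hi st /= /and3P[we wi ha] vst; subst h.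
  have [t1 [st1 [x1 tt1 v1 e1 b1]]] := exec_comp_n we oe.
  rewrite -v1 in oi hi *.
  have [t2 [st2 [x2 tt2 v2]]] := exec_store_n wi ha oi hi e1.
  exists (t1 + t2)%N, st2; split; [by apply: exec_seq x1 x2|lia|].
  by rewrite v2 v1.
- move=> a i e h oe oi hi st /= /and3P[we wi ha] vst; subst h.
  have [t1 [st1 [x1 tt1 v1 e1 b1]]] := exec_comp_r we oe.
  rewrite -v1 in oi hi *.
  have [t2 [st2 [x2 tt2 v2]]] := exec_store_r wi ha oi hi e1.
  exists (t1 + t2)%N, st2; split; [by apply: exec_seq x1 x2|lia|].
  by rewrite v2 v1.
- move=> v a d h h0 hd nz st /andP[hv ha] vst; subst h.
  exists 1%N, (nset st (cell v 0) (size (rootsR (colpoly (view st) a d)))).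
  split=> //; last by rewrite view_nset.
  have [cs ecs pcs] := rgets_colpoly st ha hd.
  apply: exec_do; rewrite /= ecs /= pcs /check nz /=.
  by rewrite nput_dir // cell_lt.
- move=> v k a d h h0 hd nz hk st /andP[hv ha] vst; subst h.
  exists 1%N, (rset st (cell v 0) (nth 0 (rootsR (colpoly (view st) a d)) k)).
  split=> //; last by rewrite view_rset.
  have [cs ecs pcs] := rgets_colpoly st ha hd.
  apply: exec_do; rewrite /= ecs /= pcs /check nz hk /=.
  by rewrite rput_dir // cell_lt.
- move=> v a h h0 hac st /andP[hv ha] vst; subst h.
  exists 1%N, (rset st (cell v 0) (acos (rmem st (cell a 0)))).
  split=> //; last by rewrite view_rset //= ha.
  apply: exec_do; rewrite /= rget_dir ?cell_lt //=.
  move: hac; rewrite /= ha => hac.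
  by rewrite /check hac /= rput_dir // cell_lt.
- move=> h st _ vst; exists 0%N, st; split=> //; exact: exec_skip.
- move=> p q h h1 h2 t1 t2 _ IH1 _ IH2 st /= /andP[wp wq] vst.
  have [t1' [st1 [x1 tt1 v1]]] := IH1 st wp vst.
  have [t2' [st2 [x2 tt2 v2]]] := IH2 st1 wq v1.
  exists (t1' + t2')%N, st2; split=> //; first exact: exec_seq x1 x2.
  rewrite mulnDr leq_add //.
    by apply: leq_trans tt1 _; rewrite leq_mul2r leq_maxl orbT.
  by apply: leq_trans tt2 _; rewrite leq_mul2r leq_maxr orbT.
- move=> b p q h h' t ob _ IH st /= /and3P[wb wp wq] vst; subst h.
  have [t0 [st0 [x0 tt0 v0 tb]]] := exec_comp_cond wb ob.
  have [t1 [st1 [x1 tt1 v1]]] :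
      exists t' st', [/\ exec (if evB (view st) b then compile p else compile q)
         st0 t' st', (t' <= maxn (slowdown p) (slowdown q) * t)%N & view st' = h'].
    have [|t' [st' [x' l' v']]] := IH st0 _ v0; first by case: ifP.
    exists t', st'; split=> //; first by move: x'; case: ifP.
    by apply: leq_trans l' _; rewrite leq_mul2r; case: ifP => _;
       rewrite ?leq_maxl ?leq_maxr ?orbT.
  exists (t0 + t1.+1)%N, st1; split=> //.
    by apply: exec_seq x0 _; apply: exec_if tb _.
  have : (t1 <= maxn (time_b b + 2) (maxn (slowdown p) (slowdown q)) * t)%N.
    by apply: leq_trans tt1 _; rewrite leq_mul2r leq_maxr orbT.
  have := leq_maxl (time_b b + 2)%N (maxn (slowdown p) (slowdown q)).
  rewrite mulnS; lia.
- move=> b p h ob eb st /= /andP[wb wp] vst; subst h.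
  have [t0 [st0 [x0 tt0 v0 tb]]] := exec_comp_cond wb ob.
  exists (t0 + 1)%N, st0; split=> //.
    by apply: exec_seq x0 _; apply: exec_while_false; rewrite tb eb.
  have := leq_maxl (time_b b + 2)%N (slowdown p); lia.
- move=> b p h h1 h2 t1 t2 ob eb _ IH1 _ IH2 st /= w vst; subst h.
  have /andP[wb wp] := w.
  have [t0 [st0 [x0 tt0 v0 tb]]] := exec_comp_cond wb ob.
  have [t1' [st1 [x1 tt1 v1]]] := IH1 st0 wp v0.
  have [t2' [st2 [x2 tt2 v2]]] := IH2 st1 w v1.
  (* The induction hypothesis provides the condition code followed by the loop; this first run of
     the condition is cut off and becomes the end of the present iteration. *)
  have [ta [tb' [st3 [xa xb et2]]]] := exec_seqE x2.
  exists (t0 + ((t1' + ta) + tb').+1)%N, st2; split=> //.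
    apply: exec_seq x0 _; apply: exec_while_true; first by rewrite tb eb.
      exact: exec_seq x1 xa.
    exact: xb.
  have : (t1' <= maxn (time_b b + 2) (slowdown p) * t1)%N.
    by apply: leq_trans tt1 _; rewrite leq_mul2r leq_maxr orbT.
  rewrite /= in tt2; move: tt2 (leq_maxl (time_b b + 2)%N (slowdown p)).
  move: (maxn _ _) => K; rewrite mulnS mulnDr et2.
  by move: (K * t1)%N (K * t2)%N => kt1 kt2; lia.
Qed.

End Correctness.

(** * Program logic *)

Notation "p ;; q" := (CSeq p q) (at level 61, right associativity).

Definition For (v : nat) (e : nexp) (body : cmd) : cmd :=
  CN v (NK 0) (NK 0);;
  CWhile (BNlt (NV v (NK 0)) e)
    (body ;; CN v (NK 0) (NB NAdd (NV v (NK 0)) (NK 1))).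

Section Triples.
Variables (R : realType) (height : nat) (input : seq R).
Implicit Types (h g : memory R) (Q I : memory R -> Prop).
Local Notation hx := (hx height input).
Local Notation okN := (okN height).
Local Notation okR := (okR height input).
Local Notation okB := (okB height input).
Local Notation evR := (evR input).
Local Notation evB := (evB input).

Definition run (c : cmd) h (T : nat) Q : Prop :=
  exists t h', [/\ hx c h t h', (t <= T)%N & Q h'].

Lemma agree_refl c h : agree c h h.
Proof. by split. Qed.

Lemma agree_trans c h1 h2 h3 : agree c h1 h2 -> agree c h2 h3 -> agree c h1 h3.
Proof.
move=> [n1 r1] [n2 r2]; split=> a ha; first by rewrite n2 // n1.
by rewrite r2 // r1.
Qed.

Lemma agree_sub c c' h h' :
  (forall a, writes_n c a -> writes_n c' a) ->
  (forall a, writes_r c a -> writes_r c' a) -> agree c h h' -> agree c' h h'.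
Proof.
move=> sn sr [n r]; split=> a ha.
  by apply: n; apply: contra ha => /sn.
by apply: r; apply: contra ha => /sr.
Qed.

Lemma run_weaken c h T T' Q Q' : run c h T Q -> (T <= T')%N ->
  (forall h', Q h' -> agree c h h' -> Q' h') -> run c h T' Q'.
Proof.
move=> [t [h' [x tT q]]] TT' H; exists t, h'; split=> //.
  exact: leq_trans tT TT'.
by apply: H q _; exact: hx_agree x.
Qed.

Lemma run_seq p q h T1 T2 Q :
  run p h T1 (fun h1 => agree p h h1 -> run q h1 T2 Q) ->
  run (p ;; q) h (T1 + T2) Q.
Proof.
move=> [t1 [h1 [x1 l1]]] /(_ (hx_agree x1)) [t2 [h2 [x2 l2 q2]]].
by exists (t1 + t2)%N, h2; split; [exact: hx_seq x1 x2|exact: leq_add|].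
Qed.

(** Computes through straight-line blocks only. Loops get [False] and are handled by [run_while] and
    [run_for]. *)
Fixpoint wp (c : cmd) Q h : Prop :=
  match c with
  | CN a i e =>
      [/\ okN h e, okN h i, (evN h i < height)%N & Q (setN h a (evN h i) (evN h e))]
  | CR a i e =>
      [/\ okR h e, okN h i, (evN h i < height)%N & Q (setR h a (evN h i) (evR h e))]
  | CCount v a d =>
      [/\ (0 < height)%N, (d <= height)%N, colpoly h a d != 0 &
          Q (setN h v 0 (size (rootsR (colpoly h a d))))]
  | CRoot v k a d =>
      [/\ (0 < height)%N, (d <= height)%N, colpoly h a d != 0,
          (k < size (rootsR (colpoly h a d)))%N &
          Q (setR h v 0 (nth 0 (rootsR (colpoly h a d)) k))]
  | CAcos v a =>
      [/\ (0 < height)%N, -1 <= ra h a 0%N <= 1 & Q (setR h v 0 (acos (ra h a 0%N)))]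
  | CSkip => Q h
  | p ;; q => wp p (wp q Q) h
  | CIf b p q =>
      [/\ okB h b, evB h b -> wp p Q h & ~~ evB h b -> wp q Q h]
  | CWhile _ _ => False
  end.

Fixpoint steps (c : cmd) : nat :=
  match c with
  | CSkip => 0
  | p ;; q => steps p + steps q
  | CIf _ p q => (steps p + steps q).+1
  | _ => 1
  end.

Lemma wp_run c h Q : wp c Q h -> run c h (steps c) Q.
Proof.
elim: c h Q => [a i e|a i e|v a d|v k a d|v a||p IHp q IHq|b p IHp q IHq|//] h Q /=.
- by case=> *; eexists _, _; split; first exact: hx_n.
- by case=> *; eexists _, _; split; first exact: hx_r.
- by case=> *; eexists _, _; split; first exact: hx_count.
- by case=> *; eexists _, _; split; first exact: hx_root.
- by case=> *; eexists _, _; split; first exact: hx_acos.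
- by move=> *; eexists _, _; split; first exact: hx_skip.
- by move/IHp => r; apply: run_seq; apply: run_weaken r _ _ => // h' /IHq.
- case=> ob wt wf; have : run (if evB h b then p else q) h (steps p + steps q) Q.
    case: ifP => [/wt|/negbT/wf] w.
      by apply: run_weaken (IHp _ _ w) _ _ => //; exact: leq_addr.
    by apply: run_weaken (IHq _ _ w) _ _ => //; exact: leq_addl.
  move=> [t [h' [x l q']]]; exists t.+1, h'; split=> //; exact: hx_if.
Qed.

Lemma wp_seq p q h T Q1 Q : wp p Q1 h ->
  (forall g, Q1 g -> agree p h g -> run q g T Q) -> run (p ;; q) h (steps p + T) Q.
Proof.
move=> w H; apply: run_seq; apply: run_weaken (wp_run w) _ _ => // g q1 ag _.
exact: H.
Qed.

Lemma call_seq p q h T1 T2 Q1 Q : run p h T1 Q1 ->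
  (forall g, Q1 g -> agree p h g -> run q g T2 Q) -> run (p ;; q) h (T1 + T2) Q.
Proof.
move=> r H; apply: run_seq; apply: run_weaken r _ _ => // g q1 ag _; exact: H.
Qed.

Lemma run_if b p q h T Q : okB h b ->
  (evB h b -> run p h T Q) -> (~~ evB h b -> run q h T Q) ->
  run (CIf b p q) h T.+1 Q.
Proof.
move=> ob rt rf; have : run (if evB h b then p else q) h T Q.
  by case: ifP => [/rt|/negbT/rf].
by move=> [t [h' [x l q']]]; exists t.+1, h'; split=> //; exact: hx_if.
Qed.

(* [cost] bounds the number of steps that remain, hence decreases. *)
Lemma run_while b p I (cost : memory R -> nat) h Q : I h ->
  (forall g, I g -> agree (CWhile b p) h g -> okB g b) ->
  (forall g, I g -> agree (CWhile b p) h g -> evB g b ->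
     exists T, run p g T (fun g' => I g' /\ (T + cost g' < cost g)%N)) ->
  (forall g, I g -> agree (CWhile b p) h g -> ~~ evB g b -> Q g) ->
  run (CWhile b p) h (cost h).+1 Q.
Proof.
move=> Ih okb step stop.
suff H n : forall g, (cost g < n)%N -> I g -> agree (CWhile b p) h g ->
    run (CWhile b p) g (cost g).+1 Q.
  by apply: H (leqnn _) Ih _; exact: agree_refl.
elim: n => // n IHn g lgn Ig ag; case eb: (evB g b).
  have [T [t [g' [x lt [Ig' lT]]]]] := step g Ig ag eb.
  have ag' : agree (CWhile b p) h g' by apply: agree_trans ag _; exact: (hx_agree x).
  have [|t' [g'' [x' lt' q]]] := IHn g' _ Ig' ag'; first by lia.
  exists (t + t').+1, g''; split=> //; last by lia.
  by apply: hx_while1 x x' => //; exact: okb.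
exists 1%N, g; split=> //; first by apply: hx_while0 => //; exact: okb.
by apply: stop => //; rewrite eb.
Qed.

(** The bound [e] need only keep its value on memories that agree with [h] off the written columns.
    Each iteration pays for its test and the increment; the final 2 are the initialization and the
    failing test. *)
Lemma run_for v e body N T (I : nat -> memory R -> Prop) h Q : (0 < height)%N ->
  ~~ writes_n body v ->
  (forall g, agree (For v e body) h g -> okN g e /\ evN g e = N) ->
  I 0%N (setN h v 0 0) ->
  (forall k g, (k < N)%N -> I k g -> na g v 0%N = k -> agree (For v e body) h g ->
     run body g T (fun g' => I k.+1 (setN g' v 0 k.+1))) ->
  (forall g, I N g -> na g v 0%N = N -> agree (For v e body) h g -> Q g) ->
  run (For v e body) h (N * (T + 2) + 2) Q.
Proof.
move=> h0 nv he I0 step stop.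
set h1 := setN h v 0 0.
have ag1 : agree (For v e body) h h1.
  split=> a //=; rewrite negb_or => /andP[/negbTE nav _].
  by apply/funext => j; rewrite nav.
have agw g : agree (CWhile (BNlt (NV v (NK 0)) e)
    (body;; CN v (NK 0) (NB NAdd (NV v (NK 0)) (NK 1)))) h1 g ->
    agree (For v e body) h g.
  move=> ag; apply: agree_trans ag1 _; apply: agree_sub ag => a /=.
    by move=> /orP[->|->]; rewrite ?orbT.
  by move=> ->.
have -> : (N * (T + 2) + 2 = 1 + (N * (T + 2)).+1)%N by lia.
apply: run_seq; exists 1%N, h1; split=> //; first exact: hx_n.
move=> _.
pose J g := (na g v 0 <= N)%N /\ I (na g v 0%N) g.
apply: run_weaken.
- apply: (@run_while _ _ J (fun g => ((N - na g v 0) * (T + 2))%N) _ Q).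
  + by rewrite /J /= !eqxx.
  + by move=> g _ /agw/he[oe _]; rewrite /= h0 oe.
  + move=> g [_ Ig] /agw ag /=; have [_ ->] := he g ag => lt.
    exists (T + 1)%N; apply: run_seq.
    apply: run_weaken (step _ _ lt Ig erefl ag) _ _ => // g' Ig' agb _.
    have env : na g' v 0%N = na g v 0%N by rewrite (proj1 agb).
    exists 1%N, (setN g' v 0 (na g v 0).+1); split=> //.
      have := @hx_n R height input v (NK 0) (NB NAdd (NV v (NK 0)) (NK 1)) g'.
      by rewrite /= env addn1 h0; apply.
    rewrite /J /= !eqxx; split=> //.
    have -> : (N - na g v 0 = (N - (na g v 0).+1).+1)%N by lia.
    by rewrite /= mulSn; lia.
  + move=> g [le Ig] /agw ag /=; have [_ ->] := he g ag; rewrite -leqNgt => ge.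
    have eN : na g v 0%N = N by apply/eqP; rewrite eqn_leq le ge.
    by apply: stop => //; rewrite -{1}eN.
- by rewrite /= !eqxx subn0.
- by [].
Qed.

End Triples.

(** * The region bounded by a polygon *)

Section Plane.
Variable R : realType.
Implicit Types (p q z : R * R).

Definition cross p q z : R :=
  (q.1 - p.1) * (z.2 - p.2) - (q.2 - p.2) * (z.1 - p.1).

(** The scalar product of [z - p] and [z - q]. On the line through [p] and [q] it is nonpositive
    exactly between them, and for [p = q] it is the squared distance, so degenerate segments need no
    separate definition. *)
Definition dot p q z : R := (z.1 - p.1) * (z.1 - q.1) + (z.2 - p.2) * (z.2 - q.2).

Definition on p q z : bool := (cross p q z == 0) && (dot p q z <= 0).

(* The ray from [z] in the direction of the first axis crosses [p, q].  The
   strictness of the comparisons makes a vertex on the ray count once. *)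
Definition hit p q z : bool :=
  [&& z.2 < p.2, q.2 <= z.2 & cross p q z < 0] ||
  [&& z.2 < q.2, p.2 <= z.2 & 0 < cross p q z].

Lemma crossE p q z :
  cross p q z = (p.1 - z.1) * (q.2 - z.2) - (p.2 - z.2) * (q.1 - z.1).
Proof. by rewrite /cross; ring. Qed.

Lemma segmentP p q z : segment p q z <-> on p q z.
Proof.
split.
  move=> [t /=]; rewrite in_itv /= => /andP[t0 t1] <-.
  rewrite /on /affine_comb /cross /dot /=; apply/andP; split.
    by apply/eqP; ring.
  set d1 := q.1 - p.1; set d2 := q.2 - p.2.
  have -> : (p.1 + t * d1 - p.1) * (p.1 + t * d1 - q.1) +
            (p.2 + t * d2 - p.2) * (p.2 + t * d2 - q.2) =
            - (t * (1 - t) * (d1 ^+ 2 + d2 ^+ 2)) by rewrite /d1 /d2; ring.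
  rewrite oppr_le0 mulr_ge0 ?mulr_ge0 ?subr_ge0 //.
  by rewrite addr_ge0 ?sqr_ge0.
rewrite /on /cross /dot => /andP[/eqP c0 d0].
case: p q z c0 d0 => [p1 p2] [q1 q2] [z1 z2] /= c0 d0.
set a := q1 - p1; set b := q2 - p2.
have [ab0|ab0] := eqVneq (a ^+ 2 + b ^+ 2) 0.
  have a0 : a = 0.
    by apply/eqP; rewrite -sqrf_eq0 eq_le sqr_ge0 -ab0 lerDl sqr_ge0.
  have b0 : b = 0.
    by apply/eqP; rewrite -sqrf_eq0 eq_le sqr_ge0 -ab0 lerDr sqr_ge0.
  have eq1 : q1 = p1 by move: a0; rewrite /a; lra.
  have eq2 : q2 = p2 by move: b0; rewrite /b; lra.
  subst q1 q2; exists 0; first by rewrite /= in_itv /= lexx ler01.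
  have s0 : (z1 - p1) ^+ 2 + (z2 - p2) ^+ 2 <= 0 by rewrite !expr2.
  have e1 : z1 - p1 = 0.
    apply/eqP; rewrite -sqrf_eq0 eq_le sqr_ge0 andbT.
    by apply: le_trans s0; rewrite lerDl sqr_ge0.
  have e2 : z2 - p2 = 0.
    apply/eqP; rewrite -sqrf_eq0 eq_le sqr_ge0 andbT.
    by apply: le_trans s0; rewrite lerDr sqr_ge0.
  by rewrite /affine_comb /=; congr pair; lra.
(* The parameter of the orthogonal projection of [z] to the line; collinearity makes [z] its own
   projection. *)
pose t := ((z1 - p1) * a + (z2 - p2) * b) / (a ^+ 2 + b ^+ 2).
have abp : 0 < a ^+ 2 + b ^+ 2 by rewrite lt_def ab0 addr_ge0 ?sqr_ge0.
have c0' : a * (z2 - p2) - b * (z1 - p1) = 0 by [].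
have e1 : z1 - p1 = t * a.
  apply: (mulIf ab0); rewrite /t mulrAC divfK //.
  by rewrite -[LHS]addr0 -[X in _ + X](mulr0 b) -c0'; ring.
have e2 : z2 - p2 = t * b.
  apply: (mulIf ab0); rewrite /t mulrAC divfK //.
  by rewrite -[LHS]addr0 -[X in _ + X](mulr0 (- a)) -c0'; ring.
have : (a ^+ 2 + b ^+ 2) * (t * (t - 1)) <= 0.
  have <- : (z1 - p1) * (z1 - q1) + (z2 - p2) * (z2 - q2) =
     (a ^+ 2 + b ^+ 2) * (t * (t - 1)).
    have -> : z1 - q1 = z1 - p1 - a by rewrite /a; ring.
    have -> : z2 - q2 = z2 - p2 - b by rewrite /b; ring.
    by rewrite e1 e2; ring.
  by [].
rewrite pmulr_rle0 // => tt.
exists t; last by rewrite /affine_comb /= -/a -/b -e1 -e2; congr pair; ring.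
rewrite /= in_itv /=.
by apply/andP; split; rewrite leNgt; apply/negP => ?; nra.
Qed.

Lemma near_planeP z0 (P : R * R -> Prop) :
  (\forall z \near z0, P z) <->
  exists2 e, 0 < e & forall z, `|z.1 - z0.1| < e -> `|z.2 - z0.2| < e -> P z.
Proof.
split.
  move/nbhs_ballP => [e e0 H]; exists e => // z h1 h2; apply: H.
  by split; rewrite /ball /= distrC.
move=> [e e0 H]; apply/nbhs_ballP; exists e => // z [h1 h2]; apply: H.
  by move: h1; rewrite /ball /= distrC.
by move: h2; rewrite /ball /= distrC.
Qed.

Lemma cross_continuous p q : continuous (cross p q).
Proof.
move=> z; apply: cvgB; apply: cvgM; try exact: cvg_cst; apply: cvgB.
- exact: cvg_snd.
- exact: cvg_cst.
- exact: cvg_fst.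
- exact: cvg_cst.
Qed.

Lemma dot_continuous p q : continuous (dot p q).
Proof.
move=> z; apply: cvgD; apply: cvgM; apply: cvgB;
  try exact: cvg_cst; by [exact: cvg_snd|exact: cvg_fst].
Qed.

Lemma near_lt (f : R * R -> R) z0 c : continuous f -> f z0 < c ->
  \forall z \near z0, f z < c.
Proof. by move=> cf fc; exact: (cvgr_lt _ (cf z0) _ fc). Qed.

Lemma near_gt (f : R * R -> R) z0 c : continuous f -> c < f z0 ->
  \forall z \near z0, c < f z.
Proof. by move=> cf fc; exact: (cvgr_gt _ (cf z0) _ fc). Qed.

Lemma snd_continuous : continuous (snd : R * R -> R).
Proof. by move=> z; exact: cvg_snd. Qed.

Lemma near_sg (f : R * R -> R) z0 : continuous f -> f z0 != 0 ->
  \forall z \near z0, (f z < 0) = (f z0 < 0) /\ (0 < f z) = (0 < f z0).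
Proof.
move=> cf; rewrite neq_lt => /orP[h|h].
  near=> z; have fz : f z < 0 by near: z; exact: near_lt.
  by rewrite fz h !ltNge !ltW.
near=> z; have fz : 0 < f z by near: z; exact: near_gt.
by rewrite fz h !ltNge !ltW.
Unshelve. all: by end_near. Qed.

Lemma near_on p q z0 : ~~ on p q z0 -> \forall z \near z0, ~~ on p q z.
Proof.
rewrite /on negb_and => /orP[h|].
  have := near_sg (@cross_continuous p q) h; apply: filterS => z [h1 h2].
  by rewrite negb_and neq_lt h1 h2 -neq_lt h.
rewrite -ltNge => h.
have := near_gt (@dot_continuous p q) h; apply: filterS => z h1.
by rewrite negb_and -ltNge h1 orbT.
Qed.

Lemma near_height (c : R) z0 : z0.2 != c ->
  \forall z \near z0, ((z.2 < c) = (z0.2 < c)) /\ ((c <= z.2) = (c <= z0.2)).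
Proof.
rewrite neq_lt => /orP[h|h].
  have := near_lt snd_continuous h; apply: filterS => z hz.
  by rewrite hz h !leNgt hz h.
have := near_gt snd_continuous h; apply: filterS => z hz.
by rewrite !ltNge !ltW.
Qed.

(* Adding the two vertex terms makes the contribution of an edge locally
   constant off this edge, also when the ray meets an end of the edge. *)
Lemma near_hit p q z0 : ~~ on p q z0 ->
  exists b : bool, \forall z \near z0,
   hit p q z (+) ((z0.1 < p.1) && (z.2 < p.2)) (+)
                 ((z0.1 < q.1) && (z.2 < q.2)) = b.
Proof.
move=> non.
have [ep|np] := eqVneq z0.2 p.2; have [eq|nq] := eqVneq z0.2 q.2.
- exists false; near=> z.
  have -> : hit p q z = false.
    by rewrite /hit -ep -eq; case: (ltP z.2 z0.2); rewrite ?andbF.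
  have c0 : cross p q z0 = 0 by rewrite crossE -ep -eq; ring.
  move: non; rewrite /on c0 eqxx /= -ltNge /dot -ep -eq => d0.
  (* Both ends have the height of [z0], which is not between them, so they lie on the same side of
     it and the two vertex terms cancel. *)
  have -> : (z0.1 < p.1) = (z0.1 < q.1).
    by apply/idP/idP => h; nra.
  by rewrite addbb.
- have np1 : z0.1 != p.1.
    apply: contra non => /eqP e1; rewrite /on /cross /dot e1 ep.
    by rewrite !subrr !mulr0 subrr eqxx !mul0r addr0 lexx.
  have cE : cross p q z0 = (p.1 - z0.1) * (q.2 - z0.2) by rewrite crossE -ep; ring.
  have cn : cross p q z0 != 0 by rewrite cE mulf_neq0 // subr_eq0 eq_sym.
  exists (if z0.2 < q.2 then (z0.1 < p.1) (+) (z0.1 < q.1) else false).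
  near=> z.
  have [c1 c2] : (cross p q z < 0) = (cross p q z0 < 0) /\
                 (0 < cross p q z) = (0 < cross p q z0).
    by near: z; exact: near_sg (@cross_continuous p q) cn.
  have [h1 h2] : (z.2 < q.2) = (z0.2 < q.2) /\ (q.2 <= z.2) = (q.2 <= z0.2).
    by near: z; exact: near_height.
  rewrite /hit c1 c2 h1 h2 cE (leNgt p.2) (leNgt q.2).
  case: ifP => hq.
    have q0 : 0 < q.2 - z0.2 by rewrite subr_gt0.
    rewrite (pmulr_llt0 _ q0) (pmulr_lgt0 _ q0) subr_lt0 subr_gt0 /= andbF.
    by case: (z.2 < p.2); case: (z0.1 < p.1); case: (z0.1 < q.1).
  have q0 : q.2 - z0.2 < 0 by rewrite subr_lt0 lt_neqAle eq_sym nq leNgt hq.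
  rewrite (nmulr_llt0 _ q0) subr_gt0 /= andbF orbF.
  by case: (z.2 < p.2); case: (z0.1 < p.1).
- have nq1 : z0.1 != q.1.
    apply: contra non => /eqP e1; rewrite /on crossE /dot e1 eq.
    by rewrite !subrr !mulr0 subrr eqxx !addr0 lexx.
  have cE : cross p q z0 = - ((p.2 - z0.2) * (q.1 - z0.1)).
    by rewrite crossE -eq; ring.
  have cn : cross p q z0 != 0.
    by rewrite cE oppr_eq0 mulf_neq0 // subr_eq0 eq_sym.
  exists (if z0.2 < p.2 then (z0.1 < p.1) (+) (z0.1 < q.1) else false).
  near=> z.
  have [c1 c2] : (cross p q z < 0) = (cross p q z0 < 0) /\
                 (0 < cross p q z) = (0 < cross p q z0).
    by near: z; exact: near_sg (@cross_continuous p q) cn.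
  have [h1 h2] : (z.2 < p.2) = (z0.2 < p.2) /\ (p.2 <= z.2) = (p.2 <= z0.2).
    by near: z; exact: near_height.
  rewrite /hit c1 c2 h1 h2 cE oppr_lt0 oppr_gt0 (leNgt p.2) (leNgt q.2).
  case: ifP => hq.
    have q0 : 0 < p.2 - z0.2 by rewrite subr_gt0.
    rewrite (pmulr_rgt0 _ q0) subr_gt0 /= andbF.
    by case: (z.2 < q.2); case: (z0.1 < p.1); case: (z0.1 < q.1).
  have q0 : p.2 - z0.2 < 0 by rewrite subr_lt0 lt_neqAle eq_sym np leNgt hq.
  rewrite (nmulr_rlt0 _ q0) subr_gt0 /= andbF.
  by case: (z.2 < q.2); case: (z0.1 < q.1).
- case eb: (((z0.2 < p.2) && (q.2 <= z0.2)) || ((z0.2 < q.2) && (p.2 <= z0.2))).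
    (* The height of [z0] is strictly between those of the ends, so a vanishing cross product would
       put [z0] on the edge. *)
    have cn : cross p q z0 != 0.
      apply: contra non; rewrite /on => /eqP c0; rewrite c0 eqxx /= /dot.
      have AD : (p.1 - z0.1) * (q.2 - z0.2) = (p.2 - z0.2) * (q.1 - z0.1).
        by apply/eqP; rewrite -subr_eq0 -crossE c0.
      have CD : (p.2 - z0.2) * (q.2 - z0.2) < 0.
        case/orP: eb => /andP[h1 h2].
          by rewrite pmulr_rlt0 ?subr_gt0 // subr_lt0 lt_neqAle eq_sym nq.
        by rewrite pmulr_llt0 ?subr_gt0 // subr_lt0 lt_neqAle eq_sym np.
      have D2 : 0 < (q.2 - z0.2) ^+ 2.
        by rewrite exprn_even_gt0 //= subr_eq0 eq_sym.
      have : (p.1 - z0.1) * (q.1 - z0.1) * (q.2 - z0.2) ^+ 2 <= 0.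
        have -> : (p.1 - z0.1) * (q.1 - z0.1) * (q.2 - z0.2) ^+ 2 =
          ((p.2 - z0.2) * (q.2 - z0.2)) * (q.1 - z0.1) ^+ 2.
          have -> : (p.1 - z0.1) * (q.1 - z0.1) * (q.2 - z0.2) ^+ 2 =
            (p.1 - z0.1) * (q.2 - z0.2) * ((q.1 - z0.1) * (q.2 - z0.2)) by ring.
          by rewrite AD; ring.
        by rewrite mulr_le0_ge0 ?sqr_ge0 // ltW.
      rewrite pmulr_lle0 // => AB.
      have -> : (z0.1 - p.1) * (z0.1 - q.1) = (p.1 - z0.1) * (q.1 - z0.1) by ring.
      have -> : (z0.2 - p.2) * (z0.2 - q.2) = (p.2 - z0.2) * (q.2 - z0.2) by ring.
      by move: AB CD; clear; lra.
    exists (hit p q z0 (+) ((z0.1 < p.1) && (z0.2 < p.2)) (+)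
                           ((z0.1 < q.1) && (z0.2 < q.2))).
    near=> z.
    have [c1 c2] : (cross p q z < 0) = (cross p q z0 < 0) /\
                   (0 < cross p q z) = (0 < cross p q z0).
      by near: z; exact: near_sg (@cross_continuous p q) cn.
    have [h1 h2] : (z.2 < p.2) = (z0.2 < p.2) /\ (p.2 <= z.2) = (p.2 <= z0.2).
      by near: z; exact: near_height.
    have [h3 h4] : (z.2 < q.2) = (z0.2 < q.2) /\ (q.2 <= z.2) = (q.2 <= z0.2).
      by near: z; exact: near_height.
    by rewrite /hit c1 c2 h1 h2 h3 h4.
  exists (((z0.1 < p.1) && (z0.2 < p.2)) (+) ((z0.1 < q.1) && (z0.2 < q.2))).
  near=> z.
  have [h1 h2] : (z.2 < p.2) = (z0.2 < p.2) /\ (p.2 <= z.2) = (p.2 <= z0.2).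
    by near: z; exact: near_height.
  have [h3 h4] : (z.2 < q.2) = (z0.2 < q.2) /\ (q.2 <= z.2) = (q.2 <= z0.2).
    by near: z; exact: near_height.
  have -> : hit p q z = false.
    rewrite /hit h1 h2 h3 h4 !andbA.
    by move/negbT: eb; rewrite negb_or => /andP[/negbTE-> /negbTE->].
  by rewrite h1 h3.
Unshelve. all: by end_near. Qed.

End Plane.

(** * The parity of the number of crossings is locally constant off the boundary *)

Section Parity.
Variables (R : realType) (v : seq (R * R)).
Implicit Types (z : R * R).
Local Notation n := (size v).
Local Notation next := (next_idx v).

Definition on_edge (i : nat) z : bool := on (vtx v i) (vtx v (next i)) z.
Definition hit_edge (i : nat) z : bool := hit (vtx v i) (vtx v (next i)) z.
Definition inside z : bool := odd (\sum_(i < n) hit_edge i z).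

Lemma edgeP i z : edge v i z <-> on_edge i z.
Proof. exact: segmentP. Qed.

Lemma boundaryP z : polygon_boundary v z <-> exists2 i, (i < n)%N & on_edge i z.
Proof.
split=> [[i /= hi /edgeP oi]|[i hi /edgeP oi]]; by exists i.
Qed.

Lemma boundaryPn z : ~ polygon_boundary v z <-> forall i, (i < n)%N -> ~~ on_edge i z.
Proof.
split=> [nb i hi|H /boundaryP[i /H/negP]//].
by apply/negP => oi; apply: nb; apply/boundaryP; exists i.
Qed.

Lemma insideE z : inside z = \big[addb/false]_(i < n) hit_edge i z.
Proof.
rewrite /inside (big_morph odd oddD (erefl (odd 0))).
by apply: eq_bigr => i _; rewrite oddb.
Qed.

Lemma addb_next (f : nat -> bool) :
  \big[addb/false]_(i < n) f (next i) = \big[addb/false]_(i < n) f i.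
Proof.
by rewrite [RHS](reindex_inj (bij_inj (@ordS_bij n))).
Qed.

(** The vertex terms of [near_hit] occur twice, once for each edge at the vertex, and cancel in the
    sum over the closed polygon. The edges in [A] may contain [z0], so their hits stay explicit;
    [outside_comp] uses this to compare the two sides of an edge. *)
Lemma near_inside (A : pred 'I_n) z0 :
  (forall i : 'I_n, A i ->
     z0.2 != (vtx v i).2 /\ z0.2 != (vtx v (next i)).2) ->
  (forall i : 'I_n, ~~ A i -> ~~ on_edge i z0) ->
  exists b, \forall z \near z0,
    inside z = b (+) \big[addb/false]_(i < n | A i) hit_edge i z.
Proof.
move=> hA nA.
pose rho i z := (z0.1 < (vtx v i).1) && (z.2 < (vtx v i).2).
pose psi (i : 'I_n) z :=
  (if A i then false else hit_edge i z) (+) rho i z (+) rho (next i) z.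
have /choice[b hb] : forall i : 'I_n, exists b, \forall z \near z0, psi i z = b.
  move=> i; rewrite /psi; case: (boolP (A i)) => ai; last exact/near_hit/nA.
  have [h1 h2] := hA _ ai; exists (rho i z0 (+) rho (next i) z0).
  near=> z; rewrite /rho.
  have [-> _] : (z.2 < (vtx v i).2) = (z0.2 < (vtx v i).2) /\
       ((vtx v i).2 <= z.2) = ((vtx v i).2 <= z0.2).
    by near: z; exact: near_height.
  have [-> _] : (z.2 < (vtx v (next i)).2) = (z0.2 < (vtx v (next i)).2) /\
       ((vtx v (next i)).2 <= z.2) = ((vtx v (next i)).2 <= z0.2).
    by near: z; exact: near_height.
  by [].
exists (\big[addb/false]_(i < n) b i).
have : \forall z \near z0, forall i, psi i z = b i.
  exact: (@filter_forall _ _ (fun i z => psi i z = b i) (nbhs z0) _ hb).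
apply: filterS => z hz.
under eq_bigr do rewrite -hz.
rewrite /psi !big_split /= (addb_next (rho^~ z)) -[X in X (+) _]addbA addbb addbF.
rewrite insideE (bigID A) /= addbC big_mkcond /=; congr addb.
by apply: eq_bigr => i _; case: (A i).
Unshelve. all: by end_near. Qed.

Lemma near_insideE z0 : ~ polygon_boundary v z0 ->
  \forall z \near z0, inside z = inside z0.
Proof.
move=> /boundaryPn nb.
have [//|i _|b hb] := @near_inside pred0 z0; first exact: nb.
have e0 := nbhs_singleton hb.
by apply: filterS hb => z ->; rewrite e0 !big_pred0_eq.
Qed.

Lemma near_boundaryPn z0 : ~ polygon_boundary v z0 ->
  \forall z \near z0, ~ polygon_boundary v z.
Proof.
move=> /boundaryPn nb.
have : \forall z \near z0, forall i : 'I_n, ~~ on_edge i z.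
  apply: (@filter_forall _ _ (fun (i : 'I_n) z => ~~ on_edge i z) (nbhs z0) _).
  by move=> i; apply: near_on; exact: nb.
by apply: filterS => z hz; apply/boundaryPn => i hi; exact: (hz (Ordinal hi)).
Qed.

Definition reach : R := \sum_(i < n) (`|(vtx v i).1| + `|(vtx v i).2|).

Lemma vtx_reach i : (i < n)%N -> `|(vtx v i).1| <= reach /\ `|(vtx v i).2| <= reach.
Proof.
move=> hi; rewrite /reach (bigD1 (Ordinal hi)) //=.
have : 0 <= \sum_(j < n | j != Ordinal hi) (`|(vtx v j).1| + `|(vtx v j).2|).
  by apply: sumr_ge0 => j _; rewrite addr_ge0.
move: (normr_ge0 (vtx v i).1) (normr_ge0 (vtx v i).2); lra.
Qed.

Lemma next_lt i : (i < n)%N -> (next i < n)%N.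
Proof. by move=> hi; rewrite /next_idx ltn_mod (leq_ltn_trans _ hi). Qed.

Lemma on_reach i z : (i < n)%N -> on_edge i z ->
  `|z.1| <= reach /\ `|z.2| <= reach.
Proof.
move=> hi /edgeP[t /=]; rewrite in_itv /= => /andP[t0 t1] <-.
have [a1 a2] := vtx_reach hi; have [b1 b2] := vtx_reach (next_lt hi).
move: a1 a2 b1 b2; rewrite !ler_norml /affine_comb /=.
move=> /andP[? ?] /andP[? ?] /andP[? ?] /andP[? ?].
by split; apply/andP; split; nra.
Qed.

Lemma inside_reach z : reach < `|z.1| \/ reach < `|z.2| -> inside z = false.
Proof.
move=> hz; rewrite insideE.
have [h2|h2] := ltP reach `|z.2|.
  rewrite big1 // => i _; rewrite /hit_edge /hit.
  have [_ a2] := vtx_reach (ltn_ord i).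
  have [_ b2] := vtx_reach (next_lt (ltn_ord i)).
  move: h2; rewrite lter_normr; move: a2 b2; rewrite !ler_norml.
  move=> /andP[? ?] /andP[? ?] /orP[h|h].
    have e1 : z.2 < (vtx v i).2 = false by apply/negbTE; rewrite -leNgt; lra.
    have e2 : z.2 < (vtx v (next i)).2 = false.
      by apply/negbTE; rewrite -leNgt; lra.
    by rewrite e1 e2.
  have e1 : (vtx v i).2 <= z.2 = false by apply/negbTE; rewrite -ltNge; lra.
  have e2 : (vtx v (next i)).2 <= z.2 = false.
    by apply/negbTE; rewrite -ltNge; lra.
  by rewrite e1 e2 !andbF.
have {hz}h1 : reach < `|z.1| by case: hz => //; rewrite ltNge h2.
have [h|h] := ltP z.1 0; last first.
  rewrite ger0_norm // in h1.
  rewrite big1 // => i _; apply/negbTE; rewrite /hit_edge /hit crossE.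
  have [a1 _] := vtx_reach (ltn_ord i).
  have [b1 _] := vtx_reach (next_lt (ltn_ord i)).
  move: a1 b1; rewrite !ler_norml => /andP[_ a1] /andP[_ b1].
  rewrite negb_or; apply/andP; split; apply/negP => /and3P[? ? ?]; nra.
rewrite ltr0_norm // in h1.
(* Far to the left, the ray hits an edge exactly when its ends lie on different sides of the
   horizontal line through [z], and a closed polygon changes sides an even number of times. *)
pose f i := z.2 < (vtx v i).2.
rewrite (eq_bigr (fun i : 'I_n => f i (+) f (next i))); last first.
  move=> i _; rewrite /hit_edge /hit /f crossE.
  have [a1 _] := vtx_reach (ltn_ord i).
  have [b1 _] := vtx_reach (next_lt (ltn_ord i)).
  move: a1 b1; rewrite !ler_norml => /andP[a1 _] /andP[b1 _].
  case: (ltP z.2 (vtx v i).2) => k1; case: (ltP z.2 (vtx v (next i)).2) => k2 //=.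
    by rewrite orbF; nra.
  by nra.
by rewrite big_split /= addb_next addbb.
Qed.

End Parity.

(** * Segments, rays and lines *)

Section Segments.
Variable R : realType.
Implicit Types (p q x y z a b : R * R).

Lemma affine_comb0 p q : affine_comb p q 0 = p.
Proof. by case: p => p1 p2; rewrite /affine_comb !mul0r !addr0. Qed.

Lemma affine_comb1 p q : affine_comb p q 1 = q.
Proof.
by case: p q => p1 p2 [q1 q2]; rewrite /affine_comb /= !mul1r; congr pair; ring.
Qed.

Lemma affine_combA p q s t :
  affine_comb p (affine_comb p q s) t = affine_comb p q (t * s).
Proof. by rewrite /affine_comb /=; congr pair; ring. Qed.

Lemma affine_comb_continuous p q : continuous (affine_comb p q).
Proof.
move=> t; pose f (a b u : R) := a + u * (b - a).
have cf (r s : R) : f r s u @[u --> t] --> f r s t.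
  by apply: cvgD; [exact: cvg_cst|apply: cvgM; [exact: cvg_id|exact: cvg_cst]].
exact: (cvg_pair (cf p.1 q.1) (cf p.2 q.2)).
Qed.

Lemma segment_connected2 p q : connected (segment p q).
Proof.
apply: connected_continuous_connected; first exact: segment_connected.
by apply: continuous_subspaceT; exact: affine_comb_continuous.
Qed.

Lemma segment_start p q : segment p q p.
Proof. by exists 0; rewrite ?affine_comb0 //= in_itv /= lexx ler01. Qed.

Lemma segment_end p q : segment p q q.
Proof. by exists 1; rewrite ?affine_comb1 //= in_itv /= lexx ler01. Qed.

Lemma segmentE p q z :
  segment p q z <-> exists t, [/\ 0 <= t, t <= 1 & z = affine_comb p q t].
Proof.
split=> [[t /=]|[t [t0 t1 ->]]].
  by rewrite in_itv /= => /andP[t0 t1] <-; exists t.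
by exists t; rewrite //= in_itv /= t0 t1.
Qed.

Lemma segmentC p q z : segment p q z <-> segment q p z.
Proof.
suff H u w : segment u w z -> segment w u z by split; exact: H.
move=> /segmentE[t [t0 t1 ->]]; apply/segmentE; exists (1 - t).
rewrite /affine_comb; split; [lra|lra|congr pair; ring].
Qed.

Lemma segment_split p q x y : segment p q x -> x != p -> x != q ->
  segment p q y <-> segment x p y \/ segment x q y.
Proof.
move=> /segmentE[t [t0 t1 ->]] np nq.
have {}t0 : 0 < t.
  by rewrite lt_def t0 andbT; apply: contra np => /eqP ->; rewrite affine_comb0.
have {}t1 : t < 1.
  by rewrite lt_def t1 andbT; apply: contra nq => /eqP <-; rewrite affine_comb1.
have t1' : 1 - t != 0 by rewrite gt_eqF // subr_gt0.
have t0' : t != 0 by rewrite gt_eqF.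
split.
  move=> /segmentE[s [s0 s1 ->]]; have [st|ts] := leP s t.
    left; apply/segmentE; exists ((t - s) / t); split.
    - by rewrite divr_ge0 ?subr_ge0 // ltW.
    - by rewrite ler_pdivrMr //; lra.
    - by rewrite /affine_comb /=; congr pair; field.
  right; apply/segmentE; exists ((s - t) / (1 - t)); split.
  - by rewrite divr_ge0 ?subr_ge0 // ltW.
  - by rewrite ler_pdivrMr ?subr_gt0 //; lra.
  - by rewrite /affine_comb /=; congr pair; field.
move=> [/segmentE[s [s0 s1 ->]]|/segmentE[s [s0 s1 ->]]]; apply/segmentE.
  exists (t * (1 - s)); split; [nra|nra|].
  by rewrite /affine_comb /=; congr pair; ring.
exists (t + s * (1 - t)); split; [nra|nra|].
by rewrite /affine_comb /=; congr pair; ring.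
Qed.

Definition ray x a y : Prop := exists2 s, 0 <= s & y = affine_comb x a s.

Lemma segment_ray x a y : segment x a y -> ray x a y.
Proof. by move=> /segmentE[t [t0 t1 ->]]; exists t. Qed.

Lemma near_ray x a : a != x -> \forall y \near x, ray x a y -> segment x a y.
Proof.
case: x a => [x1 x2] [a1 a2] nax.
apply/near_planeP; exists (Num.max `|a1 - x1| `|a2 - x2|).
  rewrite lt_max !normr_gt0 !subr_eq0.
  by move: nax; rewrite xpair_eqE negb_and.
move=> y h1 h2 [s s0 ey]; apply/segmentE; exists s; split=> //.
move: h1 h2; rewrite ey /affine_comb /= !(addrC _ (s * _)) !addrK !normrM (ger0_norm s0).
rewrite leNgt => h1 h2; apply/negP => s1.
have [h|h] := leP `|a1 - x1| `|a2 - x2|.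
  move: h2; rewrite (max_idPr h); apply/negP; rewrite -leNgt.
  by rewrite ler_peMl // ltW.
move: h1; rewrite (max_idPl (ltW h)); apply/negP; rewrite -leNgt.
by rewrite ler_peMl // ltW.
Qed.

End Segments.

Section Lines.
Variable R : realType.
Implicit Types (p q x y z a b : R * R).

Lemma line_param x a y : a != x -> cross x a y = 0 -> exists s, y = affine_comb x a s.
Proof.
case: x a y => [x1 x2] [a1 a2] [y1 y2]; rewrite xpair_eqE negb_and /cross /=.
set u := a1 - x1; set w := a2 - x2 => nax c0.
have [u0|u0] := eqVneq u 0.
  have w0 : w != 0.
    by move: nax; rewrite -(subr_eq0 a1) -/u u0 eqxx /= -subr_eq0.
  exists ((y2 - x2) / w); rewrite /affine_comb /= -/u -/w divfK //.
  move: c0; rewrite u0 mul0r sub0r => /eqP; rewrite oppr_eq0 mulf_eq0 (negbTE w0) /=.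
  by rewrite subr_eq0 => /eqP ->; congr pair; ring.
exists ((y1 - x1) / u); rewrite /affine_comb /= -/u -/w divfK //.
congr pair; first by ring.
have -> : (y1 - x1) / u * w = y2 - x2; last by ring.
by rewrite mulrAC; apply: (mulIf u0); rewrite divfK //; move: c0; lra.
Qed.

Lemma cross_affine p q x y t :
  cross p q (affine_comb x y t) = (1 - t) * cross p q x + t * cross p q y.
Proof. by rewrite /cross /affine_comb /=; ring. Qed.

Lemma cross_ray x a s : cross x a (affine_comb x a s) = 0.
Proof. by rewrite /cross /affine_comb /=; ring. Qed.

Lemma convex_lt (t u w e : R) : 0 <= t -> t <= 1 -> u < e -> w < e ->
  (1 - t) * u + t * w < e.
Proof. by move=> t0 t1 ue we; have [|] := leP u w => uw; nra. Qed.

Lemma convex_norm_lt (t u w e : R) : 0 <= t -> t <= 1 -> `|u| < e -> `|w| < e ->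
  `|(1 - t) * u + t * w| < e.
Proof.
rewrite !ltr_norml => t0 t1 /andP[u1 u2] /andP[w1 w2]; apply/andP; split.
  rewrite ltrNl; have := convex_lt t0 t1 (_ : - u < e) (_ : - w < e).
  by rewrite !mulrN -opprD; apply; lra.
exact: convex_lt.
Qed.

End Lines.

(** * Components of the complement near a boundary point *)

Section Components.
Variables (R : realType) (v : seq (R * R)).
Implicit Types (x y z c : R * R).
Hypothesis simple : simple_polygon v.
Local Notation n := (size v).
Local Notation next := (next_idx v).
Local Notation bd := (polygon_boundary v).
Local Notation comp := (connected_component (~` bd)).

Let n_gt2 : (2 < n)%N. Proof. by case: simple. Qed.

Lemma segment_comp x y : (forall t, 0 <= t -> t <= 1 -> ~ bd (affine_comb x y t)) ->
  comp x y.
Proof.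
move=> H; apply: (@connected_component_max _ _ (segment x y) x).
- exact: segment_start.
- by move=> z /segmentE[t [t0 t1 ->]]; exact: H.
- exact: segment_connected2.
- exact: segment_end.
Qed.

Lemma comp_open z : open (comp z).
Proof.
rewrite openE => x cx.
have nx : ~ bd x by exact: (connected_component_sub cx).
have /near_planeP[e e0 H] := near_boundaryPn nx.
apply/near_planeP; exists e => // y h1 h2.
apply: connected_component_trans cx _; apply: segment_comp => t t0 t1.
apply: H; rewrite /affine_comb /= addrAC subrr add0r normrM (ger0_norm t0).
  by apply: le_lt_trans h1; rewrite ler_piMl.
by apply: le_lt_trans h2; rewrite ler_piMl.
Qed.

(** The points of one parity off the boundary form an open set. Its trace on a component is also
    closed, as the other parity is open too, so it is the whole connected component. *)
Lemma inside_comp x y : comp x y -> inside v y = inside v x.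
Proof.
move=> cxy.
have nx : ~ bd x.
  by move=> bx; move: cxy; rewrite connected_component_out.
pose same b := [set z | ~ bd z /\ inside v z = b].
have os b : open (same b).
  rewrite openE => z [nz iz].
  have h1 := near_boundaryPn nz; have h2 := near_insideE nz.
  by near=> w; split; [near: w; exact: h1|rewrite -iz; near: w; exact: h2].
have cc := @component_connected _ (~` bd) x.
have E : comp x `&` same (inside v x) = comp x.
  apply: cc.
  - by exists x; split; [exact: connected_component_refl|].
  - by exists (same (inside v x)) => //; exact: os.
  - exists (~` same (~~ inside v x)); first exact/open_closedC/os.
    apply/seteqP; split=> z [cz].
      by move=> [nz iz]; split=> // -[_]; rewrite iz; case: inside.
    move=> ns; split=> //; have nz := connected_component_sub cz.
    by split=> //; apply/eqP/negP => /negP h; apply: ns; split=> //;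
       move: h; case: inside; case: inside.
by move: cxy; rewrite -E => -[_ []].
Unshelve. all: by end_near. Qed.

Lemma approach_closure c y (C : set (R * R)) :
  (forall t, 0 <= t -> t < 1 -> C (affine_comb c y t)) -> closure C y.
Proof.
move=> H B /(near_planeP y B)[e e0 He].
pose M := `|y.1 - c.1| + `|y.2 - c.2|.
have M0 : 0 <= M by rewrite addr_ge0.
pose d := Num.min 1 (e / (M + 1)).
have d0 : 0 < d by rewrite lt_min ltr01 divr_gt0 //; lra.
have d1 : d <= 1 by rewrite ge_min lexx.
have dM : d * M < e.
  have : d <= e / (M + 1) by rewrite ge_min lexx orbT.
  rewrite ler_pdivlMr; [nra|lra].
exists (affine_comb c y (1 - d)); split; first by apply: H; lra.
apply: He; rewrite /affine_comb /=.
  have -> : c.1 + (1 - d) * (y.1 - c.1) - y.1 = - (d * (y.1 - c.1)) by ring.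
  rewrite normrN normrM (gtr0_norm d0); apply: le_lt_trans dM.
  by rewrite ler_pM2l // lerDl.
have -> : c.2 + (1 - d) * (y.2 - c.2) - y.2 = - (d * (y.2 - c.2)) by ring.
rewrite normrN normrM (gtr0_norm d0); apply: le_lt_trans dM.
by rewrite ler_pM2l // lerDr.
Qed.

Lemma approach_comp c y z : comp z c ->
  (forall t, 0 <= t -> t < 1 -> ~ bd (affine_comb c y t)) -> closure (comp z) y.
Proof.
move=> cz H; apply: (@approach_closure c) => t t0 t1.
apply: connected_component_trans cz _; apply: segment_comp => s s0 s1.
by rewrite affine_combA; apply: H; nra.
Qed.

(** Otherwise the component would be closed as well as open, and would contain the connected segment
    from [z] to a vertex of the polygon. *)
Lemma comp_touches z : ~ bd z -> exists2 x, bd x & closure (comp z) x.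
Proof.
move=> nz; apply: contrapT => H.
have clC : closure (comp z) `<=` comp z.
  move=> x cx; have nx : ~ bd x by move=> bx; apply: H; exists x.
  have [y [zy xy]] := cx _ (open_nbhs_nbhs (conj (@comp_open x) (connected_component_refl nx))).
  by apply: connected_component_trans zy _; exact: connected_component_sym.
pose p := vtx v 0.
have E : segment z p `&` comp z = segment z p.
  apply: segment_connected2.
  - exists z; split; [exact: segment_start|exact: connected_component_refl].
  - by exists (comp z) => //; exact: comp_open.
  - exists (closure (comp z)); first exact: closed_closure.
    apply/seteqP; split=> x [sx cx]; split=> //; last exact: clC.
    exact: subset_closure.
have : comp z p by have := segment_end z p; rewrite -E => -[].
move/connected_component_sub; apply; exists 0%N => /=; first by lia.
exact: segment_start.
Qed.

(* The last condition says that the two segments do not overlap. *)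
Definition star x a b : Prop :=
  [/\ a != x, b != x, \forall y \near x, bd y <-> segment x a y \/ segment x b y &
      forall s, 0 < s -> b <> affine_comb x a s].

Lemma star_near x a b : star x a b ->
  \forall y \near x, bd y <-> ray x a y \/ ray x b y.
Proof.
case=> nax nbx H _; have ha := near_ray nax; have hb := near_ray nbx.
near=> y; have [h1 h2] : bd y <-> segment x a y \/ segment x b y.
  by near: y; exact: H.
have ra : ray x a y -> segment x a y by near: y; exact: ha.
have rb : ray x b y -> segment x b y by near: y; exact: hb.
split=> [/h1[]/segment_ray|[/ra|/rb]]; by [left|right|move=> ?; apply: h2; left|move=> ?; apply: h2; right].
Unshelve. all: by end_near. Qed.

Lemma square_affine x y z t (e : R) : 0 <= t -> t <= 1 ->
  `|y.1 - x.1| < e -> `|y.2 - x.2| < e -> `|z.1 - x.1| < e -> `|z.2 - x.2| < e ->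
  `|(affine_comb y z t).1 - x.1| < e /\ `|(affine_comb y z t).2 - x.2| < e.
Proof.
move=> t0 t1 y1 y2 z1 z2; split; rewrite /affine_comb /=.
  have -> : y.1 + t * (z.1 - y.1) - x.1 = (1 - t) * (y.1 - x.1) + t * (z.1 - x.1).
    by ring.
  exact: convex_norm_lt.
have -> : y.2 + t * (z.2 - y.2) - x.2 = (1 - t) * (y.2 - x.2) + t * (z.2 - x.2).
  by ring.
exact: convex_norm_lt.
Qed.

(** The two rays are opposite, so near [x] the boundary is a line. From a point [c] of the component
    the segment to a nearby boundary point stays off the line until its end, since [cross] is affine
    along it. *)
Lemma star_flat z x a b : star x a b -> cross x a b = 0 -> closure (comp z) x ->
  \forall y \near x, bd y -> closure (comp z) y.
Proof.
move=> st c0 clx; have [nax nbx _ npar] := st.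
have [l eb] := line_param nax c0.
have l0 : l < 0.
  rewrite ltNge le_eqVlt; apply/negP => /orP[/eqP l0|/npar//].
  by move: nbx; rewrite eb -l0 affine_comb0 eqxx.
have rayE y : ray x a y \/ ray x b y <-> cross x a y = 0.
  split=> [[[s _ ->]|[s _ ->]]|/(line_param nax)[s ->]]; first exact: cross_ray.
    by rewrite eb affine_combA cross_ray.
  have [s0|s0] := leP 0 s; [by left; exists s|right; exists (s / l)].
    by rewrite ltW // nmulr_rgt0 // invr_lt0.
  by rewrite eb affine_combA divfK // lt_eqF.
have /near_planeP[e e0 H] := star_near st.
apply/near_planeP; exists e => // y y1 y2 /(H y y1 y2)/rayE by0.
have [c [cc cN]] := clx _ (proj2 (near_planeP x
   (fun c => `|c.1 - x.1| < e /\ `|c.2 - x.2| < e)) (ex_intro2 _ _ e e0 (fun _ h1 h2 => conj h1 h2))).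
have [c1 c2] := cN.
have nc : cross x a c != 0.
  apply/eqP => /rayE/(H c c1 c2) bc; exact: (connected_component_sub cc).
apply: (@approach_comp c) => // t t0 t1.
have [w1 w2] := square_affine t0 (ltW t1) c1 c2 y1 y2.
move/(H _ w1 w2)/rayE; rewrite cross_affine by0 mulr0 addr0 => /eqP.
by rewrite mulf_eq0 (negbTE nc) orbF subr_eq0 gt_eqF.
Qed.

(** Near [x] the boundary bounds a quadrant in suitable coordinates. Its interior is convex and its
    exterior is star-shaped, so whichever of them the component meets, straight segments within it
    reach every nearby boundary point. *)
Lemma star_corner z x a b : star x a b -> cross x a b != 0 -> closure (comp z) x ->
  \forall y \near x, bd y -> closure (comp z) y.
Proof.
move=> st; set D := cross x a b => D0 clx.
(* Cramer's rule: the coordinates of [y - x] in the basis [a - x], [b - x]. The boundary becomes the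
   union of the two nonnegative half axes. *)
pose ca y := - cross x b y / D; pose cb y := cross x a y / D.
have yE y : y = (x.1 + ca y * (a.1 - x.1) + cb y * (b.1 - x.1),
                 x.2 + ca y * (a.2 - x.2) + cb y * (b.2 - x.2)).
  move: D0; rewrite /ca /cb /D /cross; case: x a b y {st clx ca cb D}
    => [x1 x2] [a1 a2] [b1 b2] [y1 y2] /= D0.
  by congr pair; field.
have caA y w t : ca (affine_comb y w t) = (1 - t) * ca y + t * ca w.
  by rewrite /ca cross_affine; ring.
have cbA y w t : cb (affine_comb y w t) = (1 - t) * cb y + t * cb w.
  by rewrite /cb cross_affine; ring.
have rayE y : ray x a y \/ ray x b y <->
    (cb y = 0 /\ 0 <= ca y) \/ (ca y = 0 /\ 0 <= cb y).
  split.
    move=> [[s s0 ->]|[s s0 ->]]; [left|right].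
      rewrite caA cbA /ca /cb /D.
      have -> : cross x b x = 0 by rewrite /cross; ring.
      have -> : cross x a x = 0 by rewrite /cross; ring.
      have -> : cross x a a = 0 by rewrite /cross; ring.
      have -> : cross x b a = - D by rewrite /D /cross; ring.
      by rewrite opprK !mul0r oppr0 !mul0r !mulr0 divff // mulr1 !add0r.
    rewrite caA cbA /ca /cb /D.
    have -> : cross x b x = 0 by rewrite /cross; ring.
    have -> : cross x a x = 0 by rewrite /cross; ring.
    have -> : cross x b b = 0 by rewrite /cross; ring.
    by rewrite oppr0 !mul0r !mulr0 divff // mulr1 !add0r.
  move=> [[h0 h1]|[h0 h1]]; [left; exists (ca y)|right; exists (cb y)] => //.
    by rewrite [LHS]yE h0 /affine_comb !mul0r !addr0.
  by rewrite [LHS]yE h0 /affine_comb !mul0r !addr0.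
have /near_planeP[e e0 H] := star_near st.
pose M := `|a.1 - x.1| + `|a.2 - x.2| + `|b.1 - x.1| + `|b.2 - x.2|.
have M0 : 0 <= M by rewrite !addr_ge0.
(* Chosen so that the parallelogram of coordinates below [h] fits into the square of radius [e]. *)
pose h := e / (M + 1).
have h0 : 0 < h by rewrite divr_gt0 //; lra.
have hM : h * M < e.
  have -> : e = h * (M + 1) by rewrite /h divfK // gt_eqF //; lra.
  by nra.
pose para y := `|ca y| < h /\ `|cb y| < h.
have paraE y : para y ->
    (bd y <-> (cb y = 0 /\ 0 <= ca y) \/ (ca y = 0 /\ 0 <= cb y)).
  move=> [p1 p2]; rewrite -rayE; apply: H.
    rewrite (congr1 fst (yE y)) /= (_ : x.1 + ca y * (a.1 - x.1) + cb y * (b.1 - x.1) - x.1 =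
      ca y * (a.1 - x.1) + cb y * (b.1 - x.1)); last by ring.
    apply: le_lt_trans (ler_normD _ _) _; rewrite (normrM (ca y)) (normrM (cb y)); apply: le_lt_trans hM.
    apply: (@le_trans _ _ (h * (`|a.1 - x.1| + `|b.1 - x.1|))).
      by rewrite mulrDr; apply: lerD; apply: ler_wpM2r; first [exact: normr_ge0|exact: ltW].
    apply: ler_wpM2l; first exact: ltW.
    by rewrite /M; move: (normr_ge0 (a.2 - x.2)) (normr_ge0 (b.2 - x.2)); lra.
  rewrite (congr1 snd (yE y)) /= (_ : x.2 + ca y * (a.2 - x.2) + cb y * (b.2 - x.2) - x.2 =
      ca y * (a.2 - x.2) + cb y * (b.2 - x.2)); last by ring.
  apply: le_lt_trans (ler_normD _ _) _; rewrite (normrM (ca y)) (normrM (cb y)); apply: le_lt_trans hM.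
  apply: (@le_trans _ _ (h * (`|a.2 - x.2| + `|b.2 - x.2|))).
    by rewrite mulrDr; apply: lerD; apply: ler_wpM2r; first [exact: normr_ge0|exact: ltW].
  apply: ler_wpM2l; first exact: ltW.
  by rewrite /M; move: (normr_ge0 (a.1 - x.1)) (normr_ge0 (b.1 - x.1)); lra.
have paraA y w t : 0 <= t -> t <= 1 -> para y -> para w -> para (affine_comb y w t).
  by rewrite /para caA cbA => t0 t1 [? ?] [? ?]; split; exact: convex_norm_lt.
have cax : ca x = 0 by rewrite /ca /cross !subrr !mulr0 subrr oppr0 mul0r.
have cbx : cb x = 0 by rewrite /cb /cross !subrr !mulr0 subrr mul0r.
have near_para : \forall y \near x, para y.
  have cta : continuous ca.
    by move=> w; apply: cvgM; [apply: cvgN; exact: cross_continuous|exact: cvg_cst].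
  have ctb : continuous cb.
    by move=> w; apply: cvgM; [exact: cross_continuous|exact: cvg_cst].
  near=> y; split; rewrite ltr_norml; apply/andP; split; near: y.
  - by apply: near_gt cta _; rewrite cax oppr_lt0.
  - by apply: near_lt cta _; rewrite cax.
  - by apply: near_gt ctb _; rewrite cbx oppr_lt0.
  - by apply: near_lt ctb _; rewrite cbx.
have [c [cc pc]] := clx _ near_para.
have nbc : ~ bd c by exact: connected_component_sub cc.
apply: filterS near_para => y py /(paraE y py) hy.
have [/andP[a0 b0]|ab] := boolP ((0 < ca c) && (0 < cb c)).
  apply: (@approach_comp c) => // t t0 t1.
  have t1' : 0 < 1 - t by rewrite subr_gt0.
  move/(paraE _ (paraA _ _ _ t0 (ltW t1) pc py)); rewrite caA cbA.
  by move: hy => [[-> ?]|[-> ?]] [[? ?]|[? ?]]; nra.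
(* A point of the opposite quadrant, from which the whole exterior of the closed quadrant is
   visible: a negative coordinate of the target stays negative on the way. *)
pose o := (x.1 - h / 2 * (a.1 - x.1) - h / 2 * (b.1 - x.1),
           x.2 - h / 2 * (a.2 - x.2) - h / 2 * (b.2 - x.2)).
have oa : ca o = - (h / 2).
  move: D0; rewrite /ca /o /D /cross /=; clear; move=> D0; field; exact: D0.
have ob : cb o = - (h / 2).
  move: D0; rewrite /cb /o /D /cross /=; clear; move=> D0; field; exact: D0.
have po : para o by rewrite /para oa ob normrN ger0_norm; [split; lra|lra].
have co : comp z o.
  apply: connected_component_trans cc _; apply: segment_comp => t t0 t1.
  move/(paraE _ (paraA _ _ _ t0 t1 pc po)); rewrite caA cbA oa ob.
  have [a0|a0] := ltP (ca c) 0; first by move=> [[? ?]|[? ?]]; nra.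
  have [b0|b0] := ltP (cb c) 0; first by move=> [[? ?]|[? ?]]; nra.
  move: ab; rewrite negb_and -!leNgt => ab _; apply: nbc; apply/(paraE c pc).
  case/orP: ab => ab; [right|left]; split=> //; apply/eqP; rewrite eq_le.
    by rewrite ab a0.
  by rewrite ab b0.
apply: (@approach_comp o) => // t t0 t1.
move/(paraE _ (paraA _ _ _ t0 (ltW t1) po py)); rewrite caA cbA oa ob.
by move: hy => [[-> ?]|[-> ?]] [[? ?]|[? ?]]; nra.
Unshelve. all: by end_near. Qed.

Lemma star_closure z x a b : star x a b -> closure (comp z) x ->
  \forall y \near x, bd y -> closure (comp z) y.
Proof.
move=> st; have [c0|c0] := eqVneq (cross x a b) 0.
  exact: star_flat st c0.
exact: star_corner st c0.
Qed.

End Components.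

(** * The Jordan theorem for simple polygons *)

Section Jordan.
Variables (R : realType) (v : seq (R * R)).
Implicit Types (x y z c : R * R).
Hypothesis simple : simple_polygon v.
Local Notation n := (size v).
Local Notation next := (next_idx v).
Local Notation bd := (polygon_boundary v).
Local Notation comp := (connected_component (~` bd)).

Let n_gt2 : (2 < n)%N. Proof. by case: simple. Qed.

Lemma next_neq i : (i < n)%N -> next i != i.
Proof.
move=> hi; rewrite /next_idx; have [e|ne] := eqVneq i.+1 n.
  by rewrite e modnn; apply/eqP; lia.
by rewrite modn_small; [apply/eqP|]; lia.
Qed.

Lemma next2_neq i : (i < n)%N -> next (next i) != i.
Proof.
move=> hi; rewrite /next_idx -addn1 modnDml addn1.
have [e|ne] := eqVneq i.+2 n; first by rewrite e modnn; apply/eqP; lia.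
have [e|ne'] := eqVneq i.+1 n; last by rewrite modn_small; [apply/eqP|]; lia.
have -> : (i.+2 = 1 + n)%N by lia.
by rewrite modnDr modn_small; [apply/eqP|]; lia.
Qed.

Lemma prev_idx i : (i < n)%N -> exists2 j, (j < n)%N & next j = i.
Proof.
move=> hi; rewrite /next_idx; have [->|i0] := posnP i.
  by exists n.-1; [lia|rewrite prednK ?modnn //; lia].
by exists i.-1; [lia|rewrite prednK // modn_small].
Qed.

Lemma vtx_neq i j : (i < n)%N -> (j < n)%N -> i != j -> vtx v i != vtx v j.
Proof. by move=> hi hj; rewrite /vtx nth_uniq //; case: simple. Qed.

(** If the next edge folded back over edge [i], the point at distance parameter [Num.min 1 s] from
    the common vertex would lie on both edges without being that vertex. *)
Lemma no_overlap i s : (i < n)%N -> 0 < s ->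
  vtx v (next (next i)) <> affine_comb (vtx v (next i)) (vtx v i) s.
Proof.
move=> hi s0 E; have [_ _ H] := simple.
set j := next i in E *; have hj : (j < n)%N by exact: next_lt.
have nij : i != j by rewrite eq_sym next_neq.
pose t := Num.min 1 s.
have t0 : 0 < t by rewrite lt_min ltr01.
have t1 : t <= 1 by rewrite ge_min lexx.
have ts : t <= s by rewrite ge_min lexx orbT.
pose y := affine_comb (vtx v j) (vtx v i) t.
have ei : edge v i y.
  by apply/segmentC/segmentE; exists t; split=> //; exact: ltW.
have ej : edge v j y.
  apply/segmentE; exists (t / s); split.
  - by rewrite divr_ge0 // ltW.
  - by rewrite ler_pdivrMr // mul1r.
  - by rewrite E affine_combA divfK // gt_eqF.
case: (H i j y hi hj nij ei ej) => [[_ yj]|[ij _]]; last first.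
  by have := next2_neq hi; rewrite -/j -ij eqxx.
have nv := vtx_neq hi hj nij.
have nv' : (vtx v i).1 - (vtx v j).1 != 0 \/ (vtx v i).2 - (vtx v j).2 != 0.
  move: nv; rewrite [vtx v i]surjective_pairing [vtx v j]surjective_pairing.
  by rewrite xpair_eqE negb_and /= !subr_eq0 => /orP.
have e1 := congr1 fst yj; have e2 := congr1 snd yj; rewrite /= in e1 e2.
case: nv' => nz; [have : t * ((vtx v i).1 - (vtx v j).1) = 0 by lra|
  have : t * ((vtx v i).2 - (vtx v j).2) = 0 by lra];
  by move/eqP; rewrite mulf_eq0 (negbTE nz) orbF gt_eqF.
Qed.

Lemma near_edges x (A : pred nat) : (forall k, (k < n)%N -> ~~ A k -> ~~ on_edge v k x) ->
  \forall y \near x, bd y <-> exists2 k, (k < n)%N && A k & on_edge v k y.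
Proof.
move=> H.
have : \forall y \near x, forall k : 'I_n, ~~ A k -> ~~ on_edge v k y.
  apply: (@filter_forall _ _ (fun (k : 'I_n) y => ~~ A k -> ~~ on_edge v k y) (nbhs x) _).
  move=> k; case: (boolP (A k)) => ak; first exact: nearW.
  by have := near_on (H k (ltn_ord k) ak); apply: filterS => y ny _.
apply: filterS => y ny; rewrite boundaryP; split=> [[k hk oy]|[k /andP[hk ak] oy]].
  exists k => //; rewrite hk /=; apply/negPn/negP => nk.
  by have := ny (Ordinal hk) nk; rewrite /= oy.
by exists k.
Qed.

Lemma star_vertex i : (i < n)%N ->
  star v (vtx v (next i)) (vtx v i) (vtx v (next (next i))).
Proof.
move=> hi; have [_ _ H] := simple.
set j := next i; have hj : (j < n)%N by exact: next_lt.
have nij : i != j by rewrite eq_sym next_neq.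
split.
- exact: vtx_neq.
- by apply: vtx_neq; [exact: next_lt|by []|exact: next_neq].
- have h k : (k < n)%N -> ~~ pred2 i j k -> ~~ on_edge v k (vtx v j).
    move=> hk; rewrite /= negb_or => /andP[ki kj]; apply/negP => /edgeP ek.
    have ei : edge v i (vtx v j) by exact: segment_end.
    case: (H k i _ hk hi ki ek ei) => [[_ e]|[e _]].
      by have := vtx_neq hi hj nij; rewrite -e eqxx.
    by move: kj; rewrite e eqxx.
  have := near_edges h.
  apply: filterS => y ->; split.
    move=> [k /andP[hk /orP[/eqP->|/eqP->]] /edgeP ey]; last by right.
    by left; apply/segmentC.
  move=> [/segmentC/edgeP ey|/edgeP ey]; [exists i|exists j] => //=.
    by rewrite hi eqxx.
  by rewrite hj eqxx orbT.
- by move=> s s0; exact: no_overlap.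
Qed.

Definition edge_parallel i (d1 d2 : R) : Prop :=
  ((vtx v (next i)).1 - (vtx v i).1) * d2 = ((vtx v (next i)).2 - (vtx v i).2) * d1.

(** The direction from [x] to [a] is that of an edge containing [x], in the form in which
    [region_leave] compares it with a direction of motion. *)
Definition along x a : Prop := exists i, [/\ (i < n)%N, on_edge v i x &
  forall d1 d2, edge_parallel i d1 d2 -> (a.1 - x.1) * d2 = (a.2 - x.2) * d1].

Lemma boundary_star x : bd x -> exists a b, [/\ star v x a b, along x a & along x b].
Proof.
have at_vertex i : (i < n)%N -> exists a b, [/\ star v (vtx v (next i)) a b,
    along (vtx v (next i)) a & along (vtx v (next i)) b].
  move=> hi; exists (vtx v i), (vtx v (next (next i))); split.
  - exact: star_vertex.
  - exists i; split=> //; first exact/edgeP/segment_end.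
    by rewrite /edge_parallel => d1 d2; lra.
  - exists (next i); split=> //; [exact: next_lt|exact/edgeP/segment_start].
move=> /boundaryP[i hi oi]; have ei := proj2 (edgeP v i x) oi.
have [_ _ H] := simple.
have [->|nxq] := eqVneq x (vtx v (next i)); first exact: at_vertex.
have [->|nxp] := eqVneq x (vtx v i).
  by have [j hj <-] := prev_idx hi; exact: at_vertex.
have /segmentE[t [t0 t1 ext]] := ei.
exists (vtx v i), (vtx v (next i)); split; last 2 first.
- exists i; split=> // d1 d2; rewrite /edge_parallel ext /affine_comb /= => E.
  have := congr1 (fun u => - t * u) E; rewrite /=; lra.
- exists i; split=> // d1 d2; rewrite /edge_parallel ext /affine_comb /= => E.
  have := congr1 (fun u => (1 - t) * u) E; rewrite /=; lra.
split; [by rewrite eq_sym|by rewrite eq_sym| |].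
- have h k : (k < n)%N -> ~~ pred1 i k -> ~~ on_edge v k x.
    move=> hk /= ki; apply/negP => /edgeP ek.
    case: (H k i _ hk hi ki ek ei) => [[_ /eqP]|[e]]; first by rewrite (negbTE nxp).
    by rewrite e => /eqP; rewrite (negbTE nxq).
  have := near_edges h; apply: filterS => y ->.
  rewrite -(segment_split y ei nxp nxq); split=> [[k /andP[_ /eqP->] /edgeP]//|ey].
  by exists i; [rewrite hi /= eqxx|exact/edgeP].
- move=> s s0 e.
  have nz : vtx v (next i) != vtx v i.
    by apply: vtx_neq; [exact: next_lt|by []|exact: next_neq].
  have {}t0 : 0 < t.
    by rewrite lt_def t0 andbT; apply: contra nxp => /eqP t0'; rewrite ext t0' affine_comb0.
  have {}t1 : t < 1.
    by rewrite lt_def t1 andbT; apply: contra nxq => /eqP t1'; rewrite ext -t1' affine_comb1.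
  move: nz e; rewrite ext; case: (vtx v (next i)) (vtx v i) => [q1 q2] [p1 p2].
  rewrite xpair_eqE negb_and -(subr_eq0 q1) -(subr_eq0 q2) /affine_comb /= => nz [e1 e2].
  have f1 : (q1 - p1) * ((1 - t) + s * t) = 0.
    by move/eqP: e1; rewrite -subr_eq0 => /eqP <-; ring.
  have f2 : (q2 - p2) * ((1 - t) + s * t) = 0.
    by move/eqP: e2; rewrite -subr_eq0 => /eqP <-; ring.
  have g0 : (1 - t) + s * t != 0 by rewrite gt_eqF //; nra.
  case/orP: nz => nz; [move/eqP: f1|move/eqP: f2]; by rewrite mulf_eq0 (negbTE nz) (negbTE g0).
Qed.

(** The part of the edge that lies in the closure of the component is closed, and open in the edge
    by [star_closure]; a segment is connected. *)
Lemma closure_edge z i x : (i < n)%N -> edge v i x -> closure (comp z) x ->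
  forall y, edge v i y -> closure (comp z) y.
Proof.
move=> hi ex clx y ey.
have bE w : edge v i w -> bd w by move=> ew; exists i.
pose O := interior [set w | bd w -> closure (comp z) w].
have E : edge v i `&` closure (comp z) = edge v i.
  apply: segment_connected2.
  - by exists x.
  - exists O; first exact: open_interior.
    apply/seteqP; split=> w [ew h]; split=> //.
      by have [a [b [st _ _]]] := boundary_star (bE w ew); exact: star_closure st h.
    by apply: (interior_subset h); exact: bE.
  - by exists (closure (comp z)) => //; exact: closed_closure.
by move: ey; rewrite -E => -[].
Qed.

(** From the edge that the component touches, [closure_edge] goes on from vertex to vertex around
    the polygon. *)
Lemma closure_boundary z y : ~ bd z -> bd y -> closure (comp z) y.
Proof.
move=> nz; have [x /boundaryP[i hi /edgeP ei] clx] := comp_touches simple nz.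
have all_edges k : closure (comp z) (vtx v ((i + k) %% n)).
  elim: k => [|k IH].
    rewrite addn0 modn_small //; apply: (closure_edge hi ei clx).
    exact: segment_start.
  have hk : ((i + k) %% n < n)%N by rewrite ltn_mod; lia.
  have -> : ((i + k.+1) %% n = next ((i + k) %% n))%N.
    by rewrite /next_idx -[((i + k) %% n).+1]addn1 modnDml addn1 addnS.
  by apply: (closure_edge hk _ IH); [exact: segment_start|exact: segment_end].
move=> /boundaryP[j hj /edgeP ej]; apply: (closure_edge hj _ _ ej).
  exact: segment_start.
have := all_edges (j + (n - i))%N.
by rewrite (_ : (i + (j + (n - i)) = j + n)%N) ?modnDr ?modn_small //; lia.
Qed.

(** If all edges were horizontal, the two edges at a leftmost vertex would both go to the right and
    overlap. A horizontal edge would not do in [outside_comp], since a horizontal ray never counts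
    it. *)
Lemma exists_oblique : exists2 i, (i < n)%N & (vtx v i).2 != (vtx v (next i)).2.
Proof.
apply: contrapT => H.
have flat i : (i < n)%N -> (vtx v (next i)).2 = (vtx v i).2.
  by move=> hi; apply/eqP/negPn/negP => ne; apply: H; exists i => //; rewrite eq_sym.
pose o := Ordinal (leq_trans (ltn0Sn 1) (ltnW n_gt2)).
pose j : 'I_n := [arg min_(k < o) (vtx v k).1]%O.
have jmin k : (k < n)%N -> (vtx v j).1 <= (vtx v k).1.
  by move=> hk; rewrite /j; case: arg_minP => // k0 _ h; exact: (h (Ordinal hk)).
have [i hi ij] := prev_idx (ltn_ord j).
have hj2 := next_lt (ltn_ord j).
have nv1 : vtx v i != vtx v (next i) by apply: vtx_neq => //; [exact: next_lt|rewrite eq_sym next_neq].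
have nv2 : vtx v (next j) != vtx v j by apply: vtx_neq => //; exact: next_neq.
have m1 := jmin _ hi; have m2 := jmin _ hj2.
have f1 := flat _ hi; have f2 := flat _ (ltn_ord j).
rewrite ij in f1 nv1.
have l1 : (vtx v j).1 < (vtx v i).1.
  rewrite lt_def m1 andbT; apply: contra nv1 => /eqP e.
  by rewrite [vtx v i]surjective_pairing [vtx v j]surjective_pairing e f1.
have l2 : (vtx v j).1 < (vtx v (next j)).1.
  rewrite lt_def m2 andbT; apply: contra nv2 => /eqP e.
  by rewrite [vtx v (next j)]surjective_pairing [vtx v j]surjective_pairing e f2.
have d1 : (vtx v i).1 - (vtx v j).1 != 0 by rewrite subr_eq0 gt_eqF.
apply: (@no_overlap i (((vtx v (next j)).1 - (vtx v j).1) / ((vtx v i).1 - (vtx v j).1)) hi).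
  by rewrite divr_gt0 // subr_gt0.
rewrite ij [LHS]surjective_pairing /affine_comb divfK // f2 -f1 subrr mulr0 addr0.
by congr pair; ring.
Qed.

(** Both components come close to the midpoint [x] of an oblique edge. There the parity tells the
    side of the edge, so points [c] and [d] of the two components near [x] lie on the same side, and
    the segment between them does not meet the boundary. *)
Lemma outside_comp z w : ~ bd z -> ~ bd w -> inside v z = false -> inside v w = false ->
  comp z w.
Proof.
move=> nz nw iz iw; have [i hi ob] := exists_oblique.
set p := vtx v i in ob; set q := vtx v (next i) in ob.
(* The height of the midpoint is strictly between those of the ends, so that near it only the sign
   of [cross p q] decides whether the ray hits this edge. *)
pose x := affine_comb p q (1 / 2).
have ex : edge v i x by apply/segmentE; exists (1 / 2); split=> //; lra.
have x2 : x.2 = (p.2 + q.2) / 2 by rewrite /x /affine_comb /=; field.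
have xp : x.2 != p.2 by move: ob; rewrite x2 neq_lt => /orP[?|?]; rewrite neq_lt; apply/orP; [right|left]; lra.
have xq : x.2 != q.2 by move: ob; rewrite x2 neq_lt => /orP[?|?]; rewrite neq_lt; apply/orP; [left|right]; lra.
have bx : bd x by exists i.
have [_ _ H] := simple.
have others k : (k < n)%N -> k != i -> ~~ on_edge v k x.
  move=> hk ki; apply/negP => /edgeP ek.
  case: (H k i _ hk hi ki ek ex) => [[_ e]|[e1 e]]; first by rewrite e eqxx in xp.
  by move: xq; rewrite e e1 eqxx.
have [k /eqP->|k ki|b hb] := @near_inside _ v (pred1 (Ordinal hi)) x; first by split.
  exact: others.
have hE : \forall y \near x, hit_edge v i y =
    if q.2 < p.2 then cross p q y < 0 else 0 < cross p q y.
  near=> y; rewrite /hit_edge /hit -/p -/q.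
  have [-> ->] : (y.2 < p.2) = (x.2 < p.2) /\ (p.2 <= y.2) = (p.2 <= x.2).
    by near: y; exact: near_height.
  have [-> ->] : (y.2 < q.2) = (x.2 < q.2) /\ (q.2 <= y.2) = (q.2 <= x.2).
    by near: y; exact: near_height.
  rewrite x2; case: ifPn => h.
    have -> : (p.2 + q.2) / 2 < p.2 by lra.
    have -> : q.2 <= (p.2 + q.2) / 2 by lra.
    have -> : (p.2 + q.2) / 2 < q.2 = false by apply/negbTE; rewrite -leNgt; lra.
    by rewrite /= orbF.
  have h' : p.2 < q.2 by rewrite lt_neqAle ob leNgt.
  have -> : (p.2 + q.2) / 2 < p.2 = false by apply/negbTE; rewrite -leNgt; lra.
  have -> : (p.2 + q.2) / 2 < q.2 by lra.
  by have -> : p.2 <= (p.2 + q.2) / 2 by lra.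
have oE : \forall y \near x, bd y <-> exists2 k, (k < n)%N && pred1 i k & on_edge v k y.
  by apply: near_edges => k hk /others; exact.
have lineE : \forall y \near x, cross p q y = 0 -> on p q y.
  have xnp : p != x by apply: contra xp => /eqP {1}<-.
  have xnq : q != x by apply: contra xq => /eqP {1}<-.
  have h1 := near_ray xnp; have h2 := near_ray xnq.
  near=> y => c0; apply/segmentP.
  have h1y : ray x p y -> segment x p y by near: y; exact: h1.
  have h2y : ray x q y -> segment x q y by near: y; exact: h2.
  apply/(segment_split y ex); [by rewrite eq_sym|by rewrite eq_sym|].
  have qp : q != p by apply: contra ob => /eqP->.
  have [s es] := line_param qp c0.
  have [s0|s0] := leP s (1 / 2).
    left; apply: h1y; exists (1 - 2 * s); first by lra.
    by rewrite es /x /affine_comb /=; congr pair; field.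
  right; apply: h2y; exists (2 * s - 1); first by lra.
  by rewrite es /x /affine_comb /=; congr pair; field.
have near_all : \forall y \near x, [/\ hit_edge v i y =
    if q.2 < p.2 then cross p q y < 0 else 0 < cross p q y,
    inside v y = b (+) hit_edge v i y, bd y <-> on p q y & cross p q y = 0 -> on p q y].
  near=> y; split; near: y => //.
  - by apply: filterS hb => y ->; rewrite big_pred1_eq.
  - apply: filterS oE => y ->; split=> [[k /andP[_ /eqP->]//]|oy].
    by exists i => //=; rewrite hi eqxx.
have /near_planeP[e e0 N] := near_all.
have near_sq := proj2 (near_planeP x
   (fun c => `|c.1 - x.1| < e /\ `|c.2 - x.2| < e)) (ex_intro2 _ _ e e0 (fun _ h1 h2 => conj h1 h2)).
have [c [zc [c1 c2]]] := closure_boundary nz bx near_sq.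
have [d [wd [d1 d2]]] := closure_boundary nw bx near_sq.
have [hc ic bc lc] := N c c1 c2; have [hd id bd' ld] := N d d1 d2.
have cc : cross p q c != 0.
  by apply/eqP => /lc/bc; exact: (connected_component_sub zc).
have cd : cross p q d != 0.
  by apply/eqP => /ld/bd'; exact: (connected_component_sub wd).
have same : (cross p q c < 0) = (cross p q d < 0).
  have xor_eq (a' x' y' : bool) : a' (+) x' = false -> a' (+) y' = false -> x' = y'.
    by case: a'; case: x'; case: y'.
  move: (inside_comp zc) (inside_comp wd); rewrite iz iw ic id hc hd => e1 e2.
  move: (xor_eq _ _ _ e1 e2); case: ifP => // _.
  by rewrite (lt_neqAle _ 0) (lt_neqAle (cross p q d) 0) cc cd /= !leNgt => ->.
apply: connected_component_trans zc _.
apply: connected_component_trans (connected_component_sym wd).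
apply: segment_comp => t t0 t1.
have [w1 w2] := square_affine t0 t1 c1 c2 d1 d2.
have [_ _ [h _] _] := N _ w1 w2; move/h; rewrite /on cross_affine => /andP[/eqP e1 _].
have [cn|cp] := ltP (cross p q c) 0.
  have dn : cross p q d < 0 by rewrite -same.
  by have := convex_lt t0 t1 cn dn; rewrite e1 ltxx.
have cp' : - cross p q c < 0 by rewrite oppr_lt0 lt_neqAle eq_sym cc.
have dp' : - cross p q d < 0 by rewrite oppr_lt0 lt_neqAle eq_sym cd leNgt -same -leNgt.
by have := convex_lt t0 t1 cp' dp'; rewrite !mulrN -opprD e1 oppr0 ltxx.
Unshelve. all: by end_near. Qed.

(** Far points of the first axis are off the boundary and of even parity, hence belong to the same
    component by [outside_comp]. *)
Lemma unbounded_comp z : ~ bd z -> inside v z = false -> ~ bounded_set (comp z).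
Proof.
move=> nz iz [M [_ HM]].
pose M' := Num.max (M + 1) (reach v + 1).
have far t : reach v < t -> ~ bd (t, 0) /\ inside v (t, 0) = false.
  move=> ht; have hl : reach v < `|t| by apply: lt_le_trans ht (ler_norm t).
  split; last by apply: inside_reach; left.
  by move=> /boundaryP[i hi oi]; have [/=] := on_reach hi oi; rewrite leNgt hl.
have rM : reach v < M' by rewrite lt_max; apply/orP; right; lra.
have [nb ib] := far (M' + 1) (ltr_wpDr ler01 rM).
have cz := outside_comp nz nb iz ib.
have MM : M < M' by rewrite lt_max; apply/orP; left; lra.
have := HM M' MM _ cz.
rewrite /= leNgt => /negP; apply.
rewrite prod_normE /=.
rewrite lt_max; apply/orP; left; apply: lt_le_trans (ler_norm _).
by rewrite ltrDl.
Qed.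

Theorem polygon_regionP z : polygon_region v z <-> bd z \/ inside v z.
Proof.
split.
  move=> [bz|[nz bc]]; [by left|right].
  by case e : (inside v z) => //; case: (unbounded_comp nz e).
move=> [bz|iz]; [by left|].
have [bz|nz] := pselect (bd z); [by left|right; split=> //].
exists (reach v); split; first exact: num_real.
move=> M hM w /inside_comp; rewrite iz => iw.
rewrite /= prod_normE.
have far : reach v < `|w.1| \/ reach v < `|w.2| -> False.
  by move/inside_reach; rewrite iw.
rewrite ge_max; apply/andP; split; rewrite leNgt; apply/negP => h; apply: far.
  by left; exact: lt_trans h.
by right; exact: lt_trans h.
Qed.

End Jordan.

(** * Configurations and their critical values *)

Section Region.
Variables (R : realType) (v : seq (R * R)).
Hypothesis simple : simple_polygon v.
Implicit Types (x y z : R * R).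
Local Notation m := (size v).
Local Notation region := (polygon_region v).
Local Notation bd := (polygon_boundary v).

Lemma near_regionPn z : ~ region z -> \forall y \near z, ~ region y.
Proof.
move=> nr; have nb : ~ bd z by move=> b; apply: nr; apply/(polygon_regionP simple); left.
have ni : inside v z = false.
  by apply/negP => i; apply: nr; apply/(polygon_regionP simple); right.
have h1 := near_boundaryPn nb; have h2 := near_insideE nb.
near=> y => /(polygon_regionP simple)[|].
  by near: y.
have -> : inside v y = inside v z by near: y.
by rewrite ni.
Unshelve. all: by end_near. Qed.

Lemma region_reach z : region z -> `|z.1| <= reach v /\ `|z.2| <= reach v.
Proof.
move=> /(polygon_regionP simple)[/boundaryP[i hi oi]|iz]; first exact: on_reach oi.
have far : reach v < `|z.1| \/ reach v < `|z.2| -> False.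
  by move/inside_reach; rewrite iz.
by split; rewrite leNgt; apply/negP => h; apply: far; [left|right].
Qed.

(** Off the boundary the parity is locally constant. On the boundary both arms of the star at [z]
    are multiples of [d]; as they do not overlap, they cannot both point against [d], so one of them
    keeps the moving point on the boundary. *)
Lemma region_leave z (d : R * R) : region z -> d != (0, 0) ->
  (forall i, (i < m)%N -> on_edge v i z -> edge_parallel v i d.1 d.2) ->
  \forall s \near (0 : R), 0 < s -> region (z.1 + s * d.1, z.2 + s * d.2).
Proof.
move=> rz d0 par; pose mv s : R * R := (z.1 + s * d.1, z.2 + s * d.2).
have mvE s : mv s = affine_comb z (z.1 + d.1, z.2 + d.2) s.
  by rewrite /mv /affine_comb /=; congr pair; ring.
have cm : continuous mv.
  by rewrite (_ : mv = affine_comb z (z.1 + d.1, z.2 + d.2));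
    [exact: affine_comb_continuous|apply/funext => s; exact: mvE].
have mv0 : mv 0 = z by rewrite mvE affine_comb0.
have [bz|nz] := pselect (bd z); last first.
  have iz : inside v z by case/(polygon_regionP simple): rz.
  have : \forall y \near mv 0, inside v y = inside v z by rewrite mv0; exact: near_insideE.
  move=> hz; have hs : \forall s \near (0 : R), inside v (mv s) = inside v z := cm 0 _ hz.
  by apply: filterS hs => s es _; apply/(polygon_regionP simple); right; rewrite es.
have [a [b [[nax nbx near_bd nover] [i [hi oi pa]] [j [hj oj pb]]]]] :=
  boundary_star simple bz.
have dir c : c != z -> (c.1 - z.1) * d.2 = (c.2 - z.2) * d.1 ->
    exists2 mu, mu != 0 & c = mv mu.
  move=> ncz e; have nd : (z.1 + d.1, z.2 + d.2) != z.
    apply: contra d0; case: (z) (d) => [z1 z2] [d1 d2] /=.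
    by rewrite !xpair_eqE => /andP[/eqP e1 /eqP e2]; apply/andP; split; apply/eqP; lra.
  have [|mu ec] := @line_param _ z (z.1 + d.1, z.2 + d.2) c nd.
    by rewrite /cross /=; lra.
  exists mu; last by rewrite mvE.
  by apply: contra ncz => /eqP mu0; rewrite ec mu0 affine_comb0.
have [mu mu0 ea] := dir a nax (pa _ _ (par i hi oi)).
have [nu nu0 eb] := dir b nbx (pb _ _ (par j hj oj)).
suff key c k : c = mv k -> 0 < k -> (forall y, segment z c y -> segment z a y \/ segment z b y) ->
    \forall s \near (0 : R), 0 < s -> region (mv s).
  have [mup|mun] := ltP 0 mu; first by apply: (key a mu) => // y; left.
  have [nup|nun] := ltP 0 nu; first by apply: (key b nu) => // y; right.
  have mun' : mu < 0 by rewrite lt_neqAle mu0.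
  have nun' : nu < 0 by rewrite lt_neqAle nu0.
  case: (nover (nu / mu)); first by rewrite nmulr_rgt0 // invr_lt0.
  by rewrite ea eb !mvE affine_combA divfK.
move=> ec k0 sub.
have hb : \forall y \near mv 0, bd y <-> segment z a y \/ segment z b y by rewrite mv0.
have hb' : \forall s \near (0 : R), bd (mv s) <-> segment z a (mv s) \/ segment z b (mv s)
  := cm 0 _ hb.
near=> s => s0.
have h : bd (mv s) <-> segment z a (mv s) \/ segment z b (mv s) by near: s; exact: hb'.
have sk : s <= k by near: s; exact: (cvgr_le _ cvg_id).
apply/(polygon_regionP simple); left; apply/h/sub/segmentE.
exists (s / k); split.
- by rewrite divr_ge0 // ltW.
- by rewrite ler_pdivrMr // mul1r.
- by rewrite ec !mvE affine_combA divfK // gt_eqF.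
Unshelve. all: by end_near. Qed.

(* The classification of a point against one edge: crossings of the ray count
   1 and incidences count [m + 1], so that the sum over the edges tells the
   parity of the former and the presence of the latter apart. *)
Definition edge_score (M : nat) (p q z : R * R) : nat :=
  (hit p q z + on p q z * M.+1)%N.

Lemma edge_score_le M p q z : (edge_score M p q z <= M.+2)%N.
Proof. by rewrite /edge_score; case: hit; case: on; rewrite /= ?mul1n ?mul0n. Qed.

Definition score_in (M k : nat) : bool := if (k <= M)%N then odd k else true.

Definition score z : nat :=
  \sum_(e < m) edge_score m (vtx v e) (vtx v (next_idx v e)) z.

Lemma scoreP z : score_in m (score z) <-> region z.
Proof.
apply: (iff_trans _ (iff_sym (polygon_regionP simple z))).
have -> : score z = (\sum_(e < m) hit_edge v e z + (\sum_(e < m) on_edge v e z) * m.+1)%N.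
  by rewrite /score big_split /= big_distrl.
have hits : (\sum_(e < m) hit_edge v e z <= m)%N.
  rewrite -[X in (_ <= X)%N]card_ord -sum1_card leq_sum // => i _; exact: leq_b1.
rewrite /score_in /inside; have [|ons] := posnP (\sum_(e < m) on_edge v e z)%N.
  move=> e0; rewrite e0 mul0n addn0 hits; split=> [|[/boundaryP[i hi oi]|//]]; first by right.
  move/eqP: e0; rewrite sum_nat_eq0 => /forallP /(_ (Ordinal hi)) /=.
  by rewrite oi.
rewrite leqNgt ifN ?negbK; last first.
  by apply: leq_trans (leq_addl _ _); rewrite leq_pmull.
split=> // _; left; apply/boundaryP; apply: contrapT => nb.
move: ons; rewrite big1 // => i _; apply/eqP; rewrite eqb0; apply/negP => oi.
by apply: nb; exists i.
Qed.

End Region.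

(** * Rotations with a rational parameter *)

Section Configurations.
Variables (R : realType) (S v : seq (R * R)).
Hypothesis simple : simple_polygon v.
Implicit Types (r x y z : R * R) (w theta : R).
Local Notation m := (size v).
Local Notation n := (size S).
Local Notation region := (polygon_region v).

(* An angle in ]0, 2 pi[ is represented by its half cotangent [w]. *)
Definition cosw w : R := (w ^+ 2 - 1) / (1 + w ^+ 2).
Definition sinw w : R := 2 * w / (1 + w ^+ 2).
(** For negative [w] the angle exceeds pi and is the reflection of an arc cosine. The full turn is
    written [2 * acos (- 1)], as the program computes it, the RAM having no constant pi. *)
Definition angle w : R := if w < 0 then 2 * acos (- 1) - acos (cosw w) else acos (cosw w).

(* The preimage of [x] under the rotation of the polygon around [r]. *)
Definition spin r w x : R * R :=
  (x.1 + 2 * ((r.1 - x.1) + w * (r.2 - x.2)) / (1 + w ^+ 2),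
   x.2 + 2 * ((r.2 - x.2) - w * (r.1 - x.1)) / (1 + w ^+ 2)).

Lemma sqrD1_gt0 w : 0 < 1 + w ^+ 2.
Proof. by rewrite ltr_pwDl // sqr_ge0. Qed.

Lemma sqrD1_neq0 w : 1 + w ^+ 2 != 0.
Proof. by rewrite gt_eqF // sqrD1_gt0. Qed.

Lemma cosw_itv w : -1 <= cosw w < 1.
Proof.
rewrite /cosw ler_pdivlMr ?ltr_pdivrMr ?sqrD1_gt0 //.
have := sqr_ge0 w; move: (w ^+ 2) => u; lra.
Qed.

Lemma cosw_sinw w : sinw w ^+ 2 = 1 - cosw w ^+ 2.
Proof. by rewrite /sinw /cosw; field; exact: sqrD1_neq0. Qed.

Lemma cos_angle w : cos (angle w) = cosw w.
Proof.
have /andP[h1 h2] := cosw_itv w; have h2' := ltW h2.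
rewrite /angle acosN1; case: ifP => _; last by rewrite acosK // in_itv /= h1.
rewrite mulr_natl cosB cos2pi sin2pi mul1r mul0r addr0.
by rewrite acosK // in_itv /= h1.
Qed.

Lemma sin_angle w : sin (angle w) = sinw w.
Proof.
have /andP[h1 h2] := cosw_itv w; have h2' := ltW h2.
rewrite /angle acosN1; case: ltP => hw.
  rewrite mulr_natl sinB cos2pi sin2pi mul1r mul0r sub0r.
  rewrite sin_acos ?h1 // -cosw_sinw sqrtr_sqr ler0_norm ?opprK //.
  by rewrite /sinw pmulr_lle0 ?invr_gt0 ?sqrD1_gt0 // pmulr_rle0 // ltW.
rewrite sin_acos ?h1 // -cosw_sinw sqrtr_sqr ger0_norm //.
by rewrite /sinw divr_ge0 ?mulr_ge0 // ltW // sqrD1_gt0.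
Qed.

Lemma angle_itv w : 0 <= angle w < 2 * pi.
Proof.
have /andP[h1 h2] := cosw_itv w; have h2' := ltW h2.
have a0 : 0 < acos (cosw w) by rewrite acos_gt0 // h1.
have a1 : acos (cosw w) <= pi by rewrite acos_lepi // h1.
have := @pi_gt0 R; rewrite /angle acosN1; case: ifP => _ p0; apply/andP; split; lra.
Qed.

Lemma angle_surj theta : 0 < theta < 2 * pi ->
  exists w, cos theta = cosw w /\ sin theta = sinw w.
Proof.
move=> /andP[t0 t1]; pose h := theta / 2.
have sh : 0 < sin h by rewrite sin_gt0_pi // /h; apply/andP; split; lra.
have eh : theta = h *+ 2 by rewrite /h -mulr_natr divfK.
have sn : sin h != 0 by rewrite gt_eqF.
have cs := cos2Dsin2 h.
exists (cos h / sin h); rewrite eh cos_mulr2n sin_mulr2n /cosw /sinw.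
have e1 : 1 + (cos h / sin h) ^+ 2 = (sin h ^+ 2)^-1.
  by rewrite -[RHS]mul1r -[X in _ = X * _]cs; field.
rewrite e1 invrK; split.
  rewrite mulrBl expr_div_n divfK ?expf_neq0 // mul1r -mulr_natr.
  by move: cs; lra.
by rewrite -mulr_natr; field.
Qed.

Lemma rotate_image (A : set (R * R)) r theta w x :
  cos theta = cosw w -> sin theta = sinw w ->
  (rotate_cw r theta @` A) x <-> A (spin r w x).
Proof.
move=> ec es; have w0 := sqrD1_neq0 w.
have cs := cos2Dsin2 theta; rewrite ec es in cs.
have back y : spin r w (rotate_cw r theta y) = y.
  rewrite /spin /rotate_cw ec es /cosw /sinw /=.
  by case: y => [y1 y2] /=; congr pair; field.
have forth y : rotate_cw r theta (spin r w y) = y.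
  rewrite /spin /rotate_cw ec es /cosw /sinw /=.
  by case: y => [y1 y2] /=; congr pair; field.
split=> [[y Ay <-]|Ax]; first by rewrite back.
by exists (spin r w x).
Qed.

Lemma rotate_image0 (A : set (R * R)) r x : (rotate_cw r 0 @` A) x <-> A x.
Proof.
have id y : rotate_cw r 0 y = y.
  rewrite /rotate_cw cos0 sin0; case: y => [y1 y2] /=.
  by congr pair; ring.
by split=> [[y Ay <-]|Ax]; [rewrite id|exists x].
Qed.

(** [f] is the inverse of the motion of the polygon. Taking it as a parameter lets the identity and
    [spin] share the definition. *)
Definition depth (f : R * R -> R * R) : nat :=
  \sum_(i < n) score_in m (score v (f (vtx S i))).

Lemma captured_depth r theta (f : R * R -> R * R) :
  (forall x, (rotate_cw r theta @` region) x <-> region (f x)) ->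
  captured S v r theta = depth f.
Proof.
move=> H; rewrite /captured -sum1_count big_mkcond /= (big_nth (0, 0)) big_mkord.
apply: eq_bigr => i _; rewrite -/(vtx S i).
have -> : `[< (rotate_cw r theta @` region) (vtx S i) >] =
    score_in m (score v (f (vtx S i))).
  apply/asboolP/idP; first by move=> /H/(scoreP simple).
  by move=> /(scoreP simple)/H.
by case: score_in.
Qed.

Lemma captured_spin r theta w : cos theta = cosw w -> sin theta = sinw w ->
  captured S v r theta = depth (spin r w).
Proof. by move=> ec es; apply: captured_depth => x; exact: rotate_image. Qed.

Lemma captured_angle r w : captured S v r (angle w) = depth (spin r w).
Proof. by apply: captured_spin; rewrite ?cos_angle ?sin_angle. Qed.

Lemma captured0 r : captured S v r 0 = depth id.
Proof. by apply: captured_depth => x; exact: rotate_image0. Qed.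

End Configurations.

(** * Signs of polynomials between their roots *)

Section SignConstancy.
Variable R : realType.
Implicit Types (p : {poly R}) (i : interval R).

Lemma in_rootsR p x : p != 0 -> (x \in rootsR p) = root p x.
Proof. by move=> p0; have := roots_on_rootsR p0; rewrite /roots_on => <-; rewrite in_itv. Qed.

(** The zero polynomial is no exception: its list of roots is empty and its sign constant.
    Polynomials that vanish identically along a curve thus rightly cause no event. *)
Lemma sgr_between p i : {in i, forall x, x \notin rootsR p} ->
  {in i &, forall x y, Num.sg p.[x] = Num.sg p.[y]}.
Proof.
have [->|p0] := eqVneq p 0; first by move=> _ x y _ _; rewrite !horner0.
move=> H x y xi yi; apply: (@polyrN0_itv _ i p) => // z /H.
by rewrite in_rootsR.
Qed.

Lemma size_rootsR p d : (size p <= d.+1)%N -> (size (rootsR p) <= d)%N.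
Proof.
have [->|p0] := eqVneq p 0; first by rewrite rootsR0.
move=> sp; have := max_poly_roots p0 _ (uniq_roots _ _ _ : uniq (rootsR p)).
move=> /(_ _)/leq_trans => H; rewrite -ltnS; apply: H sp.
by apply/allP => x; rewrite in_rootsR.
Qed.

Lemma sgr_compare (a b : R) : Num.sg a = Num.sg b ->
  [/\ (a < 0) = (b < 0), (0 < a) = (0 < b), (a == 0) = (b == 0) & (a <= 0) = (b <= 0)].
Proof.
move=> e; have e1 : (a < 0) = (b < 0) by rewrite -sgr_lt0 e sgr_lt0.
have e2 : (0 < a) = (0 < b) by rewrite -sgr_gt0 e sgr_gt0.
by split=> //; [rewrite -sgr_eq0 e sgr_eq0|rewrite !leNgt e2].
Qed.

Lemma edge_score_sg M (p q z z' : R * R) :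
  Num.sg (z.2 - p.2) = Num.sg (z'.2 - p.2) -> Num.sg (z.2 - q.2) = Num.sg (z'.2 - q.2) ->
  Num.sg (cross p q z) = Num.sg (cross p q z') -> Num.sg (dot p q z) = Num.sg (dot p q z') ->
  edge_score M p q z = edge_score M p q z'.
Proof.
move=> /sgr_compare[a1 a2 _ _] /sgr_compare[b1 b2 _ _].
move=> /sgr_compare[c1 c2 c3 _] /sgr_compare[_ _ _ d1].
rewrite /edge_score /hit /on c1 c2 c3 d1 !(leNgt _ z.2) !(leNgt _ z'.2).
rewrite -(subr_lt0 p.2 z.2) -(subr_lt0 q.2 z.2) -(subr_lt0 p.2 z'.2).
by rewrite -(subr_lt0 q.2 z'.2) a1 b1.
Qed.

End SignConstancy.

(** * Curves of configurations and their polynomials *)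

Section Curves.
Variables (R : realType).
Implicit Types (a d r x p q : R * R) (w t : R).

(* A curve of configurations: the half cotangent [w] determines the parameter
   [- H(w) / G(w)] of the center on its line, for linear [G] and quadratic [H]. *)
Record curve := Curve { cg0 : R; cg1 : R; ch0 : R; ch1 : R; ch2 : R }.
Implicit Types (c : curve).

Definition curve_G c w : R := cg0 c + cg1 c * w.
Definition curve_H c w : R := ch0 c + (ch1 c + ch2 c * w) * w.
Definition curve_t c w : R := - curve_H c w / curve_G c w.

Definition center a d t : R * R := (a.1 + t * d.1, a.2 + t * d.2).

Definition pos c a d w x : R * R := spin (center a d (curve_t c w)) w x.

(* The configurations that put [x] on the line through [p] and [q]. *)
Definition edge_curve a d x p q : curve :=
  let n1 := q.2 - p.2 in
  let n2 := p.1 - q.1 in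
  let k := (n1 * (x.1 - p.1) + n2 * (x.2 - p.2)) / 2 in
  Curve (n1 * d.1 + n2 * d.2) (n1 * d.2 - n2 * d.1)
        (k + (n1 * (a.1 - x.1) + n2 * (a.2 - x.2)))
        (n1 * (a.2 - x.2) - n2 * (a.1 - x.1)) k.

(** The constant curve [t = 1]. The difference [0 - 1] is the expression by which the program
    obtains -1. *)
Definition end_curve : curve := Curve 1 0 (0 - 1) 0 0.

(** For fixed [w] the cross product is affine in [t]: where [G(w)] is nonzero it vanishes at
    [curve_t] only, and where [G(w) = 0] it does not depend on [t]. *)
Lemma edge_curveE a d x p q t w :
  cross p q (spin (center a d t) w x) * (1 + w ^+ 2) =
  - 2 * (curve_H (edge_curve a d x p q) w + t * curve_G (edge_curve a d x p q) w).
Proof.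
have := sqrD1_neq0 w.
rewrite /cross /spin /center /curve_H /curve_G /=; case: a d x p q
  => [a1 a2] [d1 d2] [x1 x2] [p1 p2] [q1 q2] /= w0; by field.
Qed.

(* Coefficients of the denominator and of the numerators of [pos c a d w x]. *)
Definition den_coefs c : seq R := [:: cg0 c; cg1 c; cg0 c; cg1 c].

Definition num_coefs c a d x : seq R * seq R :=
  let u0 := cg0 c * (a.1 - x.1) - ch0 c * d.1 in
  let u1 := cg1 c * (a.1 - x.1) - ch1 c * d.1 in
  let u2 := 0 - ch2 c * d.1 in
  let v0 := cg0 c * (a.2 - x.2) - ch0 c * d.2 in
  let v1 := cg1 c * (a.2 - x.2) - ch1 c * d.2 in
  let v2 := 0 - ch2 c * d.2 in
  ([:: x.1 * cg0 c + 2 * u0; x.1 * cg1 c + 2 * (u1 + v0);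
       x.1 * cg0 c + 2 * (u2 + v1); x.1 * cg1 c + 2 * v2],
   [:: x.2 * cg0 c + 2 * v0; x.2 * cg1 c + 2 * (v1 - u0);
       x.2 * cg0 c + 2 * (v2 - u1); x.2 * cg1 c - 2 * u2]).

Definition shift_coefs (X D : seq R) (k : R) : seq R :=
  [seq X`_i - k * D`_i | i <- iota 0 4].

(** A coefficient of the product of two cubics, as a filtered sum over [iota]: it unfolds to the
    very sum that the expression [conv_r] evaluates to. *)
Definition conv_coef (A B : seq R) (k : nat) : R :=
  \sum_(i <- iota 0 4 | (i <= k < i + 4)%N) A`_i * B`_(k - i).

(** Numerators of the four quantities whose signs determine [edge_score]. The two height differences
    and [cross] are affine in the moved point, with denominator [D] and degree at most 3; [dot] is
    quadratic, with denominator [D] squared and degree at most 6. *)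
Definition edge_polys (D X Y : seq R) p q : seq (seq R) :=
  let xp := shift_coefs X D p.1 in let xq := shift_coefs X D q.1 in
  let yp := shift_coefs Y D p.2 in let yq := shift_coefs Y D q.2 in
  [:: yp; yq; [seq (q.1 - p.1) * yp`_i - (q.2 - p.2) * xp`_i | i <- iota 0 4];
      [seq conv_coef xp xq k + conv_coef yp yq k | k <- iota 0 7]].

Definition atom_polys c a d x p q : seq (seq R) :=
  [:: cg0 c; cg1 c] ::
  edge_polys (den_coefs c) (num_coefs c a d x).1 (num_coefs c a d x).2 p q.

(* [G = 1] and [w = 0] provide a critical value on each side of the root of
   [G], or at least one if [G] has no root. *)
Definition curve_polys c : seq (seq R) :=
  [:: [:: ch0 c; ch1 c; ch2 c];
      [:: ch0 c + cg0 c; ch1 c + cg1 c; ch2 c];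
      [:: cg0 c * cg0 c - 1; 2 * (cg0 c * cg1 c); cg1 c * cg1 c];
      [:: 0; 1]].

Section EvalPolys.
Variables (c : curve) (a d x p q : R * R) (w : R).
Hypothesis G0 : curve_G c w != 0.
Let D := den_coefs c.
Let X := (num_coefs c a d x).1.
Let Y := (num_coefs c a d x).2.
Let z := pos c a d w x.

Lemma den_horner : (Poly D).[w] = curve_G c w * (1 + w ^+ 2).
Proof. by rewrite horner_Poly /= /curve_G; ring. Qed.

Lemma num_horner1 : (Poly X).[w] = z.1 * (Poly D).[w].
Proof.
rewrite den_horner horner_Poly /z /pos /spin /center /curve_t.
have w0 := sqrD1_neq0 w; move: G0; rewrite /curve_H /=.
rewrite [curve_G c w]/curve_G => g0; by field; rewrite g0 w0.
Qed.

Lemma num_horner2 : (Poly Y).[w] = z.2 * (Poly D).[w].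
Proof.
rewrite den_horner horner_Poly /z /pos /spin /center /curve_t.
have w0 := sqrD1_neq0 w; move: G0; rewrite /curve_H /=.
rewrite [curve_G c w]/curve_G => g0; by field; rewrite g0 w0.
Qed.

End EvalPolys.

Lemma shift_horner (X0 X1 X2 X3 D0 D1 D2 D3 k w : R) :
  (Poly (shift_coefs [:: X0; X1; X2; X3] [:: D0; D1; D2; D3] k)).[w] =
  (Poly [:: X0; X1; X2; X3]).[w] - k * (Poly [:: D0; D1; D2; D3]).[w].
Proof. by rewrite !horner_Poly /=; ring. Qed.

Lemma conv_horner (A0 A1 A2 A3 B0 B1 B2 B3 C0 C1 C2 C3 E0 E1 E2 E3 w : R) :
  let A := [:: A0; A1; A2; A3] in let B := [:: B0; B1; B2; B3] in
  let C := [:: C0; C1; C2; C3] in let E := [:: E0; E1; E2; E3] in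
  (Poly [seq conv_coef A B k + conv_coef C E k | k <- iota 0 7]).[w] =
  (Poly A).[w] * (Poly B).[w] + (Poly C).[w] * (Poly E).[w].
Proof.
by move=> A B C E; rewrite !horner_Poly /A /B /C /E /conv_coef unlock /=; ring.
Qed.

(* The value 0 is arbitrary: where [G] vanishes the curve is not defined. *)
Definition atom_score M c a d x p q w : nat :=
  if curve_G c w == 0 then 0%N else edge_score M p q (pos c a d w x).

Lemma atom_score_const M c a d x p q (i : interval R) :
  (forall P, P \in atom_polys c a d x p q -> {in i, forall w, w \notin rootsR (Poly P)}) ->
  {in i &, forall w w', atom_score M c a d x p q w = atom_score M c a d x p q w'}.
Proof.
move=> H w w' iw iw'.
have sgP P : P \in atom_polys c a d x p q ->
    Num.sg (Poly P).[w] = Num.sg (Poly P).[w'].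
  by move=> hP; apply: sgr_between iw iw'; exact: H.
have GE u : (Poly [:: cg0 c; cg1 c]).[u] = curve_G c u.
  by rewrite horner_Poly /= /curve_G; ring.
have sG : Num.sg (curve_G c w) = Num.sg (curve_G c w').
  by rewrite -!GE; apply: sgP; rewrite mem_head.
rewrite /atom_score; have [_ _ -> _] := sgr_compare sG.
case: eqP => [//|/eqP g'].
have g : curve_G c w != 0 by have [_ _ -> _] := sgr_compare sG.
set D := den_coefs c; set X := (num_coefs c a d x).1; set Y := (num_coefs c a d x).2.
have sD : Num.sg (Poly D).[w] = Num.sg (Poly D).[w'].
  rewrite !den_horner !sgrM sG.
  by rewrite (gtr0_sg (sqrD1_gt0 w)) (gtr0_sg (sqrD1_gt0 w')).
have D0 u : curve_G c u != 0 -> (Poly D).[u] != 0.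
  by move=> gu; rewrite den_horner mulf_neq0 // sqrD1_neq0.
(* The denominator has the same sign at [w] and [w'], so signs may be compared on numerators. *)
have quot (N : R -> R) (f : R -> R) :
    (forall u, curve_G c u != 0 -> N u = f u * (Poly D).[u]) ->
    Num.sg (N w) = Num.sg (N w') -> Num.sg (f w) = Num.sg (f w').
  move=> NE sN; have fE u : curve_G c u != 0 -> f u = N u * ((Poly D).[u])^-1.
    by move=> gu; rewrite NE // mulfK // D0.
  by rewrite !fE // !sgrM sN !sgrV sD.
have XE u : curve_G c u != 0 -> (Poly X).[u] = (pos c a d u x).1 * (Poly D).[u].
  exact: num_horner1.
have YE u : curve_G c u != 0 -> (Poly Y).[u] = (pos c a d u x).2 * (Poly D).[u].
  exact: num_horner2.
apply: edge_score_sg.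
- apply: (quot (fun u => (Poly (shift_coefs Y D p.2)).[u]) (fun u => (pos c a d u x).2 - p.2)).
    by move=> u gu; rewrite shift_horner -/Y -/D YE //; ring.
  by apply: sgP; rewrite !inE eqxx ?orbT.
- apply: (quot (fun u => (Poly (shift_coefs Y D q.2)).[u]) (fun u => (pos c a d u x).2 - q.2)).
    by move=> u gu; rewrite shift_horner -/Y -/D YE //; ring.
  by apply: sgP; rewrite !inE eqxx ?orbT.
- pose P := [seq (q.1 - p.1) * (shift_coefs Y D p.2)`_i - (q.2 - p.2) * (shift_coefs X D p.1)`_i | i <- iota 0 4].
  apply: (quot (fun u => (Poly P).[u]) (fun u => cross p q (pos c a d u x))).
    move=> u gu.
    have -> : (Poly P).[u] = (q.1 - p.1) * (Poly (shift_coefs Y D p.2)).[u] -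
                             (q.2 - p.2) * (Poly (shift_coefs X D p.1)).[u].
      by rewrite !horner_Poly /=; ring.
    by rewrite !shift_horner -/Y -/X -/D YE // XE // /cross; ring.
  by apply: sgP; rewrite !inE eqxx ?orbT.
- pose P := [seq conv_coef (shift_coefs X D p.1) (shift_coefs X D q.1) k +
                 conv_coef (shift_coefs Y D p.2) (shift_coefs Y D q.2) k | k <- iota 0 7].
  (* Here [P] is [dot] times the square of the denominator, so one factor is divided out first. *)
  apply: (quot (fun u => (Poly P).[u] / (Poly D).[u]) (fun u => dot p q (pos c a d u x))).
    move=> u gu; have Du := D0 u gu; apply: (mulIf Du); rewrite divfK //.
    rewrite conv_horner !shift_horner -/Y -/X -/D YE // XE // /dot; ring.
  rewrite !sgrM !sgrV sD; congr (_ * _).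
  by apply: sgP; rewrite !inE eqxx ?orbT.
Qed.

End Curves.

(** * Moving the center along the line until a curve is met *)

Section Sweeping.
Variables (R : realType) (S v : seq (R * R)) (a d : R * R) (lin : bool).
Hypothesis simple : simple_polygon v.
Hypothesis d_neq0 : d != (0, 0).
Implicit Types (x y z : R * R) (w t : R) (c : curve R).
Local Notation m := (size v).
Local Notation n := (size S).
Local Notation next := (next_idx v).
Local Notation region := (polygon_region v).

Definition in_range t : bool := lin || (0 <= t <= 1).

Definition curve_at i e : curve R :=
  edge_curve a d (vtx S i) (vtx v e) (vtx v (next e)).
Definition is_curve c : Prop :=
  (exists i e, [/\ (i < n)%N, (e < m)%N & c = curve_at i e]) \/ c = end_curve R.
Definition polys_at c i e := atom_polys c a d (vtx S i) (vtx v e) (vtx v (next e)).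
Definition stat c i e w := atom_score m c a d (vtx S i) (vtx v e) (vtx v (next e)) w.

Definition root_events (o : nat * nat) (Ps : seq (seq R)) : seq (R * (nat * nat)) :=
  flatten [seq [seq (w, o) | w <- rootsR (Poly P)] | P <- Ps].

(* The critical values of a curve, with the atom (a point and an edge) whose
   contribution may change there. *)
Definition events c : seq (R * (nat * nat)) :=
  root_events (0, 0) (curve_polys c) ++
  flatten [seq flatten [seq root_events (i, e) (polys_at c i e) | e <- iota 0 m] | i <- iota 0 n].

Definition critical c w : bool := w \in [seq ev.1 | ev <- events c].

Lemma root_eventsP o Ps w o' : ((w, o') \in root_events o Ps) <->
  (o' = o /\ exists2 P, P \in Ps & w \in rootsR (Poly P)).
Proof.
split=> [/flatten_mapP[P hP /mapP[u hu [-> ->]]]|[-> [P hP hw]]].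
  by split=> //; exists P.
by apply/flatten_mapP; exists P => //; apply/mapP; exists w.
Qed.

Lemma eventsP c w i e : (w, (i, e)) \in events c <->
  ((i, e) = (0, 0)%N /\ exists2 P, P \in curve_polys c & w \in rootsR (Poly P)) \/
  [/\ (i < n)%N, (e < m)%N & exists2 P, P \in polys_at c i e & w \in rootsR (Poly P)].
Proof.
rewrite mem_cat; split=> [/orP[/root_eventsP|]|[/root_eventsP->//|[hi he H]]]; first by left.
  move=> /flatten_mapP[i' hi' /flatten_mapP[e' he' /root_eventsP[[-> ->] H]]].
  by right; move: hi' he'; rewrite !mem_iota.
apply/orP; right; apply/flatten_mapP; exists i; first by rewrite mem_iota.
by apply/flatten_mapP; exists e; [rewrite mem_iota|apply/root_eventsP].
Qed.

Lemma critical_curve c w P : P \in curve_polys c -> w \in rootsR (Poly P) -> critical c w.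
Proof.
move=> hP hw; apply/mapP; exists (w, (0, 0)%N) => //.
by apply/eventsP; left; split=> //; exists P.
Qed.

Lemma critical_atom c w i e P : (i < n)%N -> (e < m)%N -> P \in polys_at c i e ->
  w \in rootsR (Poly P) -> critical c w.
Proof.
move=> hi he hP hw; apply/mapP; exists (w, (i, e)) => //.
by apply/eventsP; right; split=> //; exists P.
Qed.

Lemma depth_stat c w : curve_G c w != 0 ->
  depth S v (pos c a d w) = (\sum_(i < n) score_in m (\sum_(e < m) stat c i e w))%N.
Proof.
move=> G0; apply: eq_bigr => i _; congr (nat_of_bool (score_in _ _)).
by apply: eq_bigr => e _; rewrite /stat /atom_score (negbTE G0).
Qed.

Lemma depth_mono (f g : R * R -> R * R) :
  (forall i : 'I_n, score_in m (score v (f (vtx S i))) -> region (g (vtx S i))) ->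
  (depth S v f <= depth S v g)%N.
Proof.
move=> H; apply: leq_sum => i _; case E : (score_in m (score v (f _))) => //.
by have /(scoreP simple) -> := H i E.
Qed.

(** The derivative of [spin (center a d t) w x] with respect to [t], which does not depend on
    [x]. *)
Definition velocity w : R * R :=
  (2 * (d.1 + w * d.2) / (1 + w ^+ 2), 2 * (d.2 - w * d.1) / (1 + w ^+ 2)).

Lemma spin_center t t' w x : spin (center a d t) w x =
  ((spin (center a d t') w x).1 + (t - t') * (velocity w).1,
   (spin (center a d t') w x).2 + (t - t') * (velocity w).2).
Proof.
have := sqrD1_neq0 w; rewrite /spin /center /velocity /= => w0.
by congr pair; field.
Qed.

Lemma velocity_neq0 w : velocity w != (0, 0).
Proof.
have w0 := sqrD1_neq0 w; apply: contra d_neq0; rewrite /velocity.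
case: d => [d1 d2] /=; rewrite !xpair_eqE.
rewrite !mulf_eq0 !invr_eq0 (negbTE w0) !orbF pnatr_eq0 /= => /andP[/eqP e1 /eqP e2].
have f2 : d2 * (1 + w ^+ 2) = 0.
  have -> : d2 * (1 + w ^+ 2) = (d2 - w * d1) + w * (d1 + w * d2) by ring.
  by rewrite e1 e2; ring.
move/eqP: f2; rewrite mulf_eq0 (negbTE w0) orbF => /eqP d20.
by move: e1; rewrite d20 mulr0 addr0 => ->; rewrite eqxx.
Qed.

Lemma spin_continuous w x : continuous (fun t => spin (center a d t) w x).
Proof.
have -> : (fun t => spin (center a d t) w x) = affine_comb (spin (center a d 0) w x)
   ((spin (center a d 0) w x).1 + (velocity w).1, (spin (center a d 0) w x).2 + (velocity w).2).
  apply/funext => t; rewrite (spin_center t 0) /affine_comb /=.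
  by congr pair; ring.
exact: affine_comb_continuous.
Qed.

Lemma parallel_velocity c i e w : c = curve_at i e -> curve_G c w = 0 ->
  edge_parallel v e (velocity w).1 (velocity w).2.
Proof.
move=> ->; have w0 := sqrD1_neq0 w; rewrite /curve_G /edge_parallel /velocity /=.
set p := vtx v e; set q := vtx v (next e) => g0.
apply/eqP; rewrite -subr_eq0; apply/eqP.
transitivity (- 2 * ((q.2 - p.2) * d.1 + (p.1 - q.1) * d.2 +
   ((q.2 - p.2) * d.2 - (p.1 - q.1) * d.1) * w) / (1 + w ^+ 2)); first by field.
by rewrite g0 mulr0 mul0r.
Qed.

(* For a fixed angle move the center along the line, keeping the captured
   points, as far as possible. *)
Lemma line_to_curve t0 w : in_range t0 ->
  (0 < depth S v (spin (center a d t0) w))%N ->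
  exists c, [/\ is_curve c, curve_G c w != 0, in_range (curve_t c w) &
    (depth S v (spin (center a d t0) w) <= depth S v (pos c a d w))%N].
Proof.
move=> r0 dpos; set f := fun t => spin (center a d t) w.
pose X (i : 'I_n) := score_in m (score v (f t0 (vtx S i))).
(* The center moves forward only, which is why a curve is needed for the end [t = 1] of a segment
   but none for [t = 0]. *)
pose Q := [set t | [/\ in_range t, t0 <= t & forall i, X i -> region (f t (vtx S i))]].
have Qt0 : Q t0 by split=> // i /(scoreP simple).
have [i0 Xi0] : exists i, X i.
  apply: contrapT => H; move: dpos; rewrite /depth big1 // => i _.
  by apply/eqP; rewrite eqb0; apply/negP => Xi; apply: H; exists i.
(* The captured point [i0] moves with nonzero velocity and must stay within [reach], so one
   coordinate bounds [t]. *)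
have supQ : has_sup Q.
  split; first by exists t0.
  have [] : (velocity w).1 != 0 \/ (velocity w).2 != 0.
    have := velocity_neq0 w; case: (velocity w) => [v1 v2] /=.
    by rewrite xpair_eqE negb_and => /orP.
  - move=> v0; exists (t0 + (reach v + `|(f t0 (vtx S i0)).1|) / `|(velocity w).1|).
    move=> t [_ tt0 /(_ i0 Xi0)/(region_reach simple)[h _]].
    rewrite -lerBlDl ler_pdivlMr ?normr_gt0 // -[t - t0]ger0_norm ?subr_ge0 // -normrM.
    move: h; rewrite /f (spin_center t t0) -/(f t0 (vtx S i0)).
    set z := f t0 _; set vel := velocity w => /= h.
    rewrite (_ : (t - t0) * vel.1 = (z.1 + (t - t0) * vel.1) - z.1); last by ring.
    by apply: le_trans (ler_normB _ _) _; rewrite lerD2r.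
  - move=> v0; exists (t0 + (reach v + `|(f t0 (vtx S i0)).2|) / `|(velocity w).2|).
    move=> t [_ tt0 /(_ i0 Xi0)/(region_reach simple)[_ h]].
    rewrite -lerBlDl ler_pdivlMr ?normr_gt0 // -[t - t0]ger0_norm ?subr_ge0 // -normrM.
    move: h; rewrite /f (spin_center t t0) -/(f t0 (vtx S i0)).
    set z := f t0 _; set vel := velocity w => /= h.
    rewrite (_ : (t - t0) * vel.2 = (z.2 + (t - t0) * vel.2) - z.2); last by ring.
    by apply: le_trans (ler_normB _ _) _; rewrite lerD2r.
pose T := sup Q.
have ub t : Q t -> t <= T by move=> Qt; exact: sup_upper_bound.
(* The supremum is attained because the complement of the region is open. *)
have TQ : Q T.
  have t0T := ub _ Qt0; split=> //.
    move: r0; rewrite /in_range; case E: lin => //= /andP[h0 h1].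
    rewrite (le_trans h0 t0T) /=; apply: ge_sup; first by exists t0.
    by move=> t [+ _ _]; rewrite /in_range E => /andP[].
  move=> i Xi; apply: contrapT => nr.
  have : \forall y \near f T (vtx S i), ~ region y by exact: near_regionPn.
  move=> hn; have : \forall t \near T, ~ region (f t (vtx S i)) := @spin_continuous w (vtx S i) T _ hn.
  move=> /nbhs_ballP[e e0 He].
  have [t Qt tT] := sup_adherent e0 supQ.
  have [_ _ /(_ i Xi)] := Qt; apply: He; rewrite /ball /= ger0_norm ?subr_ge0 ?ub //.
  by rewrite ltrBlDr addrC -ltrBlDr.
have [rT t0T regT] := TQ.
suff [c [cc G0 tT]] : exists c, [/\ is_curve c, curve_G c w != 0 & curve_t c w = T].
  exists c; split=> //; rewrite ?tT //; apply: depth_mono => i Xi.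
  by rewrite /pos tT; exact: regT.
apply: contrapT => nc.
have T1 : ~~ lin -> T < 1.
  move=> nl; move: rT; rewrite /in_range (negbTE nl) /= => /andP[_].
  rewrite le_eqVlt => /orP[/eqP eT|//]; case: nc; exists (end_curve R); split.
  - by right.
  - by rewrite /curve_G /= mul0r addr0 oner_neq0.
  - by rewrite /curve_t /curve_G /curve_H eT /= sub0r !(mul0r, addr0) opprK divr1.
(* No curve passes through [T], so at an edge containing a captured point [G(w) = 0], the motion is
   parallel to the edge, and [region_leave] applies. A common further step then contradicts the
   choice of [T]. *)
have leave i : \forall s \near (0 : R), X i -> 0 < s -> region (f (T + s) (vtx S i)).
  case: (boolP (X i)) => [Xi|_]; last by near=> s.
  have := @region_leave _ v simple (f T (vtx S i)) (velocity w) (regT i Xi) (velocity_neq0 w).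
  move=> H; have : forall e, (e < m)%N -> on_edge v e (f T (vtx S i)) ->
      edge_parallel v e (velocity w).1 (velocity w).2.
    move=> e he oe; apply: (@parallel_velocity (curve_at i e) i) => //.
    apply: contrapT => /eqP G0; apply: nc; exists (curve_at i e); split=> //.
      by left; exists i, e; split.
    move: oe => /andP[/eqP c0 _].
    have := edge_curveE a d (vtx S i) (vtx v e) (vtx v (next e)) T w.
    rewrite c0 mul0r => /esym/eqP; rewrite mulf_eq0 oppr_eq0 pnatr_eq0 /= => /eqP HT.
    apply: (mulIf G0); rewrite /curve_t divfK //.
    by apply/eqP; rewrite -subr_eq0 -opprD oppr_eq0 HT.
  move/H; apply: filterS => s hs _ /hs.
  by rewrite /f (spin_center (T + s) T) (_ : T + s - T = s); last by ring.
have : \forall s \near (0 : R), forall i, X i -> 0 < s -> region (f (T + s) (vtx S i)).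
  exact: (@filter_forall _ _ (fun i s => X i -> 0 < s -> region (f (T + s) (vtx S i))) (nbhs (0 : R)) _ leave).
move=> /nbhs_ballP[e /= e0 He].
pose s := if lin then e / 2 else Num.min (e / 2) (1 - T).
have s0 : 0 < s.
  rewrite /s; case: (boolP lin) => [_|/T1 T1']; first by rewrite divr_gt0.
  by rewrite lt_min divr_gt0 // subr_gt0.
have se : s <= e / 2 by rewrite /s; case: (lin) => //; rewrite ge_min lexx.
have : T + s <= T.
  apply: ub; split.
  - rewrite /in_range /s; move: rT; rewrite /in_range.
    case: (boolP lin) => //= /T1 T1' /andP[T0 _]; apply/andP; split.
      by rewrite addr_ge0 // le_min divr_ge0 //= ?subr_ge0 ltW.
    by rewrite -lerBrDl ge_min lexx orbT.
  - by rewrite (le_trans t0T) // lerDl ltW.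
  - move=> i Xi; apply: He => //; rewrite /ball /= sub0r normrN gtr0_norm //.
    by lra.
by rewrite gerDl leNgt s0.
Unshelve. all: by end_near. Qed.

End Sweeping.

(** * Moving along a curve to a critical value *)

Section Critical.
Variables (R : realType) (S v : seq (R * R)) (a d : R * R) (lin : bool).
Hypothesis simple : simple_polygon v.
Implicit Types (x y : R * R) (w t : R) (c : curve R).
Local Notation m := (size v).
Local Notation n := (size S).
Local Notation next := (next_idx v).
Local Notation region := (polygon_region v).
Local Notation in_range := (in_range lin).
Local Notation critical := (critical S v a d).
Local Notation stat := (stat S v a d).

Lemma curve_G_continuous c : continuous (curve_G c).
Proof.
move=> w; apply: cvgD; first exact: cvg_cst.
by apply: cvgM; [exact: cvg_cst|exact: cvg_id].
Qed.

Lemma curve_t_continuous c w : curve_G c w != 0 -> {for w, continuous (curve_t c)}.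
Proof.
move=> G0; apply: cvgM.
  apply: cvgN; apply: cvgD; first exact: cvg_cst.
  apply: cvgM; last exact: cvg_id.
  by apply: cvgD; [exact: cvg_cst|apply: cvgM; [exact: cvg_cst|exact: cvg_id]].
by apply: cvgV => //; exact: curve_G_continuous.
Qed.

Lemma pos_continuous c w x : curve_G c w != 0 ->
  {for w, continuous (fun u => pos c a d u x)}.
Proof.
move=> G0; have ct := curve_t_continuous G0.
have cc (r s : R) : (r + curve_t c u * s) @[u --> w] --> r + curve_t c w * s.
  by apply: cvgD; [exact: cvg_cst|apply: cvgM; [exact: ct|exact: cvg_cst]].
have cw : (fun u : R => u) @ w --> w by exact: cvg_id.
have cden : (1 + u ^+ 2)^-1 @[u --> w] --> (1 + w ^+ 2)^-1.
  apply: cvgV; first exact: sqrD1_neq0.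
  by apply: cvgD; [exact: cvg_cst|exact: exprn_continuous].
have c1 : (pos c a d u x).1 @[u --> w] --> (pos c a d w x).1.
  apply: cvgD; first exact: cvg_cst.
  apply: cvgM => //; apply: cvgM; first exact: cvg_cst.
  apply: cvgD; first by apply: cvgB; [exact: cc|exact: cvg_cst].
  by apply: cvgM => //; apply: cvgB; [exact: cc|exact: cvg_cst].
have c2 : (pos c a d u x).2 @[u --> w] --> (pos c a d w x).2.
  apply: cvgD; first exact: cvg_cst.
  apply: cvgM => //; apply: cvgM; first exact: cvg_cst.
  apply: cvgB; first by apply: cvgB; [exact: cc|exact: cvg_cst].
  by apply: cvgM => //; apply: cvgB; [exact: cc|exact: cvg_cst].
exact: (cvg_pair c1 c2).
Qed.

Lemma sgr_noncritical c (i : interval R) P : P \in curve_polys c ->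
  {in i, forall w, ~~ critical c w} ->
  {in i &, forall u w, Num.sg (Poly P).[u] = Num.sg (Poly P).[w]}.
Proof.
move=> hP nc; apply: sgr_between => u /nc; apply: contra.
exact: critical_curve hP.
Qed.

Lemma stat_noncritical c (i : interval R) k e : (k < n)%N -> (e < m)%N ->
  {in i, forall w, ~~ critical c w} ->
  {in i &, forall u w, stat c k e u = stat c k e w}.
Proof.
move=> hk he nc; apply: atom_score_const => P hP w /nc; apply: contra.
exact: critical_atom hk he hP.
Qed.

(** [t = - H / G] and [1 - t = (H + G) / G], so the range is given by the signs of [H * G] and
    [(H + G) * G]. The roots of [H] and [H + G] are critical, and [G] has no zero on the
    interval. *)
Lemma in_range_noncritical c (i : interval R) :
  {in i, forall w, ~~ critical c w} -> {in i, forall w, curve_G c w != 0} ->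
  {in i &, forall u w, in_range (curve_t c u) -> in_range (curve_t c w)}.
Proof.
move=> nc G0 u w iu iw; rewrite /in_range; case: lin => //=.
have [sH sHG] : Num.sg (curve_H c u) = Num.sg (curve_H c w) /\
    Num.sg (curve_H c u + curve_G c u) = Num.sg (curve_H c w + curve_G c w).
  have HE r : (Poly [:: ch0 c; ch1 c; ch2 c]).[r] = curve_H c r.
    by rewrite horner_Poly /= /curve_H; ring.
  have HGE r : (Poly [:: ch0 c + cg0 c; ch1 c + cg1 c; ch2 c]).[r] = curve_H c r + curve_G c r.
    by rewrite horner_Poly /= /curve_H /curve_G; ring.
  by rewrite -!HGE -!HE; split; apply: (sgr_noncritical _ nc) => //; rewrite !inE eqxx ?orbT.
have sG : Num.sg (curve_G c u) = Num.sg (curve_G c w).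
  have GE r : (Poly [:: cg0 c; cg1 c]).[r] = curve_G c r.
    by rewrite horner_Poly /= /curve_G; ring.
  rewrite -!GE; apply: (@polyrN0_itv _ i) => // r /G0.
  by rewrite /root GE.
have tE r : r \in i -> (0 <= curve_t c r <= 1) =
    (Num.sg (curve_H c r) * Num.sg (curve_G c r) <= 0) &&
    (0 <= Num.sg (curve_H c r + curve_G c r) * Num.sg (curve_G c r)).
  move=> /G0 g0; rewrite -!sgrM sgr_le0 sgr_ge0 -[in curve_t c r <= 1]subr_ge0 /curve_t.
  have g2 : 0 < (curve_G c r ^+ 2)^-1 by rewrite invr_gt0 exprn_even_gt0.
  have -> : - curve_H c r / curve_G c r =
    - (curve_H c r * curve_G c r) * (curve_G c r ^+ 2)^-1 by field.
  have -> : 1 - - (curve_H c r * curve_G c r) * (curve_G c r ^+ 2)^-1 =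
    ((curve_H c r + curve_G c r) * curve_G c r) * (curve_G c r ^+ 2)^-1 by field.
  by rewrite !(pmulr_lge0 _ g2) oppr_ge0.
by rewrite !tE // sH sHG sG.
Qed.

(** On an interval without critical values all scores are constant. At a limit point [w1] of the
    interval the captured points are kept because the region is closed, and the range because it is
    closed. *)
Lemma slide_to_limit c w0 w1 (i : interval R) :
  (forall e, 0 < e -> exists2 u, u \in i & `|w1 - u| < e) -> w0 \in i ->
  {in i, forall w, ~~ critical c w} -> {in i, forall w, curve_G c w != 0} ->
  curve_G c w1 != 0 -> in_range (curve_t c w0) ->
  in_range (curve_t c w1) /\ (depth S v (pos c a d w0) <= depth S v (pos c a d w1))%N.
Proof.
move=> lim iw0 nc G0 G1 r0.
have adh (A : set R) : nbhs w1 A -> exists2 u, u \in i & A u.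
  by move=> /nbhs_ballP[e /= e0 H]; have [u iu hu] := lim e e0; exists u => //; exact: H.
split.
  have : forall u, u \in i -> in_range (curve_t c u).
    by move=> u iu; exact: (in_range_noncritical nc G0 iw0 iu r0).
  rewrite /in_range; case: lin => //= H; have ct := curve_t_continuous G1.
  apply/andP; split; rewrite leNgt; apply/negP => h.
    have hn : \forall u \near w1, curve_t c u < 0 by exact: (cvgr_lt _ ct).
    by have [u /H/andP[h1 _]] := adh _ hn; rewrite ltNge h1.
  have hn : \forall u \near w1, 1 < curve_t c u by exact: (cvgr_gt _ ct).
  by have [u /H/andP[_ h1]] := adh _ hn; rewrite ltNge h1.
apply: (depth_mono simple) => k Xk; apply: contrapT => nr.
have hn : \forall y \near pos c a d w1 (vtx S k), ~ region y by exact: near_regionPn.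
have hn' : \forall u \near w1, ~ region (pos c a d u (vtx S k)) := @pos_continuous c w1 _ G1 _ hn.
have [u iu] := adh _ hn'; apply; apply/(scoreP simple); move: Xk.
congr (is_true (score_in _ _)); apply: eq_bigr => e _.
have := stat_noncritical (ltn_ord k) (ltn_ord e) nc iw0 iu.
by rewrite /stat /atom_score (negbTE (G0 _ iw0)) (negbTE (G0 _ iu)).
Qed.

Lemma critical_beside c w0 : curve_G c w0 != 0 -> exists z0, critical c z0 /\
  forall u, (z0 <= u <= w0) || (w0 <= u <= z0) -> curve_G c u != 0.
Proof.
move=> G0; have [g10|g10] := eqVneq (cg1 c) 0.
  exists 0; split; last by move=> u _; move: G0; rewrite /curve_G g10 !mul0r.
  apply: (@critical_curve _ _ _ _ _ _ _ [:: 0; 1]); first by rewrite !inE eqxx !orbT.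
  rewrite in_rootsR; first by rewrite /root horner_Poly /= mul0r add0r mulr0 addr0.
  apply/eqP => /(congr1 (fun p : {poly R} => p`_1)).
  by rewrite coef_Poly coef0 /= => /eqP; rewrite oner_eq0.
(* [G] takes at [z0] the value 1 or -1 with the sign of [G(w0)], so the zero of [G] does not
   separate [z0] from [w0]; both choices are roots of [G^2 - 1]. *)
pose s := Num.sg (curve_G c w0).
pose z0 := (s - cg0 c) / cg1 c.
have Gz0 : curve_G c z0 = s by rewrite /curve_G /z0 mulrC divfK // addrC subrK.
have s2 : s * s = 1 by rewrite -expr2 sqr_sg G0.
exists z0; split.
  apply: (@critical_curve _ _ _ _ _ _ _
     [:: cg0 c * cg0 c - 1; 2 * (cg0 c * cg1 c); cg1 c * cg1 c]).
    by rewrite !inE eqxx !orbT.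
  rewrite in_rootsR.
    have -> : root (Poly [:: cg0 c * cg0 c - 1; 2 * (cg0 c * cg1 c); cg1 c * cg1 c]) z0 =
       (curve_G c z0 * curve_G c z0 - 1 == 0).
      by rewrite /root horner_Poly /= /curve_G; congr (_ == _); ring.
    by rewrite Gz0 s2 subrr.
  apply/eqP => /(congr1 (fun p : {poly R} => p`_2)).
  by rewrite coef_Poly coef0 /= => /eqP; rewrite mulf_eq0 (negbTE g10).
move=> u hu; apply/eqP => Gu.
have uE : u = - cg0 c / cg1 c.
  by apply: (mulIf g10); rewrite divfK //; move: Gu; rewrite /curve_G; lra.
have zE : z0 - u = s / cg1 c by rewrite /z0 uE; field.
have wE : w0 - u = curve_G c w0 / cg1 c by rewrite uE /curve_G; field.
have : 0 < (z0 - u) * (w0 - u).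
  have -> : (z0 - u) * (w0 - u) = (s * curve_G c w0) / (cg1 c ^+ 2).
    by rewrite zE wE; field.
  rewrite divr_gt0 ?exprn_even_gt0 //= /s.
  have [h|h] : curve_G c w0 < 0 \/ 0 < curve_G c w0 by move: G0; rewrite neq_lt => /orP.
    by rewrite ltr0_sg // mulN1r oppr_gt0.
  by rewrite gtr0_sg // mul1r.
by case/orP: hu => /andP[h1 h2]; nra.
Qed.

Lemma seq_max (s : seq R) z0 w0 : z0 \in s -> z0 <= w0 ->
  exists2 w1, w1 \in s & z0 <= w1 <= w0 /\ forall u, u \in s -> u <= w0 -> u <= w1.
Proof.
move=> hz zw; pose t := [seq u <- s | u <= w0].
have ht : z0 \in t by rewrite mem_filter zw.
have key (r : seq R) : r != [::] -> exists2 w1, w1 \in r & forall u, u \in r -> u <= w1.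
  elim: r => // x r IH _; have [->|/IH[w1 h1 h2]] := eqVneq r [::].
    by exists x; rewrite ?mem_head // => u; rewrite inE => /eqP->.
  have [h|h] := leP x w1.
    exists w1; first by rewrite inE h1 orbT.
    by move=> u; rewrite inE => /orP[/eqP->//|/h2].
  exists x; first by rewrite mem_head.
  move=> u; rewrite inE => /orP[/eqP->//|/h2 h3]; exact: le_trans h3 (ltW h).
have [|w1 h1 h2] := key t; first by apply: contraTneq ht => ->.
move: (h1); rewrite mem_filter => /andP[h3 h4]; exists w1 => //; split.
  by rewrite h3 h2.
by move=> u us uw; apply: h2; rewrite mem_filter uw.
Qed.

(** Slide from [w0] towards the critical value of [critical_beside] and stop at the first critical
    value met; [G] has no zero on the way. *)
Lemma curve_to_critical c w0 : curve_G c w0 != 0 -> in_range (curve_t c w0) ->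
  exists w1, [/\ critical c w1, curve_G c w1 != 0, in_range (curve_t c w1) &
    (depth S v (pos c a d w0) <= depth S v (pos c a d w1))%N].
Proof.
move=> G0 r0; have [cw0|ncw0] := boolP (critical c w0); first by exists w0.
have [z0 [cz0 Gz]] := critical_beside G0.
have [zw|wz] := leP z0 w0.
  have [w1 cw1 [/andP[z1 w1w] gap]] := seq_max cz0 zw.
  have lt1 : w1 < w0 by rewrite lt_neqAle w1w andbT; apply: contraNneq ncw0 => <-.
  have G1 : curve_G c w1 != 0 by apply: Gz; rewrite z1 w1w.
  have [||||r1 le] := @slide_to_limit c w0 w1 `]w1, w0] _ _ _ _ G1 r0.
  - move=> e e0; exists (Num.min w0 (w1 + e / 2)).
      by rewrite in_itv /= lt_min lt1 ltrDl divr_gt0 //= ge_min lexx.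
    have h1 : w1 < Num.min w0 (w1 + e / 2) by rewrite lt_min lt1 ltrDl divr_gt0.
    have h2 : Num.min w0 (w1 + e / 2) <= w1 + e / 2 by rewrite ge_min lexx orbT.
    by rewrite ltr0_norm ?subr_lt0 //; lra.
  - by rewrite in_itv /= lt1 lexx.
  - move=> u; rewrite in_itv /= => /andP[h1 h2]; apply/negP => /gap/(_ h2).
    by rewrite leNgt h1.
  - move=> u; rewrite in_itv /= => /andP[h1 h2]; apply: Gz.
    by rewrite h2 (le_trans z1 (ltW h1)).
  by exists w1.
(* The case [w0 < z0] is brought to [seq_max] by negating the critical values. *)
have cz0' : - z0 \in [seq - u | u <- [seq ev.1 | ev <- events S v a d c]].
  by apply/mapP; exists z0.
have zw' : - z0 <= - w0 by rewrite lerN2 ltW.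
have [w1' /mapP[w1 cw1 ->] [/andP[z1 w1w] gap]] := seq_max cz0' zw'.
rewrite !lerN2 in z1 w1w.
have lt1 : w0 < w1 by rewrite lt_neqAle w1w andbT; apply: contraNneq ncw0 => ->.
have G1 : curve_G c w1 != 0 by apply: Gz; rewrite z1 w1w orbT.
have [||||r1 le] := @slide_to_limit c w0 w1 `[w0, w1[ _ _ _ _ G1 r0.
- move=> e e0; exists (Num.max w0 (w1 - e / 2)).
    by rewrite in_itv /= gt_max lt1 ltrBlDr ltrDl divr_gt0 //= le_max lexx.
  have h1 : Num.max w0 (w1 - e / 2) < w1 by rewrite gt_max lt1 ltrBlDr ltrDl divr_gt0.
  have h2 : w1 - e / 2 <= Num.max w0 (w1 - e / 2) by rewrite le_max lexx orbT.
  by rewrite gtr0_norm ?subr_gt0 //; lra.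
- by rewrite in_itv /= lt1 lexx.
- move=> u; rewrite in_itv /= => /andP[h1 h2]; apply/negP => cu.
  have cu' : - u \in [seq - u | u <- [seq ev.1 | ev <- events S v a d c]].
    by apply/mapP; exists u.
  by have := gap _ cu'; rewrite !lerN2 h1 leNgt h2 => /(_ isT).
- move=> u; rewrite in_itv /= => /andP[h1 h2]; apply: Gz.
  by rewrite h1 (ltW (lt_le_trans h2 z1)) orbT.
by exists w1.
Qed.

Hypothesis d_neq0 : d != (0, 0).

Theorem depth_le_critical B :
  (forall c w, is_curve S v a d c -> critical c w -> curve_G c w != 0 ->
     in_range (curve_t c w) -> (depth S v (pos c a d w) <= B)%N) ->
  forall t w, in_range t -> (depth S v (spin (center a d t) w) <= B)%N.
Proof.
move=> H t w rt; have [->//|dpos] := posnP (depth S v (spin (center a d t) w)).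
have [c [cc G0 r0 le0]] := line_to_curve simple d_neq0 rt dpos.
have [w1 [cw1 G1 r1 le1]] := curve_to_critical G0 r0.
exact: leq_trans (leq_trans le0 le1) (H _ _ cc cw1 G1 r1).
Qed.

End Critical.

(** * The program *)

Declare Scope prog_scope.
Delimit Scope prog_scope with prog.
Notation "a .+n b" := (NB NAdd a b) (at level 50, left associativity) : prog_scope.
Notation "a .-n b" := (NB NSub a b) (at level 50, left associativity) : prog_scope.
Notation "a .*n b" := (NB NMul a b) (at level 40, left associativity) : prog_scope.
Notation "a .+r b" := (RB RAdd a b) (at level 50, left associativity) : prog_scope.
Notation "a .-r b" := (RB RSub a b) (at level 50, left associativity) : prog_scope.
Notation "a .*r b" := (RB RMul a b) (at level 40, left associativity) : prog_scope.
Notation "a ./r b" := (RB RDiv a b) (at level 40, left associativity) : prog_scope.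
Notation "'N[' a ]" := (NV a (NK 0)) (at level 0, format "N[ a ]") : prog_scope.
Notation "'R[' a ]" := (RV a (NK 0)) (at level 0, format "R[ a ]") : prog_scope.
Notation "a <-n e" := (CN a (NK 0) e) (at level 60) : prog_scope.
Notation "a <-r e" := (CR a (NK 0) e) (at level 60) : prog_scope.
Notation rk k := (RN (NK k)).
Local Open Scope prog_scope.

(* Columns of naturals: the sizes [vn], [vm], [vs] of the input; the segment
   [vK] and the atom [vI], [vE] that determine the current curve; the current
   atom [vi], [ve] and its contribution [vval]; the number [vc] of events; the
   present and the best number [vcnt], [vbest] of captured points; the atoms of
   the events, unsorted [OI], [OE] and sorted [SI], [SE]; the tournament tree
   [TR].  The RAM can neither halve a natural nor take its parity, hence the
   tables [HF] of halves and [TB] of the values of [score_in]. *)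
Notation vn := 0%N (only parsing).
Notation vm := 1%N (only parsing).
Notation vs := 2%N (only parsing).
Notation vI := 3%N (only parsing).
Notation vE := 4%N (only parsing).
Notation vK := 5%N (only parsing).
Notation vi := 6%N (only parsing).
Notation ve := 7%N (only parsing).
Notation vc := 8%N (only parsing).
Notation vval := 9%N (only parsing).
Notation vcnt := 10%N (only parsing).
Notation vbest := 11%N (only parsing).
Notation vrc := 12%N (only parsing).
Notation vk := 13%N (only parsing).
Notation vl := 14%N (only parsing).
Notation vt := 15%N (only parsing).
Notation vu := 16%N (only parsing).
Notation vj := 17%N (only parsing).
Notation OI := 20%N (only parsing).
Notation OE := 21%N (only parsing).
Notation SI := 22%N (only parsing).
Notation SE := 23%N (only parsing).
Notation TR := 24%N (only parsing).
Notation HF := 25%N (only parsing).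
Notation CUR := 26%N (only parsing).
Notation SM := 27%N (only parsing).
Notation TB := 28%N (only parsing).

(* Columns of reals: the line of centers [ra + t * rd]; the coefficients [rg],
   [rh] of the curve; a point [rx], an edge from [rp] to [rq] and the moved
   point [rf]; the half cotangent [rw]; the best configuration [ro], [rth]; the
   unsorted and sorted events [KEY], [SKEY]; the coefficients [BUF] of a
   polynomial, and [XC], [YC] of the moved point. *)
Notation ra1 := 0%N (only parsing).
Notation ra2 := 1%N (only parsing).
Notation rd1 := 2%N (only parsing).
Notation rd2 := 3%N (only parsing).
Notation rg0 := 4%N (only parsing).
Notation rg1 := 5%N (only parsing).
Notation rh0 := 6%N (only parsing).
Notation rh1 := 7%N (only parsing).
Notation rh2 := 8%N (only parsing).
Notation rx1 := 9%N (only parsing).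
Notation rx2 := 10%N (only parsing).
Notation rp1 := 11%N (only parsing).
Notation rp2 := 12%N (only parsing).
Notation rq1 := 13%N (only parsing).
Notation rq2 := 14%N (only parsing).
Notation rf1 := 15%N (only parsing).
Notation rf2 := 16%N (only parsing).
Notation rw := 17%N (only parsing).
Notation rwk := 18%N (only parsing).
Notation rt := 19%N (only parsing).
Notation rg := 20%N (only parsing).
Notation rc := 21%N (only parsing).
Notation rr1 := 22%N (only parsing).
Notation ro1 := 23%N (only parsing).
Notation ro2 := 24%N (only parsing).
Notation rth := 25%N (only parsing).
Notation rz := 26%N (only parsing).
Notation rr2 := 27%N (only parsing).
Notation rden := 28%N (only parsing).
Notation KEY := 30%N (only parsing).
Notation SKEY := 31%N (only parsing).
Notation BUF := 32%N (only parsing).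
Notation XC := 33%N (only parsing).
Notation YC := 34%N (only parsing).

Definition load_point : cmd :=
  rx1 <-r RI (NK 2 .*n N[vi]);;
  rx2 <-r RI (NK 2 .*n N[vi] .+n NK 1).

Definition load_edge : cmd :=
  vu <-n N[ve] .+n NK 1;;
  CIf (BNlt N[vu] N[vm]) CSkip (vu <-n NK 0);;
  rp1 <-r RI (NK 2 .*n (N[vn] .+n N[ve]));;
  rp2 <-r RI (NK 2 .*n (N[vn] .+n N[ve]) .+n NK 1);;
  rq1 <-r RI (NK 2 .*n (N[vn] .+n N[vu]));;
  rq2 <-r RI (NK 2 .*n (N[vn] .+n N[vu]) .+n NK 1).

Definition edge_test : cmd :=
  rc <-r (R[rq1] .-r R[rp1]) .*r (R[rf2] .-r R[rp2]) .-r
         (R[rq2] .-r R[rp2]) .*r (R[rf1] .-r R[rp1]);;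
  rr1 <-r (R[rf1] .-r R[rp1]) .*r (R[rf1] .-r R[rq1]) .+r
          (R[rf2] .-r R[rp2]) .*r (R[rf2] .-r R[rq2]);;
  vval <-n NK 0;;
  CIf (BAnd (BRlt R[rf2] R[rp2]) (BAnd (BRle R[rq2] R[rf2]) (BRlt R[rc] (rk 0))))
    (vval <-n NK 1) CSkip;;
  CIf (BAnd (BRlt R[rf2] R[rq2]) (BAnd (BRle R[rp2] R[rf2]) (BRlt (rk 0) R[rc])))
    (vval <-n NK 1) CSkip;;
  CIf (BAnd (BAnd (BRle R[rc] (rk 0)) (BRle (rk 0) R[rc])) (BRle R[rr1] (rk 0)))
    (vval <-n N[vval] .+n (N[vm] .+n NK 1)) CSkip.

Definition eval_G : cmd := rg <-r R[rg0] .+r R[rg1] .*r R[rw].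

Definition eval_t : cmd :=
  rt <-r (rk 0 .-r (R[rh0] .+r (R[rh1] .+r R[rh2] .*r R[rw]) .*r R[rw])) ./r R[rg].

Definition G_is_zero : bexp := BAnd (BRle R[rg] (rk 0)) (BRle (rk 0) R[rg]).

Definition eval_pos : cmd :=
  eval_t;;
  rr1 <-r R[ra1] .+r R[rt] .*r R[rd1];;
  rr2 <-r R[ra2] .+r R[rt] .*r R[rd2];;
  rden <-r rk 1 .+r R[rw] .*r R[rw];;
  rf1 <-r R[rx1] .+r (rk 2 .*r ((R[rr1] .-r R[rx1]) .+r R[rw] .*r (R[rr2] .-r R[rx2]))) ./r R[rden];;
  rf2 <-r R[rx2] .+r (rk 2 .*r ((R[rr2] .-r R[rx2]) .-r R[rw] .*r (R[rr1] .-r R[rx1]))) ./r R[rden].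

Definition eval_atom : cmd :=
  eval_G;;
  CIf G_is_zero (vval <-n NK 0) (eval_pos;; edge_test).

(** The point is withdrawn from the total with its old sum and counted again with the new one, in
    constant time. *)
Definition update_counts : cmd :=
  vj <-n N[vi] .*n N[vm] .+n N[ve];;
  vcnt <-n N[vcnt] .-n NV TB (NV SM N[vi]);;
  CN SM N[vi] (NV SM N[vi] .-n NV CUR N[vj] .+n N[vval]);;
  CN CUR N[vj] N[vval];;
  vcnt <-n N[vcnt] .+n NV TB (NV SM N[vi]).

Definition update_atom : cmd :=
  load_point;; load_edge;; eval_atom;; update_counts.

(** The operand list of a root instruction is program text and always names the seven cells, so
    missing coefficients are filled with 0. *)
Definition set_buf (es : seq rexp) : cmd :=
  foldr (fun k c => CR BUF (NK k) (nth (rk 0) es k);; c) CSkip (iota 0 7).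

Definition is_zero_at (k : nat) : bexp :=
  BAnd (BRle (RV BUF (NK k)) (rk 0)) (BRle (rk 0) (RV BUF (NK k))).

Definition buf_is_zero : bexp :=
  foldr (fun k b => BAnd (is_zero_at k) b) (is_zero_at 0) (iota 1 6).

Definition add_root (k : nat) : cmd :=
  CIf (BNlt (NK k) N[vrc])
    (CRoot rz k BUF 7;;
     CR KEY N[vc] R[rz];; CN OI N[vc] N[vi];; CN OE N[vc] N[ve];;
     vc <-n N[vc] .+n NK 1)
    CSkip.

(** The rank of a root is part of the instruction, hence the unrolled code instead of a loop. *)
Fixpoint add_first_roots (k : nat) : cmd :=
  if k is k'.+1 then add_first_roots k';; add_root k' else CSkip.

Definition add_roots : cmd :=
  CIf buf_is_zero CSkip (CCount vrc BUF 7;; add_first_roots 6).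

Fixpoint add_polys (Ps : seq (seq rexp)) : cmd :=
  if Ps is es :: Ps' then set_buf es;; add_roots;; add_polys Ps' else CSkip.

Definition curve_polys_r : seq (seq rexp) :=
  [:: [:: R[rh0]; R[rh1]; R[rh2]];
      [:: R[rh0] .+r R[rg0]; R[rh1] .+r R[rg1]; R[rh2]];
      [:: R[rg0] .*r R[rg0] .-r rk 1; rk 2 .*r (R[rg0] .*r R[rg1]); R[rg1] .*r R[rg1]];
      [:: rk 0; rk 1]].

Definition set_nums : cmd :=
  let u0 := R[rg0] .*r (R[ra1] .-r R[rx1]) .-r R[rh0] .*r R[rd1] in
  let u1 := R[rg1] .*r (R[ra1] .-r R[rx1]) .-r R[rh1] .*r R[rd1] in
  let u2 := rk 0 .-r R[rh2] .*r R[rd1] in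
  let v0 := R[rg0] .*r (R[ra2] .-r R[rx2]) .-r R[rh0] .*r R[rd2] in
  let v1 := R[rg1] .*r (R[ra2] .-r R[rx2]) .-r R[rh1] .*r R[rd2] in
  let v2 := rk 0 .-r R[rh2] .*r R[rd2] in
  CR XC (NK 0) (R[rx1] .*r R[rg0] .+r rk 2 .*r u0);;
  CR XC (NK 1) (R[rx1] .*r R[rg1] .+r rk 2 .*r (u1 .+r v0));;
  CR XC (NK 2) (R[rx1] .*r R[rg0] .+r rk 2 .*r (u2 .+r v1));;
  CR XC (NK 3) (R[rx1] .*r R[rg1] .+r rk 2 .*r v2);;
  CR YC (NK 0) (R[rx2] .*r R[rg0] .+r rk 2 .*r v0);;
  CR YC (NK 1) (R[rx2] .*r R[rg1] .+r rk 2 .*r (v1 .-r u0));;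
  CR YC (NK 2) (R[rx2] .*r R[rg0] .+r rk 2 .*r (v2 .-r u1));;
  CR YC (NK 3) (R[rx2] .*r R[rg1] .-r rk 2 .*r u2).

Definition den_r (k : nat) : rexp := if odd k then R[rg1] else R[rg0].
Definition shift_r (C p k : nat) : rexp := RV C (NK k) .-r R[p] .*r den_r k.

Definition conv_r (C p q k : nat) : rexp :=
  foldr (fun i e => (shift_r C p i .*r shift_r C q (k - i)) .+r e) (rk 0)
    [seq i <- iota 0 4 | (i <= k < i + 4)%N].

Definition atom_polys_r : seq (seq rexp) :=
  [:: [:: R[rg0]; R[rg1]];
      [seq shift_r YC rp2 i | i <- iota 0 4];
      [seq shift_r YC rq2 i | i <- iota 0 4];
      [seq (R[rq1] .-r R[rp1]) .*r shift_r YC rp2 i .-r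
           (R[rq2] .-r R[rp2]) .*r shift_r XC rp1 i | i <- iota 0 4];
      [seq conv_r XC rp1 rq1 k .+r conv_r YC rp2 rq2 k | k <- iota 0 7]].

Definition gen_events : cmd :=
  vc <-n NK 0;; vi <-n NK 0;; ve <-n NK 0;;
  add_polys curve_polys_r;;
  For vi N[vn]
    (load_point;; set_nums;;
     For ve N[vm] (load_edge;; add_polys atom_polys_r)).

(* Tournament sort: the leaves [N + k] of a binary tree hold the numbers [k] of
   the events that remain (or [N]), and an inner node holds the better of the
   entries of its sons. *)
Definition play (t : nexp) : cmd :=
  let a := NV TR (NK 2 .*n t) in
  let b := NV TR (NK 2 .*n t .+n NK 1) in
  CIf (BNle N[vc] a) (CN TR t b)
    (CIf (BNle N[vc] b) (CN TR t a)
      (CIf (BRle (RV KEY a) (RV KEY b)) (CN TR t a) (CN TR t b))).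

(** Inner nodes are played from [vc - 1] down to 1, sons before fathers, and each visited node
    enters itself as the half of its sons' indices. The entry 0 at index 1 ends the climb in
    [pop]. *)
Definition build_tree : cmd :=
  CN HF (NK 1) (NK 0);;
  For vk N[vc] (CN TR (N[vc] .+n N[vk]) N[vk]);;
  For vk (N[vc] .-n NK 1)
    (vt <-n N[vc] .-n NK 1 .-n N[vk];;
     CN HF (NK 2 .*n N[vt]) N[vt];;
     CN HF (NK 2 .*n N[vt] .+n NK 1) N[vt];;
     play N[vt]).

Definition pop : cmd :=
  vu <-n NV TR (NK 1);;
  CR SKEY N[vk] (RV KEY N[vu]);;
  CN SI N[vk] (NV OI N[vu]);;
  CN SE N[vk] (NV OE N[vu]);;
  CN TR (N[vc] .+n N[vu]) N[vc];;
  vt <-n NV HF (N[vc] .+n N[vu]);;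
  CWhile (BNlt (NK 0) N[vt]) (play N[vt];; vt <-n NV HF N[vt]).

Definition sort_events : cmd := build_tree;; For vk N[vc] pop.

(** The sweep starts one unit below the least event. With all counters cleared, the ordinary update
    of every atom establishes them. *)
Definition init_sweep : cmd :=
  For vi N[vn] (CN SM N[vi] (NK 0);;
    For ve N[vm] (CN CUR (N[vi] .*n N[vm] .+n N[ve]) (NK 0)));;
  vcnt <-n NK 0;;
  rw <-r RV SKEY (NK 0) .-r rk 1;;
  For vi N[vn] (For ve N[vm] update_atom).

Definition pass : cmd :=
  vl <-n N[vk];;
  CWhile (BAnd (BNlt N[vl] N[vc]) (BRle (RV SKEY N[vl]) R[rwk]))
    (vi <-n NV SI N[vl];; ve <-n NV SE N[vl];; update_atom;; vl <-n N[vl] .+n NK 1).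

Definition record_best : cmd :=
  CIf (BNlt N[vbest] N[vcnt])
    (vbest <-n N[vcnt];;
     ro1 <-r R[ra1] .+r R[rt] .*r R[rd1];;
     ro2 <-r R[ra2] .+r R[rt] .*r R[rd2];;
     rc <-r (R[rw] .*r R[rw] .-r rk 1) ./r (rk 1 .+r R[rw] .*r R[rw]);;
     CAcos rth rc;;
     CIf (BRlt R[rw] (rk 0))
       (rc <-r rk 0 .-r rk 1;; CAcos rr1 rc;; rth <-r rk 2 .*r R[rr1] .-r R[rth])
       CSkip)
    CSkip.

Definition check_best (lin : bool) : cmd :=
  eval_G;;
  CIf G_is_zero CSkip
    (eval_t;;
     if lin then record_best
     else CIf (BAnd (BRle (rk 0) R[rt]) (BRle R[rt] (rk 1))) record_best CSkip).

(** The events with one critical value are passed twice: first their atoms are evaluated at the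
    value itself, where the count is compared with the best, then at a point of the following
    gap. *)
Definition sweep_group (lin : bool) : cmd :=
  rwk <-r RV SKEY N[vk];;
  rw <-r R[rwk];;
  pass;;
  check_best lin;;
  CIf (BNlt N[vl] N[vc])
    (rw <-r (R[rwk] .+r RV SKEY N[vl]) ./r rk 2)
    (rw <-r R[rwk] .+r rk 1);;
  pass;;
  vk <-n N[vl].

Definition sweep (lin : bool) : cmd :=
  vk <-n NK 0;; CWhile (BNlt N[vk] N[vc]) (sweep_group lin).

Definition process_curve (lin : bool) : cmd :=
  gen_events;; sort_events;; init_sweep;; sweep lin.

Definition load_curve : cmd :=
  vi <-n N[vI];; ve <-n N[vE];; load_point;; load_edge;;
  let n1 := R[rq2] .-r R[rp2] in
  let n2 := R[rp1] .-r R[rq1] in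
  rh2 <-r (n1 .*r (R[rx1] .-r R[rp1]) .+r n2 .*r (R[rx2] .-r R[rp2])) ./r rk 2;;
  rg0 <-r n1 .*r R[rd1] .+r n2 .*r R[rd2];;
  rg1 <-r n1 .*r R[rd2] .-r n2 .*r R[rd1];;
  rh0 <-r R[rh2] .+r (n1 .*r (R[ra1] .-r R[rx1]) .+r n2 .*r (R[ra2] .-r R[rx2]));;
  rh1 <-r n1 .*r (R[ra2] .-r R[rx2]) .-r n2 .*r (R[ra1] .-r R[rx1]).

Definition load_end_curve : cmd :=
  rg0 <-r rk 1;; rg1 <-r rk 0;; rh0 <-r rk 0 .-r rk 1;; rh1 <-r rk 0;; rh2 <-r rk 0.

Definition load_center (k : nexp) (r1 r2 : nat) : cmd :=
  r1 <-r RI (NK 2 .*n (N[vn] .+n N[vm] .+n k));;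
  r2 <-r RI (NK 2 .*n (N[vn] .+n N[vm] .+n k) .+n NK 1).

Definition process_segment (lin : bool) : cmd :=
  load_center N[vK] ra1 ra2;;
  load_center (N[vK] .+n NK 1) rd1 rd2;;
  rd1 <-r R[rd1] .-r R[ra1];;
  rd2 <-r R[rd2] .-r R[ra2];;
  For vI N[vn] (For vE N[vm] (load_curve;; process_curve lin));;
  load_end_curve;; process_curve lin.

(** Each of the m edges scores at most m + 2, so (m + 2)^2 exceeds every sum that is looked up. *)
Definition table_size : nexp := (N[vm] .+n NK 2) .*n (N[vm] .+n NK 2).

Definition fill_table : cmd :=
  CN TB (NK 0) (NK 0);;
  For vk table_size
    (CIf (BNle (N[vk] .+n NK 1) N[vm])
      (CN TB (N[vk] .+n NK 1) (NK 1 .-n NV TB N[vk]))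
      (CN TB (N[vk] .+n NK 1) (NK 1))).

(* The angle 0 has no half cotangent; the center is then irrelevant. *)
Definition process_identity : cmd :=
  load_center (NK 0) ro1 ro2;;
  rth <-r rk 0;;
  vbest <-n NK 0;;
  For vi N[vn]
    (load_point;; rf1 <-r R[rx1];; rf2 <-r R[rx2];;
     vl <-n NK 0;;
     For ve N[vm] (load_edge;; edge_test;; vl <-n N[vl] .+n N[vval]);;
     vbest <-n N[vbest] .+n NV TB N[vl]).

(** A line is treated as one segment with unrestricted parameter; its input has no third size, hence
    the assignment of 1. *)
Definition solve (lin : bool) : cmd :=
  (if lin then vs <-n NK 1 else CSkip);;
  fill_table;; process_identity;;
  For vK N[vs] (process_segment lin).

(** The sizes start at addresses that serve as temporaries, and the answer must end there; both are
    moved directly. *)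
Definition copy_in (v : nat) : program := Do (NMove (Dir (cell v 0)) (Dir v)).
Definition copy_out (v a : nat) : program := Do (RMove (Dir v) (Dir (cell a 0))).

Definition main_program (lin : bool) : program :=
  Seq (Seq (copy_in vn) (Seq (copy_in vm) (copy_in vs)))
 (Seq (compile (solve lin))
      (Seq (copy_out 0 ro1) (Seq (copy_out 1 ro2) (copy_out 2 rth)))).

Lemma wf_solve lin : wf (solve lin).
Proof. by case: lin; vm_compute. Qed.

(** * Blocks of the program *)

Ltac splits := repeat match goal with
  | |- is_true true => reflexivity
  | |- is_true true -> _ => move=> _
  | |- is_true false -> _ => by []
  | |- and _ _ => split
  | |- and3 _ _ _ => split
  | |- and4 _ _ _ _ => split
  | |- and5 _ _ _ _ _ => split
  end.

Section Input.
Variable R : realType.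
Implicit Types pts : seq (R * R).

Lemma size_coordinates pts : size (coordinates pts) = (2 * size pts)%N.
Proof. by elim: pts => //= x pts IH; rewrite /coordinates /= in IH *; rewrite IH; lia. Qed.

Lemma nth_coordinates pts i :
  nth 0 (coordinates pts) (2 * i) = (nth (0, 0) pts i).1 /\
  nth 0 (coordinates pts) (2 * i + 1) = (nth (0, 0) pts i).2.
Proof.
elim: pts i => [|x pts IH] i; first by rewrite !nth_nil.
case: i => [//|i]; have [e1 e2] := IH i.
by rewrite mulnS add2n !addSn.
Qed.

End Input.

Section Blocks.
Variables (R : realType) (S P L : seq (R * R)) (height : nat).
Local Notation n := (size S).
Local Notation m := (size P).
Local Notation input := (coordinates (S ++ P ++ L)).
Local Notation run := (run height input).
Implicit Types (h g : memory R).

Definition env h : Prop := na h vn 0%N = n /\ na h vm 0%N = m.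

Lemma input_S i : (i < n)%N ->
  [/\ @nth R 0 input (2 * i) = (vtx S i).1, @nth R 0 input (2 * i + 1) = (vtx S i).2 &
      (2 * i + 1 < size input)%N].
Proof.
move=> hi; have [-> ->] := nth_coordinates (S ++ P ++ L) i.
by rewrite nth_cat hi size_coordinates !size_cat; split=> //; lia.
Qed.

Lemma input_P e : (e < m)%N ->
  [/\ @nth R 0 input (2 * (n + e)) = (vtx P e).1, @nth R 0 input (2 * (n + e) + 1) = (vtx P e).2 &
      (2 * (n + e) + 1 < size input)%N].
Proof.
move=> he; have [-> ->] := nth_coordinates (S ++ P ++ L) (n + e).
rewrite nth_cat ltnNge leq_addr /= addKn.
by rewrite nth_cat he size_coordinates !size_cat; split=> //; lia.
Qed.

Lemma input_L k : (k < size L)%N ->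
  [/\ @nth R 0 input (2 * (n + m + k)) = (vtx L k).1,
      @nth R 0 input (2 * (n + m + k) + 1) = (vtx L k).2 &
      (2 * (n + m + k) + 1 < size input)%N].
Proof.
move=> hk; have [-> ->] := nth_coordinates (S ++ P ++ L) (n + m + k).
rewrite -addnA nth_cat ltnNge leq_addr /= addKn.
rewrite nth_cat ltnNge leq_addr /= addKn.
by rewrite size_coordinates !size_cat; split=> //; lia.
Qed.

Hypothesis height0 : (0 < height)%N.

Lemma run_load_point h i : env h -> na h vi 0%N = i -> (i < n)%N ->
  run load_point h 2 (fun g => (ra g rx1 0%N, ra g rx2 0%N) = vtx S i).
Proof.
move=> [en em] ei hi; have [e1 e2 e3] := input_S hi.
apply: wp_run; rewrite /=.
by rewrite height0 ei e1 e2 e3 /= (leq_ltn_trans _ e3) ?leq_addr //; split=> //; case: (vtx S i).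
Qed.

Definition x_of h : R * R := (ra h rx1 0%N, ra h rx2 0%N).
Definition p_of h : R * R := (ra h rp1 0%N, ra h rp2 0%N).
Definition q_of h : R * R := (ra h rq1 0%N, ra h rq2 0%N).
Definition f_of h : R * R := (ra h rf1 0%N, ra h rf2 0%N).
Definition a_of h : R * R := (ra h ra1 0%N, ra h ra2 0%N).
Definition d_of h : R * R := (ra h rd1 0%N, ra h rd2 0%N).
Definition curve_of h : curve R :=
  Curve (ra h rg0 0%N) (ra h rg1 0%N) (ra h rh0 0%N) (ra h rh1 0%N) (ra h rh2 0%N).

Lemma run_load_edge h e : env h -> na h ve 0%N = e -> (e < m)%N ->
  run load_edge h (steps load_edge)
    (fun g => p_of g = vtx P e /\ q_of g = vtx P (next_idx P e)).
Proof.
move=> [en em] ee he; have [p1 p2 p3] := input_P he.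
have [q1 q2 q3] := input_P (next_lt he).
apply: wp_run; rewrite /= height0 !en !em !ee p1 p2 p3 /= (leq_ltn_trans _ p3) ?leq_addr //.
rewrite /p_of /q_of /= -!surjective_pairing; splits=> // lt.
  have ne : next_idx P e = (e + 1)%N by rewrite /next_idx -addn1 modn_small.
  rewrite ne in q1 q2 q3 *; rewrite q1 q2 q3 (leq_ltn_trans _ q3) ?leq_addr //.
  by rewrite -surjective_pairing; splits.
have ne : next_idx P e = 0%N.
  rewrite -leqNgt addn1 in lt; have em1 : e.+1 = m by lia.
  by rewrite /next_idx em1 modnn.
rewrite ne in q1 q2 q3 *; rewrite q1 q2 q3 (leq_ltn_trans _ q3) ?leq_addr //.
by rewrite -surjective_pairing; splits.
Qed.

Lemma run_edge_test h : env h -> run edge_test h (steps edge_test)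
  (fun g => na g vval 0%N = edge_score m (p_of h) (q_of h) (f_of h)).
Proof.
move=> [en em]; apply: wp_run; rewrite /= height0 /=.
rewrite /edge_score /hit /on /cross /dot /p_of /q_of /f_of /=.
set C := _ - _ * (ra h 15 0 - ra h 11 0); set D := _ + _.
rewrite (eq_le C) em.
case: [&& _, _ & C < 0]; case: [&& _, _ & 0 < C]; case: (_ && (D <= 0)) => /=;
  splits => //=; rewrite ?mul1n ?mul0n ?addn0 ?addn1 //.
Qed.

Lemma run_eval_atom h : env h -> run eval_atom h (steps eval_atom)
  (fun g => na g vval 0%N =
     atom_score m (curve_of h) (a_of h) (d_of h) (x_of h) (p_of h) (q_of h) (ra h rw 0%N)).
Proof.
move=> eh; have [en em] := eh.
have -> : steps eval_atom = (steps eval_G + (1 + (steps eval_pos + steps edge_test)).+1)%N by [].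
apply: (wp_seq (Q1 := fun g => g = setR h rg 0 (curve_G (curve_of h) (ra h rw 0%N)))).
  by rewrite /= height0.
move=> g -> _; set h1 := setR _ _ _ _.
have zE : evB input h1 G_is_zero = (curve_G (curve_of h) (ra h rw 0%N) == 0).
  by rewrite /= eq_le.
rewrite /atom_score -zE; apply: run_if; first by rewrite /= height0.
  move=> z; rewrite z; apply: (run_weaken (T := 1) (Q := fun g => na g vval 0%N = 0%N)) => //.
  by apply: wp_run; rewrite /= height0.
move=> z; rewrite (negbTE z); rewrite zE in z.
apply: (run_weaken (T := (steps eval_pos + steps edge_test)%N) (Q := (fun g => na g vval 0%N =
  edge_score m (p_of h) (q_of h) (pos (curve_of h) (a_of h) (d_of h) (ra h rw 0%N) (x_of h))))) => //.
apply: (wp_seq (Q1 := fun g => f_of g = pos (curve_of h) (a_of h) (d_of h) (ra h rw 0%N) (x_of h))).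
  rewrite /= height0 /=.
  rewrite -!expr2 sqrD1_neq0 sub0r; splits => //.
move=> {}g ef ag; have eg : env g by rewrite /env !(proj1 ag).
apply: run_weaken (run_edge_test eg) _ _ => // g' -> _.
by rewrite ef /p_of /q_of !(proj2 ag).
Qed.

Lemma agree_env c h g : agree c h g -> ~~ writes_n c vn -> ~~ writes_n c vm ->
  env h -> env g.
Proof. by move=> [ag _] wn wm [en em]; rewrite /env !ag. Qed.

(* Running classification counters: [CUR] holds the contributions of the
   atoms, [SM] their sums for the points, and [vcnt] the number of the points
   classified as captured. *)
Definition atom_index (i e : nat) : nat := (i * m + e)%N.

Definition cur h i e : nat := na h CUR (atom_index i e).

Definition table_ok h : Prop := forall k, (k <= m * m.+2)%N -> na h TB k = score_in m k.

Definition counts_ok h : Prop :=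
  [/\ forall i e, (i < n)%N -> (e < m)%N -> (cur h i e <= m.+2)%N,
      forall i, (i < n)%N -> na h SM i = (\sum_(e < m) cur h i e)%N &
      na h vcnt 0%N = (\sum_(i < n) score_in m (na h SM i))%N].

Lemma atom_index_inj i e i' e' : (e < m)%N -> (e' < m)%N ->
  (atom_index i e == atom_index i' e') = (i == i') && (e == e').
Proof.
move=> he he'; apply/eqP/andP => [E|[/eqP-> /eqP->]//].
have m0 : (0 < m)%N by apply: leq_ltn_trans he.
have ii : i = i'.
  by have := congr1 (divn^~ m) E; rewrite /= !divnMDl // !divn_small // !addn0.
by move/eqP: E; rewrite ii /atom_index eqn_add2l eqxx => ->.
Qed.

Lemma run_update_counts h i e : env h -> table_ok h -> counts_ok h ->
  (n * m <= height)%N -> (m * m.+2 < height)%N ->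
  na h vi 0%N = i -> na h ve 0%N = e -> (i < n)%N -> (e < m)%N ->
  (na h vval 0%N <= m.+2)%N ->
  run update_counts h (steps update_counts)
   (fun g => counts_ok g /\ forall i' e', (i' < n)%N -> (e' < m)%N ->
      cur g i' e' = if (i' == i) && (e' == e) then na h vval 0%N else cur h i' e').
Proof.
move=> [en em] tb [c1 c2 c3] nmh mmh ei ee hi he hv.
apply: wp_run; rewrite /= height0 em ei ee /=.
have m0 : (0 < m)%N by apply: leq_ltn_trans he.
have ih : (i < height)%N.
  by apply: leq_trans nmh; apply: leq_trans hi _; rewrite leq_pmulr.
have idx : (i * m + e < height)%N.
  by apply: leq_trans nmh; apply: (@leq_trans (i.+1 * m)); [rewrite mulSn addnC ltn_add2r|rewrite leq_mul2r hi orbT].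
pose i0 := Ordinal hi; pose e0 := Ordinal he.
set rest := (\sum_(k < m | k != e0) cur h i k)%N.
have es : na h 27 i = (na h 26 (i * m + e) + rest)%N.
  by rewrite c2 // (bigD1 e0).
have bound (u : 'I_m -> nat) : (forall k, (u k <= m.+2)%N) -> (\sum_(k < m) u k <= m * m.+2)%N.
  move=> hu; apply: (@leq_trans (\sum_(k < m) m.+2)%N); first exact: leq_sum.
  by rewrite sum_nat_const card_ord.
have sb : (na h 27 i <= m * m.+2)%N by rewrite c2 //; apply: bound => k; exact: c1.
set s' := (na h 27 i - na h 26 (i * m + e) + na h 9 0)%N.
have es' : s' = (na h 9 0 + rest)%N by rewrite /s' es addKn addnC.
rewrite eqxx; set g := setN _ 10%N 0 _.
have curE i' e' : (i' < n)%N -> (e' < m)%N ->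
    cur g i' e' = if (i' == i) && (e' == e) then na h vval 0%N else cur h i' e'.
  by move=> hi' he'; rewrite /cur /= -(atom_index_inj _ _ he' he).
have sumE i' : (i' < n)%N -> na g SM i' = (\sum_(k < m) cur g i' k)%N.
  move=> hi'; have -> : na g SM i' = if i' == i then s' else na h SM i' by [].
  have [->|ne] := eqVneq i' i.
    rewrite (bigD1 e0) // curE // !eqxx es'; congr addn.
    by apply: eq_bigr => k ke; rewrite curE // eqxx ifN.
  by rewrite c2 //; apply: eq_bigr => k _; rewrite curE // (negbTE ne).
have c1' i' e' : (i' < n)%N -> (e' < m)%N -> (cur g i' e' <= m.+2)%N.
  by move=> hi' he'; rewrite curE //; case: ifP => // _; exact: c1.
have sb' : (s' <= m * m.+2)%N.
  have := sumE i hi; have -> : na g SM i = if i == i then s' else na h SM i by [].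
  rewrite eqxx => ->; apply: bound => k; exact: c1'.
rewrite ih (leq_ltn_trans sb mmh) (leq_ltn_trans sb' mmh) idx; splits => //.
split=> //; have -> : na g vcnt 0%N =
  (na h vcnt 0%N - na h TB (na h SM i) + na h TB s')%N by [].
(* Only the summand of point [i] changes. It is subtracted from a sum that contains it, so truncated
   subtraction is exact. *)
rewrite c3 !tb // (bigD1 i0) //= addKn addnC [RHS](bigD1 i0) //= eqxx.
by congr addn; apply: eq_bigr => k ki; rewrite ifN.
Qed.

Definition load_ok h c a d : Prop := [/\ curve_of h = c, a_of h = a & d_of h = d].

Lemma agree_load cm h g c a d : agree cm h g ->
  (forall k, (k < 9)%N -> ~~ writes_r cm k) -> load_ok h c a d -> load_ok g c a d.
Proof.
move=> [_ ag] H [<- <- <-]; split; rewrite /curve_of /a_of /d_of;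
  by rewrite ?ag // H.
Qed.

Lemma agree_table c h g : agree c h g -> ~~ writes_n c TB -> table_ok h -> table_ok g.
Proof. by move=> [ag _] w tb k hk; rewrite ag // tb. Qed.

Lemma agree_counts c h g : agree c h g -> ~~ writes_n c CUR -> ~~ writes_n c SM ->
  ~~ writes_n c vcnt -> counts_ok h -> counts_ok g.
Proof.
move=> [ag _] w1 w2 w3 [c1 c2 c3]; split=> [i e hi he|i hi|].
- by rewrite /cur ag //; exact: c1.
- by rewrite ag // c2 //; apply: eq_bigr => e _; rewrite /cur ag.
- by rewrite ag // c3; apply: eq_bigr => i _; rewrite ag.
Qed.

Lemma agree_cur c h g i e : agree c h g -> ~~ writes_n c CUR -> cur g i e = cur h i e.
Proof. by move=> [ag _] w; rewrite /cur ag. Qed.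

Lemma atom_score_le M (c : curve R) a d x p q w : (atom_score M c a d x p q w <= M.+2)%N.
Proof.
by rewrite /atom_score; case: ifP => // _; exact: edge_score_le.
Qed.

Definition sizes_ok : Prop := (n * m <= height)%N /\ (m * m.+2 < height)%N.

Lemma run_update_atom h i e c a d w : sizes_ok -> env h -> table_ok h -> counts_ok h ->
  load_ok h c a d -> ra h rw 0%N = w ->
  na h vi 0%N = i -> na h ve 0%N = e -> (i < n)%N -> (e < m)%N ->
  run update_atom h (steps update_atom)
   (fun g => counts_ok g /\ forall i' e', (i' < n)%N -> (e' < m)%N ->
      cur g i' e' = if (i' == i) && (e' == e) then stat S P a d c i e w else cur h i' e').
Proof.
move=> [nmh mmh] eh tb co lo ew ei ee hi he.
apply: (call_seq (run_load_point eh ei hi)) => h1 x1 ag1.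
have eh1 : env h1 by apply: agree_env ag1 _ _ eh.
apply: (call_seq (run_load_edge eh1 _ he)); first by rewrite (proj1 ag1).
move=> h2 [p2 q2] ag2.
have eh2 : env h2 by apply: agree_env ag2 _ _ eh1.
apply: (call_seq (run_eval_atom eh2)) => h3 v3 ag3.
have eh3 : env h3 by apply: agree_env ag3 _ _ eh2.
have v3E : na h3 vval 0%N = stat S P a d c i e w.
  rewrite v3 /stat -p2 -q2 -x1.
  have lo1 : load_ok h1 c a d by apply: agree_load ag1 _ lo; do 9?case=> //.
  have lo2 : load_ok h2 c a d by apply: agree_load ag2 _ lo1; do 9?case=> //.
  have [-> -> ->] := lo2; congr atom_score.
    by rewrite /x_of !(proj2 ag2).
  by rewrite (proj2 ag2) // (proj2 ag1).
apply: run_weaken.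
- apply: (@run_update_counts h3 i e) => //.
  + by apply: agree_table ag3 _ _ => //; apply: agree_table ag2 _ _ => //; apply: agree_table ag1 _ _.
  + by apply: agree_counts ag3 _ _ _ _ => //; apply: agree_counts ag2 _ _ _ _ => //; apply: agree_counts ag1 _ _ _ _.
  + by rewrite (proj1 ag3) // (proj1 ag2) // (proj1 ag1).
  + by rewrite (proj1 ag3) // (proj1 ag2) // (proj1 ag1).
  + by rewrite v3E; exact: atom_score_le.
- by [].
- move=> g [cg curE] _; split=> // i' e' hi' he'; rewrite curE // v3E.
  case: ifP => // _; rewrite /cur (proj1 ag3) // (proj1 ag2) // (proj1 ag1) //.
Qed.

End Blocks.

(** * Event generation *)

Section EventGeneration.
Variables (R : realType) (S P L : seq (R * R)) (height : nat).
Local Notation n := (size S).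
Local Notation m := (size P).
Local Notation input := (coordinates (S ++ P ++ L)).
Local Notation run := (run height input).
Local Notation env := (env S P).
Implicit Types (h g : memory R).
Hypothesis height7 : (7 <= height)%N.

Let height0 : (0 < height)%N. Proof. exact: leq_trans height7. Qed.

(* Expressions whose value is not affected by the recording of events. *)
Fixpoint stable_n (e : nexp) : bool :=
  match e with
  | NK _ => true
  | NV a i => (a \notin [:: vc; vrc; OI; OE]) && stable_n i
  | NB _ e1 e2 => stable_n e1 && stable_n e2
  end.

Fixpoint stable_r (e : rexp) : bool :=
  match e with
  | RV a i => (a \notin [:: rz; KEY; BUF]) && stable_n i
  | RN e | RI e => stable_n e
  | RB _ e1 e2 => stable_r e1 && stable_r e2
  end.

Definition same h g : Prop :=
  (forall a, a \notin [:: vc; vrc; OI; OE] -> na g a = na h a) /\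
  (forall a, a \notin [:: rz; KEY; BUF] -> ra g a = ra h a).

Lemma same_evN h g e : same h g -> stable_n e -> evN g e = evN h e.
Proof.
move=> [sn _]; elim: e => //= [a i IH /andP[ha /IH->]|op e1 IH1 e2 IH2 /andP[/IH1-> /IH2->]//].
by rewrite sn.
Qed.

Lemma same_okN h g e : same h g -> stable_n e -> okN height g e = okN height h e.
Proof.
move=> sg; elim: e => //= [a i IH /andP[_ si]|op e1 IH1 e2 IH2 /andP[/IH1-> /IH2->]//].
by rewrite IH // (same_evN sg si).
Qed.

Lemma same_evR h g e : same h g -> stable_r e -> evR input g e = evR input h e.
Proof.
move=> sg; elim: e => //= [a i /andP[ha si]|e se|e se|op e1 IH1 e2 IH2 /andP[/IH1-> /IH2->]//].
- by rewrite (same_evN sg si) (proj2 sg).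
- by rewrite (same_evN sg se).
- by rewrite (same_evN sg se).
Qed.

Lemma same_okR h g e : same h g -> stable_r e -> okR height input g e = okR height input h e.
Proof.
move=> sg; elim: e => //= [a i /andP[ha si]|e se|e se|op e1 IH1 e2 IH2 /andP[s1 s2]].
- by rewrite (same_okN sg si) (same_evN sg si).
- by rewrite (same_okN sg se).
- by rewrite (same_okN sg se) (same_evN sg se).
- by rewrite IH1 // IH2 // (same_evR sg s2).
Qed.

Lemma same_set h g k x : same h g -> same h (setR g BUF k x).
Proof.
move=> [sn sr]; split=> a ha /=; first exact: sn.
rewrite -sr //; apply/funext => j.
by case: eqP ha => // ->.
Qed.

Lemma run_set_buf h (es : seq rexp) : all stable_r es -> all (okR height input h) es ->
  (size es <= 7)%N ->
  run (set_buf es) h (steps (set_buf es))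
    (fun g => colpoly g BUF 7 = Poly [seq evR input h e | e <- es]).
Proof.
move=> st ok s7; have st' k : stable_r (nth (rk 0) es k).
  have [hk|hk] := ltnP k (size es); first exact: (all_nthP _ st).
  by rewrite nth_default.
have ok' k : okR height input h (nth (rk 0) es k).
  have [hk|hk] := ltnP k (size es); first exact: (all_nthP _ ok).
  by rewrite nth_default.
have nthE k : evR input h (nth (rk 0) es k) = [seq evR input h e | e <- es]`_k.
  have [hk|hk] := ltnP k (size es); first by rewrite (nth_map (rk 0)).
  by rewrite !nth_default ?size_map.
have s0 : same h h by split.
have okE g k : same h g -> okR height input g (nth (rk 0) es k).
  by move=> sg; rewrite (same_okR sg).
have evE g k : same h g -> evR input g (nth (rk 0) es k) = [seq evR input h e | e <- es]`_k.
  by move=> sg; rewrite (same_evR sg).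
have wpE k c (Q : memory R -> Prop) g : same h g -> (k < 7)%N ->
    wp height input c Q (setR g BUF k [seq evR input h e | e <- es]`_k) ->
    wp height input (CR BUF (NK k) (nth (rk 0) es k) ;; c) Q g.
  move=> sg hk w; rewrite /= evE // okE //.
  by split; [|by []|exact: leq_trans hk height7|exact: w].
apply: wp_run; rewrite /set_buf [foldr _ _ _]/=.
do 7! [apply: (wpE); [by do ?apply: same_set|by []|]].
rewrite /=; apply/polyP => i; rewrite coef_poly coef_Poly.
case: ltnP => hi; last by rewrite nth_default // size_map (leq_trans s7).
by move: i hi; do 7?[case=> //].
Qed.

Lemma buf_is_zeroE h : evB input h buf_is_zero = (colpoly h BUF 7 == 0).
Proof.
have zE k : evB input h (is_zero_at k) = (ra h BUF k == 0) by rewrite /= eq_le.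
have -> : evB input h buf_is_zero = all (fun k => ra h BUF k == 0) (iota 0 7).
  rewrite /buf_is_zero [foldr _ _ _]/= [evB _ _ _]/=.
  rewrite -!eq_le /= andbT; do 6 rewrite andbC -!andbA; by do ?case: eqP.
apply/allP/eqP => [H|p0 k].
  apply/polyP => i; rewrite coef_poly coef0; case: ltnP => // hi.
  by apply/eqP/H; rewrite mem_iota.
rewrite mem_iota => /andP[_ hk].
by move/polyP/(_ k): p0; rewrite coef_poly hk coef0 => ->.
Qed.

Lemma buf_is_zero_ok h : okB height input h buf_is_zero.
Proof.
rewrite /= !andbT; have H k : (k < 7)%N -> (k < height)%N by move=> hk; exact: leq_trans hk height7.
by rewrite !H.
Qed.

Definition event_at h k : R * (nat * nat) := (ra h KEY k, (na h OI k, na h OE k)).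
Definition event_list h : seq (R * (nat * nat)) :=
  [seq event_at h k | k <- iota 0 (na h vc 0%N)].

Lemma run_add_first_roots j h (p : {poly R}) i e : p != 0 -> colpoly h BUF 7 = p ->
  na h vrc 0%N = size (rootsR p) -> na h vi 0%N = i -> na h ve 0%N = e ->
  (na h vc 0 + j < height)%N ->
  run (add_first_roots j) h (steps (add_first_roots j)) (fun g =>
    event_list g = event_list h ++ [seq (w, (i, e)) | w <- take j (rootsR p)] /\
    (na g vc 0 <= na h vc 0 + j)%N).
Proof.
move=> p0 hp hrc hi he; elim: j => [|j IH] hc.
  by apply: wp_run; rewrite /= take0 cats0 addn0.
apply: (call_seq (IH _)); first by lia.
move=> g [evg cg] ag.
have wn a : a \notin [:: vc; OI; OE] -> na g a = na h a.
  move=> ha; apply: (proj1 ag); elim: {IH hc evg cg ag} j => //= j IH.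
  by rewrite (negbTE IH) /= !orbF; move: ha; rewrite !inE !negb_or => /and3P[/negbTE-> /negbTE-> /negbTE->].
have wr : ra g BUF = ra h BUF.
  by apply: (proj2 ag); elim: {IH hc evg cg ag} j => //= j IH; rewrite negb_or IH.
have hp' : colpoly g BUF 7 = p by rewrite -hp /colpoly wr.
apply: wp_run; rewrite /= wn // hrc height0 height7 hp' p0 /=; splits => //.
  move=> lt; splits => //.
  - have := hc; lia.
  - have := hc; lia.
  - have := hc; lia.
  - rewrite (take_nth 0 lt) map_rcons -cats1 catA -evg /event_list /=.
    rewrite iotaD map_cat /= /event_at /= eqxx (wn vi) // (wn ve) // hi he.
    congr cat; apply/eq_in_map => k; rewrite mem_iota /= => hk.
    by rewrite (ltn_eqF hk).
  - by rewrite addn1 addnS ltnS.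
rewrite -leqNgt => le; splits => //; last by lia.
by rewrite evg !take_oversize // (leq_trans le).
Qed.

Lemma steps_add_first_roots j : steps (add_first_roots j) = (6 * j)%N.
Proof. by elim: j => //= j ->; rewrite mulnS addnC. Qed.

Lemma run_add_roots h i e : na h vi 0%N = i -> na h ve 0%N = e ->
  (na h vc 0 + 6 < height)%N ->
  run add_roots h 38 (fun g =>
    event_list g = event_list h ++ [seq (w, (i, e)) | w <- rootsR (colpoly h BUF 7)] /\
    (na g vc 0 <= na h vc 0 + 6)%N).
Proof.
move=> hi he hc; apply: run_if; first exact: buf_is_zero_ok.
  rewrite buf_is_zeroE => /eqP p0; exists 0%N, h; split=> //; first exact: hx_skip.
  by rewrite p0 rootsR0 cats0 leq_addr.
rewrite buf_is_zeroE => p0.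
apply: (wp_seq (T := 36) (Q1 := fun g => g = setN h vrc 0 (size (rootsR (colpoly h BUF 7))))).
  by rewrite /= height0 height7 p0.
move=> g -> _; have := @run_add_first_roots 6 (setN h vrc 0 (size (rootsR (colpoly h BUF 7))))
  (colpoly h BUF 7) i e p0 erefl erefl hi he hc.
rewrite steps_add_first_roots => r; apply: run_weaken r _ _ => // g' [-> cg] _; split=> //.
(* Seven coefficients mean degree at most 6, so six unrolled steps record all roots. *)
rewrite take_oversize //; apply: size_rootsR; exact: size_poly.
Qed.

Definition evs h := map (evR input h).

(** The polynomials are those of the initial memory although events are recorded in between;
    stability of the expressions makes up for this. The cost 45 consists of 7 steps for the buffer
    and 38 for at most six roots. *)
Lemma run_add_polys (Ps : seq (seq rexp)) h i e :
  all (all stable_r) Ps -> all (all (okR height input h)) Ps -> all (fun es => size es <= 7)%N Ps ->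
  na h vi 0%N = i -> na h ve 0%N = e -> (na h vc 0 + 6 * size Ps < height)%N ->
  run (add_polys Ps) h (45 * size Ps) (fun g =>
    event_list g = event_list h ++ root_events (i, e) [seq evs h es | es <- Ps] /\
    (na g vc 0 <= na h vc 0 + 6 * size Ps)%N).
Proof.
elim: Ps h => [|es Ps IH] h /=.
  by move=> _ _ _ _ _ _; apply: wp_run; rewrite /= cats0 addn0.
move=> /andP[st sts] /andP[ok oks] /andP[s7 s7s] hi he hc.
have -> : (45 * (size Ps).+1 = 7 + (38 + 45 * size Ps))%N by lia.
apply: (call_seq (run_set_buf st ok s7)) => h1 p1 ag1.
have same1 : same h h1 by split=> a; [move=> _; apply: (proj1 ag1)|rewrite !inE !negb_or => /and3P[_ _ /negbTE hb]; apply: (proj2 ag1); rewrite /= hb].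
apply: (call_seq (run_add_roots (i := i) (e := e) _ _ _)).
- by rewrite (proj1 ag1).
- by rewrite (proj1 ag1).
- by rewrite (proj1 ag1) //; lia.
move=> h2 [ev2 c2] ag2.
have c1 : na h1 vc 0%N = na h vc 0%N by rewrite (proj1 ag1).
have same2 : same h h2.
  split=> a; rewrite !inE !negb_or.
    move=> ha; rewrite (proj1 ag2); first by rewrite (proj1 ag1).
    by case/and4P: ha => /negbTE /= -> /negbTE-> /negbTE-> /negbTE->.
  move=> ha; rewrite (proj2 ag2); first by rewrite (proj1 (conj (proj2 same1 a _) I)) // !inE !negb_or.
  by case/and3P: ha => /negbTE /= -> /negbTE-> _.
have oks2 : all (all (okR height input h2)) Ps.
  elim: {IH hc s7s} Ps sts oks => //= es' Ps IHP /andP[s1 s2] /andP[q1 q2].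
  rewrite IHP // andbT; elim: es' s1 q1 => //= x es' IHe /andP[s1 s3] /andP[q1 q3].
  by rewrite (same_okR same2) // q1 IHe.
have vi2 : na h2 vi 0%N = i by rewrite (proj1 same2).
have ve2 : na h2 ve 0%N = e by rewrite (proj1 same2).
apply: run_weaken (IH h2 sts oks2 s7s vi2 ve2 _) _ _ => //; first by lia.
move=> g [evg cg] _; split; last by lia.
rewrite evg ev2 -catA; congr cat.
  by rewrite /event_list c1; apply: eq_map => k; rewrite /event_at !(proj1 ag1) // (proj2 ag1).
rewrite /root_events /= p1; congr (_ ++ flatten _).
have -> // : [seq evs h2 es0 | es0 <- Ps] = [seq evs h es0 | es0 <- Ps].
elim: {IH hc s7s oks oks2 evg cg} Ps sts => //= es' Ps IHP /andP[s1 s2].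
rewrite IHP //; congr cons; elim: es' s1 => //= x es' IHe /andP[s1 s3].
by rewrite (same_evR same2) // IHe.
Qed.

Definition nums_of h : seq R * seq R :=
  ([seq ra h XC i | i <- iota 0 4], [seq ra h YC i | i <- iota 0 4]).

Lemma run_set_nums h : run set_nums h (steps set_nums) (fun g =>
  nums_of g = num_coefs (curve_of h) (a_of h) (d_of h) (x_of h)).
Proof.
have h4 k : (k <= 4)%N -> (k < height)%N by move=> hk; exact: leq_ltn_trans hk (leq_trans _ height7).
by apply: wp_run; rewrite /= height0 !h4 //=; splits.
Qed.

Lemma evs_atom_polys h c a d x p q : load_ok h c a d -> x_of h = x -> p_of h = p ->
  q_of h = q -> nums_of h = num_coefs c a d x ->
  [seq evs h es | es <- atom_polys_r] = atom_polys c a d x p q.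
Proof.
move=> [ec ea ed] ex ep eq en; rewrite /atom_polys -en /edge_polys /den_coefs -ec -ep -eq.
by rewrite /evs /nums_of /conv_coef /shift_coefs unlock.
Qed.

Lemma evs_curve_polys h c a d : load_ok h c a d ->
  [seq evs h es | es <- curve_polys_r] = curve_polys c.
Proof. by move=> [<- _ _]. Qed.

Lemma flatten_iotaS (T : Type) (f : nat -> seq T) k :
  flatten [seq f i | i <- iota 0 k.+1] = flatten [seq f i | i <- iota 0 k] ++ f k.
Proof. by rewrite -addn1 iotaD map_cat flatten_cat /= cats0. Qed.

(** 225 is the cost of the five polynomials of an atom at 45 steps each, as 180 in [gen_time] is
    that of the four polynomials of the curve. *)
Definition edge_loop_time : nat := (m * (steps load_edge + 225 + 2) + 2)%N.

Lemma run_gen_edges h c a d i : env h -> load_ok h c a d -> (i < n)%N ->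
  na h vi 0%N = i -> x_of h = vtx S i -> nums_of h = num_coefs c a d (vtx S i) ->
  (na h vc 0 + 30 * m < height)%N ->
  run (For ve N[vm]%prog (load_edge;; add_polys atom_polys_r)) h edge_loop_time (fun g =>
    event_list g = event_list h ++
      flatten [seq root_events (i, e) (polys_at S P a d c i e) | e <- iota 0 m] /\
    (na g vc 0 <= na h vc 0 + 30 * m)%N).
Proof.
move=> eh lo hi ei ex en hc.
apply: (run_for (I := fun e g => event_list g = event_list h ++
    flatten [seq root_events (i, e') (polys_at S P a d c i e') | e' <- iota 0 e] /\
    (na g vc 0 <= na h vc 0 + 30 * e)%N)).
- exact: height0.
- by [].
- move=> g ag; rewrite /= height0 (proj1 ag) //; split=> //; exact: (proj2 eh).
- by rewrite /= cats0 muln0 addn0.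
- move=> e g he [evg cg] ee ag.
  have eg : env g by apply: agree_env ag _ _ eh.
  apply: (call_seq (run_load_edge L height0 eg ee he)) => g1 [p1 q1] ag1.
  have lo1 : load_ok g1 c a d.
    by apply: (agree_load ag1); [do 9?case=> //|apply: (agree_load ag); [do 9?case=> //|]].
  have x1 : x_of g1 = vtx S i by rewrite /x_of !(proj2 ag1) // !(proj2 ag).
  have n1 : nums_of g1 = num_coefs c a d (vtx S i).
    by rewrite -en /nums_of !(proj2 ag1) // !(proj2 ag).
  have E := evs_atom_polys lo1 x1 p1 q1 n1.
  have hk k : (k < 7)%N -> (k < height)%N by move=> hk; exact: leq_trans hk height7.
  apply: run_weaken (run_add_polys (i := i) (e := e) _ _ _ _ _ _) _ _ => //.
  + by rewrite /= height0 !hk.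
  + by rewrite (proj1 ag1) // (proj1 ag).
  + by rewrite (proj1 ag1).
  + rewrite (proj1 ag1) // /=; move: cg hc he; clear; lia.
  + move=> g2 [ev2 c2] ag2; rewrite E in ev2; split.
      rewrite (_ : event_list (setN g2 _ _ _) = event_list g2) //.
      rewrite ev2 flatten_iotaS catA -evg; congr cat.
      by rewrite /event_list !(proj1 ag1) //; apply: eq_map => k; rewrite /event_at !(proj1 ag1) // (proj2 ag1).
    by move: c2; rewrite (proj1 ag1) //=; move: cg; clear; lia.
- by move=> g [evg cg] _ _.
Qed.

Definition gen_time : nat :=
  (3 + 180 + (n * (2 + steps set_nums + edge_loop_time + 2) + 2))%N.

Lemma run_gen_events h c a d : env h -> load_ok h c a d -> (24 + 30 * (n * m) < height)%N ->
  run gen_events h gen_time (fun g =>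
    event_list g = events S P a d c /\ (na g vc 0 <= 24 + 30 * (n * m))%N).
Proof.
move=> eh lo hc.
apply: (wp_seq (p := (vc <-n NK 0)%prog) (T := (2 + 180 + (n * (2 + steps set_nums + edge_loop_time + 2) + 2))%N)
  (Q1 := fun g => g = setN h vc 0 0)); first by rewrite /= height0.
move=> g -> _.
apply: (wp_seq (p := (vi <-n NK 0)%prog) (T := (1 + 180 + (n * (2 + steps set_nums + edge_loop_time + 2) + 2))%N)
  (Q1 := fun g => g = setN (setN h vc 0 0) vi 0 0)); first by rewrite /= height0.
move=> {}g -> _.
apply: (wp_seq (p := (ve <-n NK 0)%prog) (T := (180 + (n * (2 + steps set_nums + edge_loop_time + 2) + 2))%N)
  (Q1 := fun g => g = setN (setN (setN h vc 0 0) vi 0 0) ve 0 0)); first by rewrite /= height0.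
move=> {}g -> _.
apply: (call_seq (T1 := 180) (run_add_polys (i := 0) (e := 0) (Ps := curve_polys_r) _ _ _ _ _ _)) => //.
- by rewrite /= height0.
- by rewrite /=; move: hc; clear; lia.
move=> g1 [ev1 c1] ag1.
have eg1 : env g1 by apply: agree_env ag1 _ _ _ => //; exact: eh.
have lo1 : load_ok g1 c a d by apply: (agree_load ag1); [do 9?case=> //|exact: lo].
have ev1' : event_list g1 = root_events (0, 0)%N (curve_polys c) by rewrite ev1 (@evs_curve_polys (setN (setN (setN h vc 0 0) vi 0 0) ve 0 0) c a d lo).
have c1' : (na g1 vc 0 <= 24)%N by move: c1; rewrite /=; lia.
apply: (run_for (I := fun i g => event_list g = root_events (0, 0)%N (curve_polys c) ++
    flatten [seq flatten [seq root_events (i', e) (polys_at S P a d c i' e) | e <- iota 0 m] | i' <- iota 0 i] /\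
    (na g vc 0 <= 24 + 30 * (i * m))%N)).
- exact: height0.
- by [].
- by move=> {}g ag; rewrite /= height0 (proj1 ag) //; split=> //; exact: (proj1 eg1).
- by rewrite /= cats0 mul0n muln0 addn0.
- move=> i g2 hi [ev2 c2] ei ag2.
  have eg2 : env g2 by apply: agree_env ag2 _ _ eg1.
  have -> : (2 + steps set_nums + edge_loop_time = 2 + (steps set_nums + edge_loop_time))%N by rewrite addnA.
  apply: (call_seq (run_load_point L height0 eg2 ei hi)) => g3 x3 ag3.
  apply: (call_seq (run_set_nums g3)) => g4 n4 ag4.
  have lo2 : load_ok g2 c a d by apply: (agree_load ag2); [do 9?case=> //|].
  have lo3 : load_ok g3 c a d by apply: (agree_load ag3); [do 9?case=> //|].
  have lo4 : load_ok g4 c a d by apply: (agree_load ag4); [do 9?case=> //|].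
  have eg3 : env g3 by apply: agree_env ag3 _ _ eg2.
  have eg4 : env g4 by apply: agree_env ag4 _ _ eg3.
  have c4 : na g4 vc 0%N = na g2 vc 0%N by rewrite (proj1 ag4) // (proj1 ag3).
  have mm : (24 + 30 * (i * m) + 30 * m <= 24 + 30 * (n * m))%N.
    by rewrite -addnA -mulnDr addnC addnC -mulSnr leq_add2l leq_mul2l /= leq_mul2r hi orbT.
  apply: run_weaken (run_gen_edges eg4 lo4 hi _ _ _ _) _ _ => //.
  + by rewrite (proj1 ag4) // (proj1 ag3).
  + by rewrite -x3 /x_of !(proj2 ag4).
  + by rewrite n4 -x3; have [-> -> ->] := lo3.
  + rewrite c4; apply: leq_ltn_trans hc; apply: leq_trans mm; by rewrite leq_add2r.
  + move=> g5 [ev5 c5] ag5; split.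
      rewrite (_ : event_list (setN g5 _ _ _) = event_list g5) //.
      rewrite ev5 flatten_iotaS catA -ev2; congr cat.
      rewrite /event_list c4; apply: eq_map => k.
      by rewrite /event_at !(proj1 ag4) // !(proj2 ag4) // !(proj1 ag3) // (proj2 ag3).
    by rewrite /= mulSn; move: c5 c2; rewrite c4; clear; lia.
- by move=> g2 [ev2 c2] _ _; split.
Qed.

End EventGeneration.

(** * Sorting *)

Section Tournament.
Variables (R : realType) (N : nat) (key : nat -> R).
Implicit Types (T : nat -> nat) (a b c i j : nat).

Definition better a b : nat :=
  if (N <= a)%N then b else if (N <= b)%N then a else if key a <= key b then a else b.

(** The preorder of the tournament: numbers from [N] on stand for removed events and come last. *)
Definition beats a b : bool := (N <= b)%N || ((a < N)%N && (key a <= key b)).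

Definition node_ok T i : Prop := T i = better (T (2 * i)%N) (T (2 * i + 1)%N).

Lemma beats_refl a : beats a a.
Proof. by rewrite /beats lexx andbT leqNgt; case: ltnP. Qed.

Lemma beats_trans b a c : beats a b -> beats b c -> beats a c.
Proof.
rewrite /beats; case: (leqP N c) => //= _; case: (leqP N b) => //= _.
by move=> /andP[-> ab] bc; exact: le_trans bc.
Qed.

Lemma better_beats a b : beats (better a b) a /\ beats (better a b) b.
Proof.
rewrite /better; have [ha|ha] := leqP N a.
  by split; [rewrite /beats ha|exact: beats_refl].
have [hb|hb] := leqP N b; first by split; [exact: beats_refl|rewrite /beats hb].
have [h|h] := leP (key a) (key b); split; rewrite ?beats_refl // /beats.
  by rewrite ha h orbT.
by rewrite hb (ltW h) orbT.
Qed.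

(** Induction from a node to its father [j./2], which beats both of its sons. *)
Lemma root_beats T j : (forall i, (0 < i < N)%N -> node_ok T i) -> (0 < j < 2 * N)%N ->
  beats (T 1) (T j).
Proof.
move=> H; have [k] := ubnP j; elim: k j => // k IH j jk /andP[j0 jN].
have [->|j1] := eqVneq j 1%N; first exact: beats_refl.
have hi : (0 < j./2 < N)%N by lia.
apply: beats_trans (IH j./2 _ _) _; [lia|lia|].
have [b1 b2] := better_beats (T (2 * j./2)%N) (T (2 * j./2 + 1)%N).
rewrite (H _ hi); case: (boolP (odd j)) => oj.
  by rewrite [in T j](_ : j = (2 * j./2 + 1)%N) //; lia.
by rewrite [in T j](_ : j = (2 * j./2)%N) //; lia.
Qed.

Lemma root_leaf T : (forall i, (0 < i < N)%N -> node_ok T i) -> (0 < N)%N ->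
  exists2 k, (k < N)%N & T 1 = T (N + k)%N.
Proof.
move=> H N0.
suff G d i : (2 * N - i <= d)%N -> (0 < i < 2 * N)%N -> exists2 k, (k < N)%N & T i = T (N + k)%N.
  by apply: (G (2 * N)%N); lia.
elim: d i => [|d IH] i hd hi; first by lia.
have [iN|Ni] := ltnP i N; last by exists (i - N)%N; [lia|congr T; lia].
have [k1 hk1 e1] := IH (2 * i)%N ltac:(lia) ltac:(lia).
have [k2 hk2 e2] := IH (2 * i + 1)%N ltac:(lia) ltac:(lia).
have : T i = T (2 * i)%N \/ T i = T (2 * i + 1)%N.
  rewrite (H i); last by lia.
  by rewrite /better; case: ifP => _; [right|case: ifP => _; [left|case: ifP => _; [left|right]]].
by move=> [->|->]; [exists k1|exists k2].
Qed.

End Tournament.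

(** * The tournament sort as a program *)

Section Sort.
Variables (R : realType) (input : seq R) (height N : nat).
Local Notation run := (run height input).
Implicit Types (h g : memory R).
Hypothesis height_ge : (2 * N + 2 < height)%N.

Let height0 : (0 < height)%N. Proof. lia. Qed.

Definition half_ok h : Prop := forall j, (0 < j < 2 * N)%N -> na h HF j = j./2.

Lemma run_play h t : na h vc 0%N = N -> na h vt 0%N = t -> (t < N)%N ->
  run (play N[vt]%prog) h (steps (play N[vt]%prog)) (fun g =>
    g = setN h TR t (better N (ra h KEY) (na h TR (2 * t)) (na h TR (2 * t + 1)))).
Proof.
move=> hc ht tN; apply: wp_run; rewrite /= hc ht height0 /better.
have -> : (2 * t < height)%N by lia.
have -> : (2 * t + 1 < height)%N by lia.
have th : (t < height)%N by lia.
rewrite th /=; splits => //; first by move=> ->; splits.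
move=> a1; rewrite (negbTE a1); splits => //; first by move=> ->; splits.
move=> b1; rewrite (negbTE b1).
have -> : (na h 24 (2 * t) < height)%N by lia.
have -> : (na h 24 (2 * t + 1) < height)%N by lia.
by splits => //; [move=> ->|move=> /negbTE ->]; splits.
Qed.

(** [pl] lists the events extracted so far, in order of extraction. *)
Definition leaves_ok h (pl : seq nat) : Prop :=
  forall j, (j < N)%N -> na h TR (N + j) = if j \in pl then N else j.
Definition nodes_ok h : Prop :=
  forall i, (0 < i < N)%N -> node_ok N (ra h KEY) (na h TR) i.

Definition build_time : nat := (1 + (N * (1 + 2) + 2) + (N * (3 + steps (play N[vt]%prog) + 2) + 2))%N.

Lemma run_build_tree h : na h vc 0%N = N ->
  run build_tree h build_time (fun g => [/\ half_ok g, leaves_ok g [::] & nodes_ok g]).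
Proof.
move=> hc; rewrite /build_time -addnA.
apply: (wp_seq (p := CN HF (NK 1) (NK 0)) (Q1 := fun g => g = setN h HF 1 0)).
  by rewrite /=; splits => //; lia.
move=> g -> _.
apply: (call_seq (Q1 := fun g => leaves_ok g [::])).
  apply: (run_for (I := fun k g => forall j, (j < k)%N -> na g TR (N + j) = j)).
  - exact: height0.
  - by [].
  - by move=> {}g ag; rewrite /= height0 (proj1 ag).
  - by [].
  - move=> k g1 hk IH ek ag1; apply: wp_run; rewrite /= height0 (proj1 ag1) //= hc ek.
    have -> : (N + k < height)%N by lia.
    splits => // j; rewrite ltnS leq_eqVlt => /orP[/eqP->|jk]; first by rewrite eqxx.
    by rewrite eqn_add2l (ltn_eqF jk) IH.
  - by move=> g1 I1 _ _ j hj; rewrite I1.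
move=> g1 lv1 ag1.
have hc1 : na g1 vc 0%N = N by rewrite (proj1 ag1).
apply: (run_weaken (T := ((N - 1) * (3 + steps (play N[vt]%prog) + 2) + 2)%N)
  (Q := fun g => [/\ half_ok g, leaves_ok g [::] & nodes_ok g])) => //; last first.
  by rewrite leq_add2r leq_mul2r leq_subr orbT.
apply: (run_for (I := fun k g => [/\ leaves_ok g [::], na g HF 1%N = 0%N,
    (forall j, (2 * (N - k) <= j < 2 * N)%N -> na g HF j = j./2) &
    (forall i, (N - k <= i < N)%N -> node_ok N (ra g KEY) (na g TR) i)])).
- exact: height0.
- by [].
- by move=> {}g ag; rewrite /= height0 (proj1 ag) // hc1.
- split=> //=; first by rewrite (proj1 ag1).
  + by move=> j; lia.
  + by move=> i; lia.
- move=> k g2 hk [lv2 h1 h2 n2] ek ag2.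
  have hc2 : na g2 vc 0%N = N by rewrite (proj1 ag2).
  set t := (N - 1 - k)%N.
  apply: (wp_seq (p := (vt <-n N[vc] .-n NK 1 .-n N[vk])%prog)
    (T := (2 + steps (play N[vt]%prog))%N) (Q1 := fun g => g = setN g2 vt 0 t)).
    by rewrite /= height0 hc2 ek; splits.
  move=> {}g -> _.
  apply: (wp_seq (p := CN HF (NK 2 .*n N[vt])%prog N[vt]%prog)
    (T := (1 + steps (play N[vt]%prog))%N) (Q1 := fun g => g = setN (setN g2 vt 0 t) HF (2 * t) t)).
    by rewrite /= height0; splits => //; rewrite /t; lia.
  move=> {}g -> _.
  apply: (wp_seq (p := CN HF (NK 2 .*n N[vt] .+n NK 1)%prog N[vt]%prog)
    (Q1 := fun g => g = setN (setN (setN g2 vt 0 t) HF (2 * t) t) HF (2 * t + 1) t)).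
    by rewrite /= height0; splits => //; rewrite /t; lia.
  move=> {}g -> _; set g3 := setN _ _ (2 * t + 1) _.
  have tN : (t < N)%N by rewrite /t; lia.
  apply: run_weaken (@run_play g3 t _ _ tN) _ _ => // {}g -> _.
  split.
  + move=> j hj; rewrite /= ifN ?lv2 //; apply/eqP; lia.
  + rewrite /= h1; case: eqP => [|_]; first by rewrite /t; lia.
    by case: eqP => //; rewrite /t; lia.
  + move=> j hj /=; case: eqP => [->|e1]; first by lia.
    case: eqP => [->|e2]; first by lia.
    by rewrite h2 //; move: e1 e2 hj; rewrite /t; lia.
  + move=> i hi; rewrite /node_ok /=.
    have -> : (2 * i == t)%N = false by apply/eqP; rewrite /t in hi *; lia.
    have -> : (2 * i + 1 == t)%N = false by apply/eqP; rewrite /t in hi *; lia.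
    case: eqP => [->//|it]; apply: n2; rewrite /t in it; lia.
- move=> g2 [lv2 h1 h2 n2] _ _; split=> //.
    move=> j /andP[j0 jN]; have [->|j1] := eqVneq j 1%N; first by rewrite h1.
    by apply: h2; lia.
  by move=> i hi; apply: n2; lia.
Qed.

Definition climb_step : nat := (steps (play N[vt]%prog)).+2.
Definition climb_time : nat := ((trunc_log 2 N).+1 * climb_step).+1.

(** The number of nodes on the path from [t] to the root, that is, of iterations left in a climb. *)
Definition levels (t : nat) : nat := if t == 0%N then 0%N else (trunc_log 2 t).+1.

Lemma levels_half t : (0 < t)%N -> levels t = (levels t./2).+1.
Proof.
rewrite /levels; case: t => [//|[//|t]] _; rewrite trunc_log2S //.
Qed.

(** Invariant: every inner node except the current one is correct. Playing the current node can only
    spoil its father, which becomes the current node. *)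
Lemma run_climb h t : na h vc 0%N = N -> half_ok h -> na h vt 0%N = t -> (t < N)%N ->
  (forall i, (0 < i < N)%N -> i != t -> node_ok N (ra h KEY) (na h TR) i) ->
  run (CWhile (BNlt (NK 0) N[vt]%prog) (play N[vt]%prog;; (vt <-n NV HF N[vt])%prog)) h climb_time
   (fun g => nodes_ok g /\ forall j, (j < N)%N -> na g TR (N + j) = na h TR (N + j)).
Proof.
move=> hc hf ht tN nk.
pose I g := [/\ (na g vt 0 < N)%N,
  (forall i, (0 < i < N)%N -> i != na g vt 0%N -> node_ok N (ra g KEY) (na g TR) i) &
  (forall j, (j < N)%N -> na g TR (N + j) = na h TR (N + j))].
apply: run_weaken (run_while (I := I) (cost := fun g => (levels (na g vt 0) * climb_step)%N) _ _ _ _) _ _.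
- by split; rewrite ?ht.
- by move=> g _ _; rewrite /= height0.
- move=> g [gN gk gl] ag t0; rewrite /= in t0.
  exists (steps (play N[vt]%prog) + 1)%N.
  have gc : na g vc 0%N = N by rewrite (proj1 ag).
  apply: (call_seq (run_play gc erefl gN)) => g1 -> ag1.
  have gf : na g HF (na g vt 0%N) = (na g vt 0%N)./2.
    by rewrite [na g HF](proj1 ag) // hf // t0 /=; move: gN; clear; lia.
  apply: wp_run; rewrite /= gf height0.
  move: (na g vt 0%N) gN gk t0 gf {ag1} => t' gN gk t0 gf.
  split=> //; first by move: gN; lia.
  split; last by rewrite (@levels_half t') // mulSn /climb_step /=; lia.
  split; rewrite /= ?eqxx /=.
  + by move: gN; lia.
  + move=> i hi it; rewrite /node_ok /=.
    have -> : (2 * i == t')%N = false by apply/eqP; move: it; lia.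
    have -> : (2 * i + 1 == t')%N = false by apply/eqP; move: it; lia.
    by case: eqP => [->//|/eqP ni]; exact: gk.
  + by move=> j hj; rewrite /= ifN ?gl //; apply/eqP; move: gN; lia.
- move=> g [gN gk gl] ag; rewrite /= -leqNgt leqn0 => /eqP t0.
  apply: (conj _ gl : (fun g => nodes_ok g /\ forall j, (j < N)%N -> na g TR (N + j) = na h TR (N + j)) g).
  by move=> i hi; apply: gk => //; rewrite t0; lia.
- rewrite ht /climb_time ltnS leq_mul2r; apply/orP; right.
  rewrite /levels; case: eqP => // _; rewrite ltnS; apply: leq_trunc_log; exact: ltnW.
- by move=> g [] .
Qed.

Definition sorted_at h k : R * (nat * nat) := (ra h SKEY k, (na h SI k, na h SE k)).

Definition popped h g (pl : seq nat) : Prop :=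
  [/\ uniq pl, {in pl, forall p, (p < N)%N},
      forall j, (j < size pl)%N -> sorted_at g j = event_at h (nth 0%N pl j),
      forall p q, p \in pl -> (q < N)%N -> q \notin pl -> ra h KEY p <= ra h KEY q &
      forall j1 j2, (j1 <= j2 < size pl)%N -> ra g SKEY j1 <= ra g SKEY j2].

Definition pop_time : nat := (6 + climb_time)%N.

Lemma run_pop h g pl : na g vc 0%N = N -> half_ok g -> leaves_ok g pl -> nodes_ok g ->
  na g vk 0%N = size pl -> (size pl < N)%N -> popped h g pl ->
  ra g KEY = ra h KEY -> na g OI = na h OI -> na g OE = na h OE ->
  run pop g pop_time (fun g' =>
    exists pl', [/\ size pl' = (size pl).+1, popped h g' pl', leaves_ok g' pl' & nodes_ok g']).
Proof.
move=> gc hf lv nd gk kN [upl ltpl evpl minpl srt] eK eI eE.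
have N0 : (0 < N)%N by lia.
have [u uN eu] := root_leaf nd N0.
have upick : u \notin pl.
  apply/negP => ul; have TN : na g TR 1%N = N by rewrite eu lv // ul.
  (* Fewer than [N] events have been extracted, so some leaf still holds its own number, and a root
     holding [N] would not beat it. *)
  have [q [qN qpl]] : exists q, (q < N)%N /\ q \notin pl.
    apply/not_existsP => H; suff : (N <= size pl)%N by lia.
    rewrite -[N in (N <= _)%N](size_iota 0); apply: uniq_leq_size (iota_uniq _ _) _.
    move=> q; rewrite mem_iota add0n => /= qN; apply/negP => /negP nq; exact: (H q (conj qN nq)).
  have := root_beats nd (j := (N + q)%N) ltac:(lia).
  by rewrite lv // (negbTE qpl) TN /beats ltnn leqNgt qN.
have T1 : na g TR 1%N = u by rewrite eu lv // (negbTE upick).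
have umin q : (q < N)%N -> q \notin pl -> ra h KEY u <= ra h KEY q.
  move=> qN qpl; have := root_beats nd (j := (N + q)%N) ltac:(lia).
  by rewrite lv // (negbTE qpl) T1 /beats leqNgt qN /= uN /= eK.
rewrite /pop_time.
have -> : (6 + climb_time = 1 + (1 + (1 + (1 + (1 + (1 + climb_time))))))%N by [].
apply: (wp_seq (p := (vu <-n NV TR (NK 1))%prog) (Q1 := fun x => x = setN g vu 0 u)).
  by rewrite /= height0 T1; splits => //; lia.
move=> _ -> _; set g1 := setN g vu 0 u.
apply: (wp_seq (p := (CR SKEY N[vk] (RV KEY N[vu]))%prog)
  (Q1 := fun x => x = setR g1 SKEY (size pl) (ra g KEY u))).
  by rewrite /= height0 gk; splits => //; lia.
move=> _ -> _; set g2 := setR g1 _ _ _.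
apply: (wp_seq (p := (CN SI N[vk] (NV OI N[vu]))%prog)
  (Q1 := fun x => x = setN g2 SI (size pl) (na g OI u))).
  by rewrite /= height0 gk; splits => //; lia.
move=> _ -> _; set g3 := setN g2 _ _ _.
apply: (wp_seq (p := (CN SE N[vk] (NV OE N[vu]))%prog)
  (Q1 := fun x => x = setN g3 SE (size pl) (na g OE u))).
  by rewrite /= height0 gk; splits => //; lia.
move=> _ -> _; set g4 := setN g3 _ _ _.
apply: (wp_seq (p := (CN TR (N[vc] .+n N[vu]) N[vc])%prog)
  (Q1 := fun x => x = setN g4 TR (N + u) N)).
  by rewrite /= height0 gc; splits => //; lia.
move=> _ -> _; set g5 := setN g4 _ _ _.
have hfu : na g HF (N + u)%N = (N + u)./2 by rewrite hf //; lia.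
apply: (wp_seq (p := (vt <-n NV HF (N[vc] .+n N[vu]))%prog)
  (Q1 := fun x => x = setN g5 vt 0 (N + u)./2)).
  by rewrite /= height0 gc hfu; splits => //; lia.
move=> _ -> _; set g6 := setN g5 _ _ _.
apply: run_weaken (run_climb (h := g6) _ _ erefl _ _) _ _.
- by rewrite /= gc.
- by move=> j hj; rewrite /= hf.
- by move: uN; rewrite /=; clear; lia.
- move=> i hi; rewrite /node_ok /= => it.
  have -> : (2 * i == N + u)%N = false by apply/eqP; move: it; lia.
  have -> : (2 * i + 1 == N + u)%N = false by apply/eqP; move: it; lia.
  have -> : (i == N + u)%N = false by apply/eqP; move: it hi; lia.
  exact: nd.
- by [].
move=> g' [nd' lv'] ag; exists (rcons pl u).
have sE : na g' SI = na g6 SI /\ na g' SE = na g6 SE by rewrite !(proj1 ag).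
have kE : ra g' SKEY = ra g6 SKEY by rewrite (proj2 ag).
have at_lt j : (j < size pl)%N -> sorted_at g' j = sorted_at g j.
  by move=> hj; rewrite /sorted_at (proj1 sE) (proj2 sE) kE /= (ltn_eqF hj).
have at_eq : sorted_at g' (size pl) = event_at h u.
  by rewrite /sorted_at (proj1 sE) (proj2 sE) kE /= eqxx /event_at -eK -eI -eE.
split; rewrite ?size_rcons //; last first.
  move=> j hj; rewrite lv' //= eqn_add2l mem_rcons inE lv //.
  by case: eqP.
split.
- by rewrite rcons_uniq upick.
- by move=> p; rewrite mem_rcons inE => /orP[/eqP->//|/ltpl].
- move=> j; rewrite size_rcons ltnS leq_eqVlt nth_rcons => /orP[/eqP->|hj].
    by rewrite ltnn eqxx.
  by rewrite hj at_lt // evpl.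
- move=> p q; rewrite !mem_rcons !inE negb_or => /orP[/eqP->|pp] qN /andP[_ qpl].
    exact: umin.
  exact: minpl.
- move=> j1 j2; rewrite size_rcons ltnS => /andP[j12]; rewrite leq_eqVlt => /orP[/eqP e2|lt2].
    have k2 : ra g' SKEY j2 = ra h KEY u by rewrite e2; exact: (congr1 fst at_eq).
    move: j12; rewrite leq_eqVlt => /orP[/eqP->//|lt1].
    have lt1' : (j1 < size pl)%N by rewrite -e2.
    have k1 : ra g' SKEY j1 = ra h KEY (nth 0%N pl j1).
      by have := congr1 fst (at_lt _ lt1'); rewrite evpl.
    by rewrite k1 k2; apply: minpl => //; exact: mem_nth.
  have lt1 : (j1 < size pl)%N by lia.
  have -> : ra g' SKEY j1 = ra g SKEY j1 := congr1 fst (at_lt _ lt1).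
  have -> : ra g' SKEY j2 = ra g SKEY j2 := congr1 fst (at_lt _ lt2).
  by apply: srt; rewrite j12.
Qed.

Definition sort_time : nat := (build_time + (N * (pop_time + 2) + 2))%N.

Lemma run_sort_events h : na h vc 0%N = N ->
  run sort_events h sort_time (fun g =>
    perm_eq [seq sorted_at g k | k <- iota 0 N] (event_list h) /\
    forall j1 j2, (j1 <= j2 < N)%N -> ra g SKEY j1 <= ra g SKEY j2).
Proof.
move=> hc; apply: (call_seq (run_build_tree hc)) => g1 [hf lv nd] ag1.
have gc : na g1 vc 0%N = N by rewrite (proj1 ag1).
apply: (run_for (I := fun k g => exists pl, [/\ size pl = k, popped h g pl, leaves_ok g pl & nodes_ok g])).
- exact: height0.
- by [].
- by move=> g ag; rewrite /= height0 (proj1 ag).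
- exists [::]; split=> //; split=> //= j1 j2; by rewrite ltn0 andbF.
- move=> k g2 kN [pl [spl pop_ok lv2 nd2]] ek ag2.
  apply: run_weaken (run_pop (h := h) (pl := pl) _ _ lv2 nd2 _ _ pop_ok _ _ _) _ _.
  + by rewrite (proj1 ag2).
  + by move=> j hj; rewrite (proj1 ag2) // hf.
  + by rewrite ek.
  + by rewrite spl.
  + by rewrite (proj2 ag2) // (proj2 ag1).
  + by rewrite (proj1 ag2) // (proj1 ag1).
  + by rewrite (proj1 ag2) // (proj1 ag1).
  + by [].
  + move=> g3 [pl' [s3 p3 lv3 nd3]] _; exists pl'; split=> //; by rewrite s3 spl.
- move=> g2 [pl [spl [upl ltpl evpl _ srt]] _ _] _ _; split; last first.
    by move=> j1 j2; rewrite -spl; exact: srt.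
  have pp : perm_eq pl (iota 0 N).
    apply: uniq_perm => //; first exact: iota_uniq.
    have sub : {subset pl <= iota 0 N} by move=> p /ltpl pN; rewrite mem_iota.
    have [|_ H] := uniq_min_size upl sub; first by rewrite size_iota spl.
    by move=> p; rewrite H.
  have -> : [seq sorted_at g2 k | k <- iota 0 N] = [seq event_at h p | p <- pl].
    apply: (@eq_from_nth _ (0, (0, 0)%N)); rewrite ?size_map ?size_iota ?spl // => j hj.
    rewrite (nth_map 0%N) ?size_iota // nth_iota // add0n evpl ?spl //.
    by rewrite (nth_map 0%N) // spl.
  by rewrite /event_list hc; apply: perm_map.
Qed.

End Sort.

(** * The sweep along a curve *)

Section Counting.
Variables (R : realType) (S P L : seq (R * R)) (height : nat) (a d : R * R).
Local Notation n := (size S).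
Local Notation m := (size P).
Local Notation input := (coordinates (S ++ P ++ L)).
Local Notation run := (run height input).
Local Notation env := (env S P).
Local Notation cur := (cur P).
Local Notation counts_ok := (counts_ok S P).
Local Notation table_ok := (table_ok P).
Implicit Types (h g : memory R) (c : curve R).
Hypothesis sizes : sizes_ok S P height.
Hypothesis m_gt0 : (0 < m)%N.

Let height0 : (0 < height)%N. Proof. by have [_] := sizes; case: height. Qed.

Let n_height : (n <= height)%N.
Proof. by have [le _] := sizes; apply: leq_trans le; rewrite leq_pmulr. Qed.

Let index_lt i e : (i < n)%N -> (e < m)%N -> (atom_index P i e < height)%N.
Proof.
move=> hi he; rewrite /atom_index; have [le _] := sizes; apply: leq_trans le.
by apply: (@leq_trans (i.+1 * m)%N); [rewrite mulSn addnC ltn_add2r|rewrite leq_mul2r hi orbT].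
Qed.

Definition stats_at h c w : Prop :=
  forall i e, (i < n)%N -> (e < m)%N -> cur h i e = stat S P a d c i e w.

Definition clear_counts : cmd := For vi N[vn]%prog (CN SM N[vi]%prog (NK 0);;
    For ve N[vm]%prog (CN CUR (N[vi] .*n N[vm] .+n N[ve])%prog (NK 0))).

Definition clear_time : nat := (n * (1 + (m * (1 + 2) + 2) + 2) + 2)%N.

Lemma run_clear_counts h : env h -> run clear_counts h clear_time (fun g =>
  forall i, (i < n)%N -> na g SM i = 0%N /\ forall e, (e < m)%N -> cur g i e = 0%N).
Proof.
move=> eh; apply: (run_for (I := fun k g => forall i, (i < k)%N ->
    na g SM i = 0%N /\ forall e, (e < m)%N -> cur g i e = 0%N)) => //.
  by move=> g ag; rewrite /= height0; split=> //; exact: (proj1 (agree_env ag isT isT eh)).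
move=> k g kn IH ek ag; have eg := agree_env ag isT isT eh.
have kh : (k < height)%N by exact: leq_trans n_height.
apply: (wp_seq (p := CN SM N[vi]%prog (NK 0)) (Q1 := fun x => x = setN g SM k 0%N)).
  by rewrite /= height0 ek; splits.
move=> _ -> _.
apply: (run_for (I := fun j g => forall i, (i < k.+1)%N ->
    na g SM i = 0%N /\ forall e, (e < m)%N -> (i < k)%N || (e < j)%N -> cur g i e = 0%N)) => //.
- by move=> g' ag'; rewrite /= height0; split=> //; rewrite (proj1 ag') //; exact: (proj2 eg).
- move=> i; rewrite ltnS leq_eqVlt => /orP[/eqP->|ik] /=; first by rewrite eqxx; split=> // e _; rewrite ltnn.
  by have [h1 h2] := IH i ik; rewrite /= (ltn_eqF ik); split=> // e he _; exact: h2.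
- move=> j g1 jm IH1 ej ag1.
  have vi1 : na g1 vi 0%N = k by rewrite (proj1 ag1).
  have vm1 : na g1 vm 0%N = m by rewrite (proj1 ag1) //; exact: (proj2 eg).
  apply: wp_run; rewrite /= height0 vi1 vm1 ej index_lt //; splits => // i ik.
  have [h1 h2] := IH1 i ik; split=> // e he hor; rewrite /cur /=.
  rewrite (atom_index_inj _ _ he jm); case: eqP => [ei|ni] /=; last first.
    apply: h2 => //; apply/orP; left; rewrite ltnS leq_eqVlt in ik.
    by case/orP: ik => // /eqP.
  case: eqP => // ne; apply: h2 => //; move: hor; rewrite (ltnS e) (leq_eqVlt e).
  by case/or3P => [->//|/eqP//|->]; rewrite orbT.
- move=> g1 IH1 _ _ i ik; have [h1 h2] := IH1 i ik; split=> // e he.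
  by apply: h2 => //; rewrite he orbT.
Qed.

Lemma zero_counts h : na h vcnt 0%N = 0%N ->
  (forall i, (i < n)%N -> na h SM i = 0%N /\ forall e, (e < m)%N -> cur h i e = 0%N) ->
  counts_ok h.
Proof.
move=> c0 H; split=> [i e hi he|i hi|].
- by have [_ ->] := H i hi.
- by have [-> h2] := H i hi; rewrite big1 // => e _; exact: h2.
- rewrite c0 big1 // => i _; have [-> _] := H i (ltn_ord i).
  by rewrite /score_in.
Qed.

Definition update_all : cmd := For vi N[vn]%prog (For ve N[vm]%prog update_atom).
Definition update_all_time : nat := (n * (m * (steps update_atom + 2) + 2 + 2) + 2)%N.

Lemma run_update_all h c w : env h -> table_ok h -> counts_ok h -> load_ok h c a d ->
  ra h rw 0%N = w ->
  run update_all h update_all_time (fun g => counts_ok g /\ stats_at g c w).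
Proof.
move=> eh tb co lo ew.
apply: (run_for (I := fun k g => counts_ok g /\ forall i e, (i < n)%N -> (e < m)%N ->
  (i < k)%N -> cur g i e = stat S P a d c i e w)) => //.
- by move=> g ag; rewrite /= height0; split=> //; exact: (proj1 (agree_env ag isT isT eh)).
- move=> k g kn [cg IH] ek ag; have eg := agree_env ag isT isT eh.
  apply: (run_for (I := fun j g => counts_ok g /\ forall i e, (i < n)%N -> (e < m)%N ->
    (i < k)%N || ((i == k) && (e < j)%N) -> cur g i e = stat S P a d c i e w)) => //.
  + by move=> g' ag'; rewrite /= height0; split=> //; rewrite (proj1 ag') //; exact: (proj2 eg).
  + by split=> // i e hi he; rewrite andbF orbF => ik; exact: IH.
  + move=> j g1 jm [c1 IH1] ej ag1.
    have ag2 := agree_trans ag (agree_sub (c' := update_all) _ _ ag1).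
    have agA : agree update_all h g1.
      by apply: ag2 => x /=; do ?[move=> ->; rewrite ?orbT|].
    have e1 := agree_env agA isT isT eh.
    apply: run_weaken (run_update_atom L height0 sizes e1 _ c1 _ _ _ ej kn jm) _ _.
    * exact: agree_table agA isT tb.
    * by apply: agree_load agA _ lo; do 9?case=> //.
    * by rewrite (proj2 agA) // ew.
    * by rewrite (proj1 ag1).
    * by [].
    * move=> g2 [c2 E2] _; split; first exact: c2.
      move=> i e hi he; rewrite [cur _ i e](E2 i e hi he); case: ifP => [/andP[/eqP-> /eqP->]|ne] hor; first by rewrite ew.
      apply: IH1 => //; case/orP: hor => [->//|/andP[ik ej']]; rewrite ik.
      rewrite (ltnS e) leq_eqVlt in ej'; case/orP: ej' => [ee|lt]; last by rewrite lt orbT.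
      by rewrite ik ee in ne.
  + by move=> g1 [c1 IH1] _ _; split=> // i e hi he ik; apply: IH1 => //; rewrite he andbT; move: ik; rewrite (ltnS i) (leq_eqVlt i) orbC.
- by move=> g [cg IH] _ _; split=> // i e hi he; exact: IH.
Qed.

Definition init_time : nat := (clear_time + (2 + update_all_time))%N.

Lemma run_init_sweep h c : env h -> table_ok h -> load_ok h c a d ->
  run init_sweep h init_time (fun g => counts_ok g /\ stats_at g c (ra h SKEY 0%N - 1)).
Proof.
move=> eh tb lo; apply: (call_seq (run_clear_counts eh)) => g1 z1 ag1.
have -> : (2 + update_all_time = 1 + (1 + update_all_time))%N by [].
apply: (wp_seq (p := (vcnt <-n NK 0)%prog) (Q1 := fun g => g = setN g1 vcnt 0 0)).
  by rewrite /= height0.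
move=> _ -> _.
apply: (wp_seq (p := (rw <-r RV SKEY (NK 0) .-r rk 1)%prog)
  (Q1 := fun g => g = setR (setN g1 vcnt 0 0) rw 0 (ra h SKEY 0%N - 1))).
  by rewrite /= height0 (proj2 ag1).
move=> _ -> _; apply: run_update_all => //.
- exact: agree_env ag1 isT isT eh.
- exact: agree_table ag1 isT tb.
- exact: zero_counts.
- by apply: agree_load ag1 _ lo; do 9?case=> //.
Qed.

End Counting.

(** * Passing the events of one critical value *)

Section Pass.
Variables (R : realType) (S P L : seq (R * R)) (height : nat) (a d : R * R) (N : nat) (c : curve R).
Local Notation n := (size S).
Local Notation m := (size P).
Local Notation input := (coordinates (S ++ P ++ L)).
Local Notation run := (run height input).
Local Notation env := (env S P).
Local Notation cur := (cur P).
Local Notation counts_ok := (counts_ok S P).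
Local Notation table_ok := (table_ok P).
Local Notation stats_at := (stats_at S P a d).
Local Notation stat := (stat S P a d c).
Implicit Types (h g : memory R) (w y : R).
Hypothesis sizes : sizes_ok S P height.
Hypothesis N_height : (N < height)%N.
Hypotheses (n_gt0 : (0 < n)%N) (m_gt0 : (0 < m)%N).

Let height0 : (0 < height)%N. Proof. by apply: leq_ltn_trans N_height. Qed.

Definition owner h j : nat * nat := (na h SI j, na h SE j).

Definition keys_ok h : Prop :=
  perm_eq [seq sorted_at h k | k <- iota 0 N] (events S P a d c) /\
  forall j1 j2, (j1 <= j2 < N)%N -> ra h SKEY j1 <= ra h SKEY j2.

Definition ready h : Prop :=
  [/\ env h, table_ok h, load_ok h c a d, na h vc 0%N = N & keys_ok h].

Definition preserves cm : bool :=
  all (fun v => ~~ writes_n cm v) [:: vn; vm; vc; SI; SE; TB] &&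
  all (fun v => ~~ writes_r cm v) (SKEY :: iota 0 9).

Lemma agree_owner cm h g : agree cm h g -> preserves cm -> owner g =1 owner h.
Proof.
move=> ag /andP[/and5P[_ _ _ wI /andP[wE _]] _] j.
by rewrite /owner !(proj1 ag).
Qed.

Lemma agree_keys cm h g : agree cm h g -> preserves cm -> ra g SKEY = ra h SKEY.
Proof. by move=> ag /andP[_ /andP[wK _]]; rewrite (proj2 ag). Qed.

Lemma agree_ready cm h g : agree cm h g -> preserves cm -> ready h -> ready g.
Proof.
move=> ag pr [eh tb lo hc [pe mo]]; have eo := agree_owner ag pr; have eK := agree_keys ag pr.
case/andP: pr => /and5P[w0 w1 w8 wI /and3P[wE wT _]] /andP[wK wr]; split.
- exact: agree_env ag w0 w1 eh.
- exact: agree_table ag wT tb.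
- apply: agree_load ag _ lo => k hk.
  by apply: (allP (wr : all (fun v => ~~ writes_r cm v) (iota 0 9))); rewrite mem_iota.
- by rewrite (proj1 ag).
- split; last by move=> j1 j2; rewrite eK; exact: mo.
  rewrite (_ : [seq sorted_at g k | k <- iota 0 N] = [seq sorted_at h k | k <- iota 0 N]) //.
  by apply: eq_map => k; have := eo k; rewrite /owner /sorted_at eK => ->.
Qed.

Lemma keys_event h w i e : keys_ok h -> (w, (i, e)) \in events S P a d c ->
  exists j, [/\ (j < N)%N, ra h SKEY j = w & owner h j = (i, e)].
Proof.
move=> [pe _]; rewrite -(perm_mem pe) => /mapP[j]; rewrite mem_iota => /andP[_ hj] [-> -> ->].
by exists j.
Qed.

(** The roots of the curve polynomials carry the atom (0, 0), which exists because there are a point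
    and an edge; its additional updates are harmless. *)
Lemma owner_lt h j : keys_ok h -> (j < N)%N ->
  ((owner h j).1 < n)%N /\ ((owner h j).2 < m)%N.
Proof.
move=> [pe _] hj.
have : sorted_at h j \in events S P a d c by rewrite -(perm_mem pe) map_f // mem_iota.
by rewrite /sorted_at /owner => /eventsP[[[-> ->] _]|[]].
Qed.

Lemma stat_const y w i e : (i < n)%N -> (e < m)%N -> y <= w ->
  (forall w', y <= w' <= w -> (w', (i, e)) \notin events S P a d c) ->
  stat i e y = stat i e w.
Proof.
move=> hi he yw H; apply: (@atom_score_const _ _ _ _ _ _ _ _ `[y, w]).
- move=> Q hQ w'; rewrite in_itv /= => hw'; apply/negP => r.
  by have /negP[] := H w' hw'; apply/eventsP; right; split=> //; exists Q.
- by rewrite in_itv /= lexx yw.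
- by rewrite in_itv /= lexx yw.
Qed.

Definition pass_step : nat := (steps update_atom + 4)%N.

(** Only the owners of events [k] to [l - 1] are evaluated anew; by [skip] the other atoms score at
    [w] what they scored at [y]. The loop stops at [l] because the key there exceeds [w0]. *)
Lemma run_pass h k l w0 w y : ready h -> na h vk 0%N = k -> ra h rwk 0%N = w0 ->
  ra h rw 0%N = w -> (k <= l <= N)%N -> (forall j, (k <= j < l)%N -> ra h SKEY j <= w0) ->
  ((l < N)%N -> w0 < ra h SKEY l) -> counts_ok h -> stats_at h c y ->
  (forall i e, (i < n)%N -> (e < m)%N -> (forall j, (k <= j < l)%N -> owner h j != (i, e)) ->
     stat i e y = stat i e w) ->
  run pass h (2 + (l - k) * pass_step) (fun g =>
    [/\ na g vl 0%N = l, counts_ok g & stats_at g c w]).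
Proof.
move=> rh ek e0 ew /andP[kl lN] group next ch sy skip.
have -> : (2 + (l - k) * pass_step = 1 + ((l - k) * pass_step).+1)%N by lia.
apply: (wp_seq (p := (vl <-n N[vk])%prog) (Q1 := fun g => g = setN h vl 0 k)).
  by rewrite /= height0 ek.
move=> _ -> _; set h1 := setN h vl 0 k.
have rh1 : ready h1 by exact: rh.
pose loop := CWhile (BAnd (BNlt N[vl] N[vc]) (BRle (RV SKEY N[vl]) R[rwk]))%prog
    (vi <-n NV SI N[vl];; ve <-n NV SE N[vl];; update_atom;; vl <-n N[vl] .+n NK 1)%prog.
have pres : preserves loop by [].
(* The atoms that own an event already passed are up to date at [w], the others are still those of
   [y]. *)
pose I g := [/\ (k <= na g vl 0 <= l)%N, counts_ok g &
  forall i e, (i < n)%N -> (e < m)%N ->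
    cur g i e = stat i e (if has (fun j => owner h j == (i, e)) (iota k (na g vl 0 - k)) then w else y)].
apply: run_weaken (run_while (I := I) (cost := fun g => ((l - na g vl 0) * pass_step)%N)
  (Q := fun g => [/\ na g vl 0%N = l, counts_ok g & stats_at g c w]) _ _ _ _) _ _.
- split=> [| //|i e hi he]; first by rewrite /= leqnn.
  by rewrite /= subnn /=; exact: sy.
- move=> g [/andP[kg gl] _ _] ag; have [_ _ _ gc _] := agree_ready ag pres rh1.
  by rewrite /= height0 /=; lia.
- move=> g [/andP[kg gl] cg st] ag; have rg := agree_ready ag pres rh1; have [eg tg lg gc kk] := rg.
  rewrite /= gc (agree_keys ag pres) [ra g _](proj2 ag) // => /andP[gN gle].
  set j := na g vl 0%N in kg gl st gN gle *.
  have jl : (j < l)%N.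
    rewrite ltn_neqAle gl andbT; apply/eqP => jl; rewrite -jl in next.
    by have := next gN; rewrite ltNge -e0 gle.
  have [oi oe] := owner_lt kk gN.
  exists (1 + (1 + (steps update_atom + 1)))%N.
  apply: (wp_seq (p := (vi <-n NV SI N[vl])%prog) (Q1 := fun x => x = setN g vi 0 (na g SI j))).
    by rewrite /= height0 -/j; splits => //; lia.
  move=> _ -> _.
  apply: (wp_seq (p := (ve <-n NV SE N[vl])%prog)
    (Q1 := fun x => x = setN (setN g vi 0 (na g SI j)) ve 0 (na g SE j))).
    by rewrite /= height0 -/j; splits => //; lia.
  move=> _ -> _; set g2 := setN _ ve 0 _.
  have gi : na g2 vi 0%N = (owner g j).1 by [].
  have ge : na g2 ve 0%N = (owner g j).2 by [].
  have gw : ra g2 rw 0%N = w by rewrite /= (proj2 ag).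
  apply: (call_seq (run_update_atom L height0 sizes (eg : env g2) tg cg lg gw gi ge oi oe)).
  move=> g1 [c1 s1] ag1; have vl1 : na g1 vl 0%N = j by rewrite (proj1 ag1).
  have dec : (1 + (1 + (steps update_atom + 1)) + (l - j.+1) * pass_step < (l - j) * pass_step)%N.
    have -> : (l - j = (l - j.+1).+1)%N by move: jl; clear; lia.
    by rewrite mulSn /pass_step; move: (steps update_atom) => s; clear; lia.
  apply: wp_run; rewrite /= height0 vl1 addn1; split=> //; split; last exact: dec.
  split; rewrite /= ?addn1; [by rewrite jl andbT; lia|exact: c1|].
  move=> i e hi he; rewrite [LHS](s1 i e hi he) subSn // -addn1 iotaD has_cat subnKC //=.
  have oj : owner h j = (na g SI j, na g SE j) := esym (agree_owner ag pres j).
  rewrite orbF oj xpair_eqE (eq_sym i) (eq_sym e).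
  case: ifP => /= [/andP[/eqP-> /eqP->]|_]; first by rewrite orbT.
  by rewrite orbF -st.
- move=> g [/andP[kg gl] cg st] ag; have rg := agree_ready ag pres rh1; have [eg tg lg gc kk] := rg.
  rewrite /= gc (agree_keys ag pres) [ra g _](proj2 ag) // => stop.
  have jl : na g vl 0%N = l.
    apply/eqP; rewrite eqn_leq gl leqNgt; apply: contra stop => lt.
    by rewrite (leq_trans lt lN) /= [ra _ _ 0%N]e0 group // kg.
  split=> //.
  move=> i e hi he; rewrite st // jl; case: hasP => // no; apply: skip => // j hj.
  by apply/eqP => oj; apply: no; exists j; rewrite ?oj // mem_iota subnKC.
- by [].
- by [].
Qed.

End Pass.

(** * The sweep over all critical values of a curve *)

Section Sweep.
Variables (R : realType) (S P L : seq (R * R)) (height : nat) (lin : bool).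
Variables (Lambda : set (R * R)) (a d : R * R) (N : nat) (c : curve R).
Local Notation n := (size S).
Local Notation m := (size P).
Local Notation input := (coordinates (S ++ P ++ L)).
Local Notation run := (run height input).
Local Notation cur := (cur P).
Local Notation counts_ok := (counts_ok S P).
Local Notation stats_at := (stats_at S P a d).
Local Notation stat := (stat S P a d c).
Local Notation ready := (ready S P a d N c).
Implicit Types (h g : memory R) (w y : R).
Hypothesis sizes : sizes_ok S P height.
Hypothesis N_height : (N < height)%N.
Hypothesis n_gt0 : (0 < n)%N.
Hypothesis simple : simple_polygon P.
Hypothesis centers : forall t, in_range lin t -> Lambda (center a d t).

Let m_gt0 : (0 < m)%N. Proof. by have [/ltnW/ltnW] := simple. Qed.
Let height0 : (0 < height)%N. Proof. by apply: leq_ltn_trans N_height. Qed.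

Definition out_center h : R * R := (ra h ro1 0%N, ra h ro2 0%N).

Definition best_ok h : Prop :=
  [/\ Lambda (out_center h), 0 <= ra h rth 0%N < 2 * pi &
      captured S P (out_center h) (ra h rth 0%N) = na h vbest 0%N].

Lemma run_record_best h w : load_ok h c a d -> ra h rt 0%N = curve_t c w ->
  ra h rw 0%N = w -> na h vcnt 0%N = depth S P (pos c a d w) ->
  Lambda (center a d (curve_t c w)) -> best_ok h ->
  run record_best h (steps record_best) (fun g =>
    [/\ best_ok g, (na h vbest 0 <= na g vbest 0)%N & (na h vcnt 0 <= na g vbest 0)%N]).
Proof.
move=> [_ ea ed] et ew ec lam bok.
have [cos1 cos2] := andP (cosw_itv w).
pose Q g := [/\ best_ok g, (na h vbest 0 <= na g vbest 0)%N & (na h vcnt 0 <= na g vbest 0)%N].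
apply: (wp_run (Q := Q)); rewrite /= height0 -!expr2 ew sqrD1_neq0 /=.
have N1 : 0 - 1 = -1 :> R by rewrite sub0r.
have N11 : -1 <= 1 :> R by lra.
have cE : (w ^+ 2 - 1) / (1 + w ^+ 2) = cosw w by [].
split=> // [lt|]; last by rewrite -leqNgt => le; split.
have cap g : out_center g = center a d (curve_t c w) -> ra g rth 0%N = angle w ->
    na g vbest 0%N = na h vcnt 0%N -> Q g.
  move=> eo eth eb; split; rewrite ?eb // 1?ltnW //; split; rewrite ?eo ?eth ?eb //.
    exact: angle_itv.
  by rewrite captured_angle // ec.
have oE g : ra g ro1 0%N = ra h 0%N 0%N + ra h rt 0%N * ra h 2%N 0%N ->
   ra g ro2 0%N = ra h 1%N 0%N + ra h rt 0%N * ra h 3%N 0%N ->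
   out_center g = center a d (curve_t c w).
  by rewrite /out_center /center -ea -ed -et => -> ->.
rewrite cE cos1 (ltW cos2); splits => //.
  move=> w0; rewrite N1 lexx N11; splits => //.
  by apply: cap => //; [exact: oE|rewrite /angle w0].
by move=> /negbTE w0; apply: cap => //; [exact: oE|rewrite /angle w0].
Qed.

Definition check_time : nat := (1 + (1 + (steps record_best).+1).+1)%N.

Lemma run_check_best h w : ready h -> counts_ok h -> stats_at h c w ->
  ra h rw 0%N = w -> best_ok h ->
  run (check_best lin) h check_time (fun g =>
    [/\ best_ok g, (na h vbest 0 <= na g vbest 0)%N &
        curve_G c w != 0 -> in_range lin (curve_t c w) ->
        (depth S P (pos c a d w) <= na g vbest 0)%N]).
Proof.
move=> [_ _ lo _ _] [_ c2 c3] st ew bok.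
apply: (wp_seq (p := eval_G) (Q1 := fun g => g = setR h rg 0 (curve_G c w))).
  by rewrite /= height0 /curve_G -ew; have [<- _ _] := lo.
move=> _ -> _; set h1 := setR _ _ _ _.
have zE : evB input h1 G_is_zero = (curve_G c w == 0) by rewrite /= eq_le.
apply: run_if; first by rewrite /= height0.
  rewrite zE => z; apply: run_weaken (wp_run (Q := fun g => g = h1) _) _ _ => //.
  by move=> _ -> _; split=> //; rewrite z.
rewrite zE => G0.
apply: (wp_seq (p := eval_t) (Q1 := fun g => g = setR h1 rt 0 (curve_t c w))).
  rewrite /= height0 G0; split=> //; congr setR.
  by rewrite /curve_t /curve_H -ew sub0r; have [<- _ _] := lo.
move=> _ -> _; set h2 := setR _ _ _ _.
have cnt : na h vcnt 0%N = depth S P (pos c a d w).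
  rewrite depth_stat // c3; apply: eq_bigr => i _; congr (nat_of_bool (score_in _ _)).
  by rewrite c2 //; apply: eq_bigr => e _; exact: st.
have rec : in_range lin (curve_t c w) -> run record_best h2 (steps record_best) (fun g =>
    [/\ best_ok g, (na h vbest 0 <= na g vbest 0)%N &
        curve_G c w != 0 -> in_range lin (curve_t c w) ->
        (depth S P (pos c a d w) <= na g vbest 0)%N]).
  move=> rg; apply: run_weaken (run_record_best (h := h2) (w := w) lo _ ew cnt _ bok) _ _ => //.
    exact: centers.
  by move=> g [b1 b2 b3] _; split=> // _ _; rewrite -cnt.
case: lin rec centers => [rec _|rec _]; first exact: run_weaken (rec isT) (leqnSn _) _.
apply: run_if; first by rewrite /= height0.
  by rewrite /= => rg; exact: rec.
move=> nr; apply: run_weaken (wp_run (Q := fun g => g = h2) _) _ _ => //.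
move=> _ -> _; split=> // _ rg; case/negP: nr; exact: rg.
Qed.


Lemma group_end h k : (k < N)%N -> keys_ok S P a d N c h -> exists l,
  [/\ (k < l <= N)%N, forall j, (k <= j < l)%N -> ra h SKEY j = ra h SKEY k &
      (l < N)%N -> ra h SKEY k < ra h SKEY l].
Proof.
move=> kN [_ mono].
pose p l := (k < l)%N && ((l == N) || (ra h SKEY k < ra h SKEY l)).
have exp : exists l, p l by exists N; rewrite /p kN eqxx.
exists (ex_minn exp); case: ex_minnP => l /andP[kl hl] minl.
have lN : (l <= N)%N by apply: minl; rewrite /p kN eqxx.
split; first by rewrite kl.
  move=> j /andP[kj jl]; apply/eqP; rewrite eq_le [X in _ && X]mono ?kj ?(leq_trans jl) // andbT.
  rewrite leNgt; apply: contraL jl => lt; rewrite -leqNgt; apply: minl; rewrite /p lt orbT andbT.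
  by rewrite ltn_neqAle kj andbT; apply: contraTneq lt => ->; rewrite ltxx.
by move=> lt; move: hl; rewrite (ltn_eqF lt).
Qed.

Definition bounded B w : Prop :=
  curve_G c w != 0 -> in_range lin (curve_t c w) -> (depth S P (pos c a d w) <= B)%N.

Definition between h k y : Prop :=
  (forall j, (j < k)%N -> ra h SKEY j < y) /\
  (forall j, (k <= j < N)%N -> y < ra h SKEY j).

Lemma stat_skip h k l y w i e : keys_ok S P a d N c h -> (i < n)%N -> (e < m)%N -> y <= w ->
  (forall j, (j < k)%N -> ra h SKEY j < y) -> (forall j, (l <= j < N)%N -> w < ra h SKEY j) ->
  (forall j, (k <= j < l)%N -> owner h j != (i, e)) ->
  stat i e y = stat i e w.
Proof.
move=> kk hi he yw lo hi' own; apply: stat_const => // w' /andP[yw' w'w]; apply/negP.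
move=> /(keys_event kk) [j [jN jw oj]]; rewrite -jw in yw' w'w.
have [jk|kj] := ltnP j k; first by move: (lo j jk); rewrite ltNge yw'.
have [jl|lj] := ltnP j l; last by move: (hi' j); rewrite lj jN ltNge w'w => /(_ isT).
by move: (own j); rewrite kj jl oj eqxx => /(_ isT).
Qed.

Definition group_time : nat := (12 + check_time + 2 * pass_step)%N.

(** The cost is proportional to the number of events in the group, so it is charged to the advance
    of [vk]. A group is never empty, which pays for the constant part as well. *)
Lemma run_sweep_group h k y : ready h -> na h vk 0%N = k -> (k < N)%N -> counts_ok h ->
  best_ok h -> between h k y -> stats_at h c y ->
  exists2 T, (0 < T)%N & run (sweep_group lin) h T (fun g =>
    [/\ best_ok g, counts_ok g, (na h vbest 0 <= na g vbest 0)%N &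
     [/\ (T + (N - na g vk 0) * group_time.+1 < (N - k) * group_time.+1)%N,
         (k <= na g vk 0 <= N)%N,
         (forall j, (k <= j < na g vk 0)%N -> bounded (na g vbest 0) (ra h SKEY j)) &
         exists2 y', between h (na g vk 0) y' & stats_at g c y']]).
Proof.
move=> rh ek kN ch bok [ylo yhi] sy; have [eh tb lo hc kk] := rh.
have [l [/andP[kl lN] grp next]] := group_end kN kk; have kl' := ltnW kl.
set w0 := ra h SKEY k in grp next.
have yw0 : y < w0 by apply: yhi; rewrite leqnn.
have after j : (l <= j < N)%N -> w0 < ra h SKEY j.
  move=> /andP[lj jN]; apply: lt_le_trans (next (leq_ltn_trans lj jN)) _.
  by apply: (proj2 kk); rewrite lj.
pose pt := (2 + (l - k) * pass_step)%N.
exists (1 + (1 + (pt + (check_time + (3 + (pt + 1))))))%N => //.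
have kh : (k < height)%N by exact: ltn_trans kN N_height.
apply: (wp_seq (p := (rwk <-r RV SKEY N[vk])%prog) (Q1 := fun x => x = setR h rwk 0 w0)).
  by rewrite /= height0 ek kh.
move=> _ -> _.
apply: (wp_seq (p := (rw <-r R[rwk])%prog) (Q1 := fun x => x = setR (setR h rwk 0 w0) rw 0 w0)).
  by rewrite /= height0.
move=> _ -> _; set h2 := setR _ rw _ _.
apply: (call_seq (run_pass L (h := h2) (k := k) (l := l) (w0 := w0) (w := w0) (y := y)
  sizes N_height n_gt0 m_gt0 rh ek erefl erefl _ _ next ch sy _)).
- by rewrite kl' lN.
- by move=> j hj; rewrite /= grp.
- by move=> i e hi he own; apply: (stat_skip kk hi he (ltW yw0) ylo after own).
move=> g1 [vl1 c1 s1] ag1; have r1 : ready g1 by apply: (agree_ready ag1 isT rh).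
have bok1 : best_ok g1 by move: bok; rewrite /best_ok /out_center !(proj2 ag1) // (proj1 ag1).
have vb1 : na g1 vbest 0%N = na h vbest 0%N by rewrite (proj1 ag1).
have rw1 : ra g1 rw 0%N = w0 by rewrite (proj2 ag1).
apply: (call_seq (run_check_best r1 c1 s1 rw1 bok1)) => g2 [bok2 vb2 bnd2] ag2.
have pc : preserves (check_best lin) by case: (lin).
have r2 : ready g2 by apply: (agree_ready ag2 pc r1).
have wc v : v \notin [:: vbest] -> writes_n (check_best lin) v = false.
  by rewrite inE => /negbTE hv; case: (lin); rewrite /= hv.
have vl2 : na g2 vl 0%N = l by rewrite (proj1 ag2) ?wc.
have vk2 : na g2 vk 0%N = k by rewrite (proj1 ag2) ?wc // (proj1 ag1).
have wcr v : v \notin [:: rg; rt; ro1; ro2; rc; rth; rr1] -> writes_r (check_best lin) v = false.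
  rewrite !inE !negb_or => /and5P[/negbTE h1 /negbTE h2' /negbTE h3 /negbTE h4].
  move=> /and3P[/negbTE h5 /negbTE h6 /negbTE h7].
  by case: (lin); rewrite /= h1 h2' h3 h4 h5 h6 h7.
have wk2 : ra g2 rwk 0%N = w0 by rewrite (proj2 ag2) ?wcr // (proj2 ag1).
have sk2 : ra g2 SKEY = ra h SKEY by rewrite (agree_keys ag2 pc) (agree_keys ag1 isT).
have [_ _ _ hc2 _] := r2.
(* A sample of the next gap: the midpoint between two successive values, or a point beyond the last
   one. *)
pose w1 := if (l < N)%N then (w0 + ra h SKEY l) / 2 else w0 + 1.
have lt01 : w0 < w1.
  by rewrite /w1; case: ifP => [/next|_]; [rewrite -/w0 => lt; lra|rewrite ltrDl].
have after1 j : (l <= j < N)%N -> w1 < ra h SKEY j.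
  move=> /andP[lj jN]; have lN' := leq_ltn_trans lj jN; rewrite /w1 lN'.
  have h1 := next lN'; have h2' : ra h SKEY l <= ra h SKEY j by apply: (proj2 kk); rewrite lj.
  by rewrite -/w0 in h1 *; lra.
have lh : (l < height)%N by exact: leq_ltn_trans lN N_height.
apply: (wp_seq (p := CIf (BNlt N[vl] N[vc])%prog _ _) (Q1 := fun x => x = setR g2 rw 0 w1)).
  rewrite /= height0 vl2 hc2 wk2 sk2 lh pnatr_eq0 /w1.
  by split=> // [->|/negbTE ->].
move=> _ -> _; set g3 := setR _ _ _ _.
have c2 : counts_ok g3.
  by apply: (agree_counts ag2 _ _ _ c1); rewrite wc.
have s2 : stats_at g3 c w0.
  by move=> i e hi he; rewrite -(s1 i e hi he) [LHS](agree_cur P i e ag2) ?wc.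
have kk2 : keys_ok S P a d N c g3 by have [_ _ _ _] := r2.
apply: (call_seq (run_pass L (h := g3) (k := k) (l := l) (w0 := w0) (w := w1) (y := w0)
  sizes N_height n_gt0 m_gt0 r2 vk2 wk2 erefl _ _ _ c2 s2 _)).
- by rewrite kl' lN.
- by move=> j hj; rewrite /= sk2 grp.
- by rewrite /= sk2.
- move=> i e hi he own; apply: (@stat_skip g3 k l) => //; rewrite /= ?sk2 //; first exact: ltW.
  by move=> j /ylo /lt_trans; apply.
move=> g4 [vl4 c4 s4] ag4; apply: wp_run; rewrite /= height0 vl4; splits => //.
- by move: bok2; rewrite /best_ok /out_center /= !(proj2 ag4) // (proj1 ag4).
- by rewrite (proj1 ag4) //= -vb1.
- rewrite ?eqxx /pt /group_time.
  have -> : (N - k = (l - k) + (N - l))%N by move: kl lN; clear; lia.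
  rewrite mulnDl ltn_add2r; have -> : (l - k = (l - k).-1.+1)%N by move: kl; clear; lia.
  move: ((l - k).-1) check_time pass_step => u v w; rewrite !mulSn; clear; nia.
- by rewrite ?eqxx kl'.
- move=> j; rewrite ?eqxx /= => hj; rewrite (grp j hj) -/w0 (proj1 ag4) //=; exact: bnd2.
- rewrite ?eqxx /=; exists w1 => //; split=> [j jl|j]; last exact: after1.
  have [jk|kj] := ltnP j k; first by apply: lt_trans (ylo j jk) (lt_trans yw0 lt01).
  by rewrite grp ?kj.
Qed.

Definition sweep_time : nat := (1 + (N * group_time.+1).+1)%N.

Lemma run_sweep h y : ready h -> counts_ok h -> best_ok h ->
  (forall j, (j < N)%N -> y < ra h SKEY j) -> stats_at h c y ->
  run (sweep lin) h sweep_time (fun g =>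
    [/\ best_ok g, (na h vbest 0 <= na g vbest 0)%N &
        forall w, critical S P a d c w -> bounded (na g vbest 0) w]).
Proof.
move=> rh ch bok ylo sy.
apply: (wp_seq (p := (vk <-n NK 0)%prog) (Q1 := fun x => x = setN h vk 0 0)).
  by rewrite /= height0.
move=> _ -> _; set h1 := setN _ _ _ _.
have pres : preserves (CWhile (BNlt N[vk] N[vc])%prog (sweep_group lin)) by case: (lin).
pose I g := [/\ best_ok g, counts_ok g, (na h vbest 0 <= na g vbest 0)%N &
  [/\ (na g vk 0 <= N)%N, forall j, (j < na g vk 0)%N -> bounded (na g vbest 0) (ra h SKEY j) &
      exists2 y', between h (na g vk 0) y' & stats_at g c y']].
apply: run_weaken (run_while (I := I) (cost := fun g => ((N - na g vk 0) * group_time.+1)%N)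
  (Q := fun g => [/\ best_ok g, (na h vbest 0 <= na g vbest 0)%N &
        forall w, critical S P a d c w -> bounded (na g vbest 0) w]) _ _ _ _) _ _.
- split=> //; split=> //; exists y => //; split=> // j; by move=> /andP[_]; exact: ylo.
- move=> g [_ _ _ _] ag; by rewrite /= height0.
- move=> g [bg cg vg [kN bnd [y' bt st]]] ag.
  have rg : ready g by apply: (agree_ready ag pres rh).
  have [_ _ _ gc _] := rg; rewrite /= gc => lt.
  have sk : ra g SKEY = ra h SKEY by rewrite (agree_keys ag pres).
  have bt' : between g (na g vk 0%N) y' by rewrite /between sk.
  have [T T0 rT] := run_sweep_group rg erefl lt cg bg bt' st.
  exists T; apply: run_weaken rT _ _ => // g' [b1 b2 b3 [b4 /andP[b5 b6] b7 [y1 b8 b9]]] _.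
  split; last exact: b4.
  split=> //; first exact: leq_trans vg b3.
  split=> //; last by exists y1 => //; move: b8; rewrite /between sk.
  move=> j hj; have [jk|kj] := ltnP j (na g vk 0%N); last by rewrite -sk; apply: b7; rewrite kj.
  by move=> G0 r0; apply: leq_trans (bnd j jk G0 r0) b3.
- move=> g [bg cg vg [kN bnd _]] ag; have rg : ready g by apply: (agree_ready ag pres rh).
  have [_ _ _ gc kk] := rg; rewrite /= gc -leqNgt => Nk.
  have eN : na g vk 0%N = N by apply/eqP; rewrite eqn_leq kN.
  split=> // w /mapP[[w' [i e]] /(keys_event kk)[j [jN <- _]] ->] /=.
  by rewrite (agree_keys ag pres); apply: bnd; rewrite eN.
- by rewrite /= subn0 /sweep_time.
- by [].
Qed.

End Sweep.

(** * All curves and segments *)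

Section Curves.
Variables (R : realType) (S P L : seq (R * R)) (height : nat) (lin : bool).
Variables (Lambda : set (R * R)).
Local Notation n := (size S).
Local Notation m := (size P).
Local Notation input := (coordinates (S ++ P ++ L)).
Local Notation run := (run height input).
Local Notation env := (env S P).
Local Notation table_ok := (table_ok P).
Local Notation best_ok := (best_ok S P Lambda).
Implicit Types (h g : memory R) (w y : R) (a d : R * R) (c : curve R).

(** At most six roots for each of the four polynomials of the curve and of the five polynomials of
    each atom. *)
Definition max_events : nat := (24 + 30 * (n * m))%N.

Hypothesis sizes : sizes_ok S P height.
Hypothesis events_height : (2 * max_events + 2 < height)%N.
Hypothesis n_gt0 : (0 < n)%N.
Hypothesis simple : simple_polygon P.

Let m_gt0 : (0 < m)%N. Proof. by have [/ltnW/ltnW] := simple. Qed.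
Let height7 : (7 <= height)%N. Proof. by move: events_height; rewrite /max_events; lia. Qed.
Let height0 : (0 < height)%N. Proof. exact: leq_trans height7. Qed.

Definition keeps_best cm : bool :=
  ~~ writes_n cm vbest && all (fun v => ~~ writes_r cm v) [:: ro1; ro2; rth].

Lemma agree_best cm h g : agree cm h g -> keeps_best cm -> best_ok h -> best_ok g.
Proof.
move=> ag /andP[wb /and4P[w1 w2 w3 _]] [b1 b2 b3].
have eo : out_center g = out_center h by rewrite /out_center !(proj2 ag).
by split; rewrite ?eo ?(proj2 ag) ?(proj1 ag).
Qed.

Lemma sort_time_le N N' : (N <= N')%N -> (sort_time N <= sort_time N')%N.
Proof.
move=> le; rewrite /sort_time /build_time /pop_time /climb_time /climb_step.
have := leq_trunc_log 2 le; move: (trunc_log 2 N) (trunc_log 2 N') => u v uv.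
have h1 : (N * ((6 + (u.+1 * (steps (play N[vt]%prog)).+2).+1) + 2) <= N' * ((6 + (v.+1 * (steps (play N[vt]%prog)).+2).+1) + 2))%N.
  by apply: leq_mul => //; rewrite leq_add2r leq_add2l ltnS leq_mul2r ltnS uv orbT.
apply: leq_add; last by rewrite leq_add2r.
by rewrite !leq_add // leq_mul.
Qed.

Lemma sweep_time_le N N' : (N <= N')%N -> (sweep_time N <= sweep_time N')%N.
Proof. by move=> le; rewrite /sweep_time leq_add2l ltnS leq_mul. Qed.

Definition curve_time : nat :=
  (gen_time S P + (sort_time max_events + (init_time S P + sweep_time max_events)))%N.

Lemma run_process_curve a d c h :
  (forall t, in_range lin t -> Lambda (center a d t)) ->
  env h -> table_ok h -> load_ok h c a d -> best_ok h ->
  run (process_curve lin) h curve_time (fun g =>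
    [/\ best_ok g, (na h vbest 0 <= na g vbest 0)%N &
        forall w, critical S P a d c w -> bounded S P lin a d c (na g vbest 0) w]).
Proof.
move=> centers eh tb lo bok; have ev := events_height.
have gen_h : (24 + 30 * (n * m) < height)%N by move: ev; rewrite /max_events; lia.
apply: (call_seq (run_gen_events L height7 eh lo gen_h)) => g1 [ev1 vc1] ag1.
(* The number [N] of events depends on the curve; the time for [N] is bounded afterwards, by
   monotonicity, by that for [max_events]. *)
have eN := erefl (na g1 vc 0%N); move: {-1}(na g1 vc 0%N) eN vc1 => N eN NM.
have Nh : (2 * N + 2 < height)%N.
  by apply: leq_ltn_trans ev; rewrite leq_add2r leq_mul2l.
have Nh' : (N < height)%N by move: Nh; lia.
apply: (run_weaken (T := (sort_time N + (init_time S P + sweep_time N))%N)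
  (Q := fun g => [/\ best_ok g, (na h vbest 0 <= na g vbest 0)%N &
        forall w, critical S P a d c w -> bounded S P lin a d c (na g vbest 0) w])).
- apply: (call_seq (run_sort_events _ Nh eN)) => g2 [pe mo] ag2.
  have e2 : env g2 by apply: agree_env ag2 isT isT _; exact: agree_env ag1 isT isT eh.
  have t2 : table_ok g2 by apply: agree_table ag2 isT _; exact: agree_table ag1 isT tb.
  have l2 : load_ok g2 c a d.
    by apply: (agree_load ag2); [do 9?case=> //|apply: (agree_load ag1); [do 9?case=> //|]].
  have b2 : best_ok g2 by apply: agree_best ag2 isT _; exact: agree_best ag1 isT bok.
  have vb2 : na g2 vbest 0%N = na h vbest 0%N by rewrite (proj1 ag2) // (proj1 ag1).
  have r2 : ready S P a d N c g2.
    by split=> //; [rewrite (proj1 ag2)|split=> //; rewrite -ev1].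
  apply: (call_seq (run_init_sweep L sizes m_gt0 e2 t2 l2)) => g3 [c3 s3] ag3.
  have r3 : ready S P a d N c g3 by apply: (agree_ready ag3 isT r2).
  have b3 : best_ok g3 by apply: agree_best ag3 isT b2.
  have vb3 : na g3 vbest 0%N = na h vbest 0%N by rewrite (proj1 ag3).
  rewrite -vb3; apply: (run_sweep L sizes Nh' n_gt0 simple centers r3 c3 b3 _ s3).
  move=> j jN; rewrite (proj2 ag3) //; apply: lt_le_trans (mo 0%N j jN).
  by rewrite ltrBlDr ltrDl.
- by apply: leq_add (sort_time_le NM) _; rewrite leq_add2l; exact: sweep_time_le.
- by [].
Qed.

Lemma run_load_curve h i e a d : env h -> na h vI 0%N = i -> na h vE 0%N = e ->
  (i < n)%N -> (e < m)%N -> a_of h = a -> d_of h = d ->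
  run load_curve h (steps load_curve) (fun g => load_ok g (curve_at S P a d i e) a d).
Proof.
move=> eh ei ee hi he ea ed.
have -> : steps load_curve = (1 + (1 + (2 + (steps load_edge + 5))))%N by [].
apply: (wp_seq (p := (vi <-n N[vI])%prog) (Q1 := fun x => x = setN h vi 0 i)).
  by rewrite /= height0 ei.
move=> _ -> _.
apply: (wp_seq (p := (ve <-n N[vE])%prog) (Q1 := fun x => x = setN (setN h vi 0 i) ve 0 e)).
  by rewrite /= height0 ee.
move=> _ -> _; set h2 := setN _ ve _ _.
have e2 : env h2 by exact: eh.
apply: (call_seq (run_load_point L height0 e2 (i := i) erefl hi)) => g1 x1 ag1.
have e1 : env g1 by apply: agree_env ag1 isT isT e2.
apply: (call_seq (run_load_edge L height0 e1 (e := e) _ he)); first by rewrite (proj1 ag1).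
move=> g2 [p2 q2] ag2.
have a2 : a_of g2 = a by rewrite -ea /a_of !(proj2 ag2) // !(proj2 ag1).
have d2 : d_of g2 = d by rewrite -ed /d_of !(proj2 ag2) // !(proj2 ag1).
have x2 : x_of g2 = vtx S i by rewrite -x1 /x_of !(proj2 ag2).
apply: wp_run; rewrite /= height0 pnatr_eq0 /=; splits => //.
by rewrite /curve_at /edge_curve -p2 -q2 -x2 -a2 -d2.
Qed.

Definition segment_time : nat :=
  (6 + ((n * (m * (steps load_curve + curve_time + 2) + 2 + 2) + 2) + (5 + curve_time)))%N.

Lemma run_process_segment h k : 
  let a := vtx L k in let b := vtx L k.+1 in let d := (b.1 - a.1, b.2 - a.2) in
  (forall t, in_range lin t -> Lambda (center a d t)) -> d != (0, 0) ->
  env h -> table_ok h -> best_ok h -> na h vK 0%N = k -> (k.+1 < size L)%N ->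
  run (process_segment lin) h segment_time (fun g =>
    [/\ best_ok g, (na h vbest 0 <= na g vbest 0)%N &
        forall t w, in_range lin t ->
          (depth S P (spin (center a d t) w) <= na g vbest 0)%N]).
Proof.
move=> a b d centers d0 eh tb bok ek kL; have [en em] := eh.
have [i1 i2 i3] := input_L S P (ltnW kL).
have [j1 j2 j3] := input_L S P kL.
have load : wp height input
   (load_center N[vK]%prog ra1 ra2;; load_center (N[vK] .+n NK 1)%prog rd1 rd2;;
    (rd1 <-r R[rd1] .-r R[ra1])%prog;; (rd2 <-r R[rd2] .-r R[ra2])%prog)
   (fun g => a_of g = a /\ d_of g = d) h.
  rewrite /= height0 en em ek (addn1 k) i1 i2 j1 j2 i3 j3 /=.
  rewrite (leq_ltn_trans _ i3) ?leq_addr // (leq_ltn_trans _ j3) ?leq_addr //; splits => //.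
  by rewrite /a_of /= -surjective_pairing.
(* Sequences associate to the right; regrouping makes the four loads one straight-line block for
   [wp]. *)
have assoc p1 p2 p3 p4 q g T Q : run ((p1;; p2;; p3;; p4);; q) g T Q -> run (p1;; p2;; p3;; p4;; q) g T Q.
  move=> [t [g' [x l qq]]]; exists t, g'; split=> //.
  inversion x as [| | | | | |? ? ? ? ? t1 t2 x1 xq| | | ]; subst.
  inversion x1 as [| | | | | |? ? ? ? ? u1 u2 y1 z1| | | ]; subst.
  inversion z1 as [| | | | | |? ? ? ? ? u3 u4 y2 z2| | | ]; subst.
  inversion z2 as [| | | | | |? ? ? ? ? u5 u6 y3 z3| | | ]; subst.
  rewrite -!addnA; apply: hx_seq y1 _; apply: hx_seq y2 _; apply: hx_seq y3 _; exact: hx_seq z3 xq.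
apply: assoc; apply: (wp_seq load) => g1 [a1 d1] ag1.
have e1 : env g1 by apply: agree_env ag1 isT isT eh.
have t1 : table_ok g1 by apply: agree_table ag1 isT tb.
have b1 : best_ok g1 by apply: agree_best ag1 isT bok.
have vb1 : na g1 vbest 0%N = na h vbest 0%N by rewrite (proj1 ag1).
pose loop2 := For vE N[vm]%prog (load_curve;; process_curve lin).
pose loop1 := For vI N[vn]%prog loop2.
pose done i e g := forall w, critical S P a d (curve_at S P a d i e) w ->
  bounded S P lin a d (curve_at S P a d i e) (na g vbest 0%N) w.
have done_le i e g g' : (na g vbest 0 <= na g' vbest 0)%N -> done i e g -> done i e g'.
  by move=> le H w cw G0 r0; exact: leq_trans (H w cw G0 r0) le.
have keep g : agree loop1 g1 g ->
  [/\ env g, table_ok g, a_of g = a & d_of g = d].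
  move=> ag; split.
  - by apply: agree_env ag _ _ e1; rewrite ?/loop1 ?/loop2; case: (lin).
  - by apply: agree_table ag _ t1; rewrite ?/loop1 ?/loop2; case: (lin).
  - by rewrite -a1 /a_of !(proj2 ag) //; rewrite ?/loop1 ?/loop2; case: (lin).
  - by rewrite -d1 /d_of !(proj2 ag) //; rewrite ?/loop1 ?/loop2; case: (lin).
apply: (call_seq (T2 := (5 + curve_time)%N) (p := loop1)
  (Q1 := fun g => [/\ best_ok g, (na h vbest 0 <= na g vbest 0)%N &
     forall i e, (i < n)%N -> (e < m)%N -> done i e g])).
  apply: (run_for (I := fun k g => [/\ best_ok g, (na h vbest 0 <= na g vbest 0)%N &
     forall i e, (i < k)%N -> (e < m)%N -> done i e g])) => //.
  - by rewrite ?/loop1 ?/loop2; case: (lin).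
  - by move=> g /(keep)[[eg _] _ _ _]; rewrite /= height0.
  - by split=> //; rewrite /= vb1.
  - move=> i g hi [bg vg dg] ei ag.
    apply: (run_for (I := fun e0 g => [/\ best_ok g, (na h vbest 0 <= na g vbest 0)%N &
       forall i' e, (i' < i)%N || ((i' == i) && (e < e0)%N) -> (e < m)%N -> done i' e g])) => //.
    + by rewrite ?/loop1 ?/loop2; case: (lin).
    + move=> g' ag'; have [[_ eg] _ _ _] := keep _ ag.
      by rewrite /= height0 (proj1 ag') //; rewrite ?/loop1 ?/loop2; case: (lin).
    + by split=> // i' e; rewrite andbF orbF => hi' he; exact: dg.
    + move=> e g2 he [bg2 vg2 dg2] ee ag2.
      have agA : agree loop1 g1 g2.
        apply: agree_trans ag (agree_sub _ _ ag2) => v /=; last by move=> ->; rewrite ?orbT.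
        by move=> ->; rewrite orbT.
      have [eg tg ag_ dg_] := keep _ agA.
      have vI2 : na g2 vI 0%N = i by rewrite (proj1 ag2) //; rewrite ?/loop1 ?/loop2; case: (lin).
      apply: (call_seq (run_load_curve eg vI2 ee hi he ag_ dg_)) => g3 l3 ag3.
      have e3 : env g3 by apply: agree_env ag3 isT isT eg.
      have t3 : table_ok g3 by apply: agree_table ag3 isT tg.
      have b3 : best_ok g3 by apply: agree_best ag3 isT bg2.
      have vb3 : na g3 vbest 0%N = na g2 vbest 0%N by rewrite (proj1 ag3).
      apply: run_weaken (run_process_curve centers e3 t3 l3 b3) _ _ => //.
      move=> g4 [b4 v4 dn4] _; split; [exact: b4|by rewrite /= (leq_trans vg2) // -vb3|].
      move=> i' e' hor he'.
      have [/andP[/eqP-> /eqP->]|ne] := boolP ((i' == i) && (e' == e)); first exact: dn4.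
      apply: (done_le _ _ g2); first by rewrite -vb3.
      apply: dg2 => //; case/orP: hor => [->//|/andP[ii]]; rewrite ii in ne *.
      by rewrite ltnS leq_eqVlt => /orP[ee'|->]; [rewrite ee' in ne|rewrite orbT].
    + move=> g2 [b2 v2 d2] _ _; split=> // i' e hi' he; apply: d2 => //.
      by rewrite he andbT orbC -leq_eqVlt -ltnS.
move=> g2 [b2 v2 dn2] ag2; have [eg tg ag_ dg_] := keep _ ag2.
apply: (call_seq (wp_run (c := load_end_curve) (Q := fun g => load_ok g (end_curve R) a d) _)).
  rewrite /= height0; splits => //; by rewrite /curve_of.
move=> g3 l3 ag3.
have e3 : env g3 by apply: agree_env ag3 isT isT eg.
have t3 : table_ok g3 by apply: agree_table ag3 isT tg.
have b3 : best_ok g3 by apply: agree_best ag3 isT b2.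
have vb3 : na g3 vbest 0%N = na g2 vbest 0%N by rewrite (proj1 ag3).
apply: run_weaken (run_process_curve centers e3 t3 l3 b3) _ _ => //.
move=> g4 [b4 v4 dn4] _; split; [by []|by rewrite (leq_trans v2) // -vb3|].
apply: depth_le_critical => // c w [[i [e [hi he ->]]]|->] cw G0 r0.
  by apply: leq_trans (dn2 i e hi he w cw G0 r0) _; rewrite -vb3.
exact: dn4.
Qed.

End Curves.

Section Solve.
Variables (R : realType) (S P L : seq (R * R)) (height : nat) (lin : bool).
Variables (Lambda : set (R * R)).
Local Notation n := (size S).
Local Notation m := (size P).
Local Notation input := (coordinates (S ++ P ++ L)).
Local Notation run := (run height input).
Local Notation env := (env S P).
Local Notation table_ok := (table_ok P).
Local Notation best_ok := (best_ok S P Lambda).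
Implicit Types (h g : memory R) (w y : R) (a d : R * R) (c : curve R).

Hypothesis nm_height : (n * m <= height)%N.
Hypothesis table_height : (m.+2 * m.+2 < height)%N.
Hypothesis events_height : (2 * max_events S P + 2 < height)%N.
Hypothesis n_gt0 : (0 < n)%N.
Hypothesis simple : simple_polygon P.

Let m_gt0 : (0 < m)%N. Proof. by have [/ltnW/ltnW] := simple. Qed.
Let height0 : (0 < height)%N. Proof. exact: leq_ltn_trans events_height. Qed.
Let sizes : sizes_ok S P height.
Proof. by split=> //; apply: leq_ltn_trans table_height; rewrite leq_mul2r; apply/orP; right; do 2 apply: ltnW. Qed.

Definition table_time : nat := (1 + (m.+2 * m.+2 * (3 + 2) + 2))%N.

Lemma score_inS k : (k < m)%N -> nat_of_bool (score_in m k.+1) = (1 - score_in m k)%N.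
Proof. by move=> km; rewrite /score_in km (ltnW km) /=; case: odd. Qed.

Lemma run_fill_table h : env h -> run fill_table h table_time table_ok.
Proof.
move=> eh; have [en em] := eh; have th := table_height.
apply: (wp_seq (p := CN TB (NK 0) (NK 0)) (Q1 := fun x => x = setN h TB 0 0)).
  by rewrite /= height0.
move=> _ -> _.
apply: (run_for (I := fun k g => forall j, (j <= k)%N -> na g TB j = score_in m j)) => //.
- move=> g ag; have e1 : na g vm 0%N = m by rewrite (proj1 ag).
  by rewrite /= height0 e1 !addn2.
- by move=> j; rewrite leqn0 => /eqP->.
- move=> k g km IH ek ag; have e1 : na g vm 0%N = m by rewrite (proj1 ag).
  have k1 : (k + 1 < height)%N by rewrite addn1; apply: leq_ltn_trans th.
  have k0 : (k < height)%N by apply: leq_ltn_trans k1; rewrite addn1.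
  apply: wp_run; rewrite /= height0 e1 ek k1 k0 addn1 /=; splits => //.
    move=> lt; split=> // j jk; case: eqP => [->|/eqP ne].
      by rewrite score_inS // IH.
    by apply: IH; rewrite -ltnS ltn_neqAle ne.
  move=> lt; split=> // j jk; case: eqP => [->|/eqP ne].
    by rewrite /score_in (negbTE lt).
  by apply: IH; rewrite -ltnS ltn_neqAle ne.
- move=> g IH _ _ k hk; apply: IH; apply: leq_trans hk _.
  by rewrite leq_mul2r; apply/orP; right; do 2 apply: ltnW.
Qed.

Definition identity_time : nat :=
  (2 + (1 + (1 + (n * (2 + (1 + (1 + (1 + (m * (steps load_edge + (steps edge_test + 1) + 2) + 2 + 1)))) + 2) + 2))))%N.

Lemma run_process_identity h : env h -> table_ok h -> (0 < size L)%N ->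
  Lambda (vtx L 0) ->
  run process_identity h identity_time (fun g =>
    best_ok g /\ na g vbest 0%N = depth S P id).
Proof.
move=> eh tb L0 lam; have [en em] := eh; have [l1 l2 l3] := input_L S P L0.
have l4 : (2 * (n + m + 0) < size input)%N by apply: leq_ltn_trans l3; rewrite leq_addr.
pose ok0 g := out_center g = vtx L 0 /\ ra g rth 0%N = 0.
apply: (wp_seq (p := load_center (NK 0) ro1 ro2) (Q1 := fun g => out_center g = vtx L 0)).
  by rewrite /= height0 en em l1 l2 l3 l4 /out_center /= -surjective_pairing.
move=> g1 o1' ag1.
apply: (wp_seq (p := (rth <-r rk 0)%prog) (Q1 := ok0)); first by rewrite /= height0.
move=> g2 o2' ag2.
apply: (wp_seq (p := (vbest <-n NK 0)%prog) (Q1 := fun g => na g vbest 0%N = 0%N)).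
  by rewrite /= height0.
move=> g3 v3 ag3.
have ok3 : ok0 g3 by move: o2'; rewrite /ok0 /out_center !(proj2 ag3).
have e3 : env g3.
  by apply: agree_env ag3 isT isT _; apply: agree_env ag2 isT isT _; exact: agree_env ag1 isT isT eh.
have t3 : table_ok g3.
  by apply: agree_table ag3 isT _; apply: agree_table ag2 isT _; exact: agree_table ag1 isT tb.
apply: (run_for (I := fun k g => na g vbest 0%N =
   (\sum_(0 <= i < k) score_in m (score P (vtx S i)))%N)) => //.
- by move=> g ag; rewrite /= height0; split=> //; exact: (proj1 (agree_env ag isT isT e3)).
- by rewrite big_nil.
- move=> i g hi IH ei ag; have eg := agree_env ag isT isT e3; have tg := agree_table ag isT t3.
  apply: (call_seq (run_load_point L height0 eg ei hi)) => h1 x1 bg1.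
  apply: (wp_seq (p := (rf1 <-r R[rx1])%prog) (Q1 := fun x => x = setR h1 rf1 0 (vtx S i).1)).
    by rewrite /= height0 -x1.
  move=> _ -> _.
  apply: (wp_seq (p := (rf2 <-r R[rx2])%prog)
    (Q1 := fun x => x = setR (setR h1 rf1 0 (vtx S i).1) rf2 0 (vtx S i).2)).
    by rewrite /= height0 -x1.
  move=> _ -> _.
  apply: (wp_seq (p := (vl <-n NK 0)%prog)
    (Q1 := fun x => x = setN (setR (setR h1 rf1 0 (vtx S i).1) rf2 0 (vtx S i).2) vl 0 0)).
    by rewrite /= height0.
  move=> _ -> _; set h2 := setN _ vl _ _.
  have f2 : f_of h2 = vtx S i by rewrite /f_of /= -surjective_pairing.
  have e2 : env h2 by apply: agree_env bg1 isT isT eg.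
  have t2 : table_ok h2 by apply: agree_table bg1 isT tg.
  pose part j := (\sum_(0 <= e < j) edge_score m (vtx P e) (vtx P (next_idx P e)) (vtx S i))%N.
  have part_le j : (part j <= j * m.+2)%N.
    rewrite /part; elim: j => [|j IHj]; first by rewrite big_nil.
    by rewrite big_nat_recr //= mulSn addnC leq_add // edge_score_le.
  apply: (call_seq (T1 := (m * (steps load_edge + (steps edge_test + 1) + 2) + 2)%N) (T2 := 1)
    (Q1 := fun g => na g vl 0%N = part m)).
    apply: (run_for (I := fun j g => na g vl 0%N = part j)) => //.
    + by move=> g' ag'; rewrite /= height0; split=> //; exact: (proj2 (agree_env ag' isT isT e2)).
    + by rewrite /part big_nil.
    + move=> e g4 he IHe ee ag4; have e4 := agree_env ag4 isT isT e2.
      apply: (call_seq (run_load_edge L height0 e4 ee he)) => g5 [p5 q5] ag5.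
      have e5 := agree_env ag5 isT isT e4.
      apply: (call_seq (run_edge_test L height0 e5)) => g6 v6 ag6.
      have vl6 : na g6 vl 0%N = part e by rewrite (proj1 ag6) // (proj1 ag5).
      have f5 : f_of g5 = vtx S i by rewrite -f2 /f_of !(proj2 ag5) // !(proj2 ag4).
      apply: wp_run; rewrite /= height0 vl6 v6 p5 q5 f5; splits => //.
      by rewrite /part big_nat_recr.
  move=> g4 v4 ag4.
  have vb1 : na h1 vbest 0%N = na g vbest 0%N by rewrite (proj1 bg1).
  have vi4 : na g4 vbest 0%N = na g vbest 0%N by rewrite (proj1 ag4).
  have t4 : table_ok g4 by apply: agree_table ag4 isT t2.
  have pm : (part m <= m * m.+2)%N by exact: part_le.
  apply: wp_run; rewrite /= height0 v4 (leq_ltn_trans pm) ?(proj2 sizes) //; splits => //.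
  rewrite vi4 IH big_nat_recr //= t4 //; congr (_ + nat_of_bool (score_in m _))%N.
  by rewrite /part big_mkord.
- move=> g IH _ ag.
  have vb : na g vbest 0%N = depth S P id by rewrite IH big_mkord.
  have [og tg] : ok0 g by move: ok3; rewrite /ok0 /out_center !(proj2 ag).
  split=> //; split; rewrite ?og ?tg //; first by rewrite lexx mulr_gt0 ?pi_gt0.
  by rewrite vb captured0.
Qed.

Definition solve_time (s : nat) : nat :=
  (1 + (table_time + (identity_time + (s * (segment_time S P + 2) + 2))))%N.

(** The description of [Lambda] by segments and [in_range] covers a line and a chain at once. The
    identity provides a first admissible answer, so that a recorded answer exists even if no sweep
    improves on it. *)
Lemma run_solve h s : env h -> size L = s.+1 -> (if lin then s = 1%N else na h vs 0%N = s) ->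
  (forall k, (k < s)%N -> vtx L k != vtx L k.+1) ->
  (forall r, Lambda r <-> exists k t, [/\ (k < s)%N, in_range lin t &
     r = center (vtx L k) ((vtx L k.+1).1 - (vtx L k).1, (vtx L k.+1).2 - (vtx L k).2) t]) ->
  (0 < s)%N ->
  run (solve lin) h (solve_time s) (fun g =>
    optimal_rotation Lambda S P (out_center g) (ra g rth 0%N)).
Proof.
move=> eh sL hs dist lamP s0.
pose h1 := if lin then setN h vs 0 1 else h.
have e1 : env h1 by rewrite /h1; case: (lin).
have s1 : na h1 vs 0%N = s by rewrite /h1; move: hs; case: (lin) => //= ->.
apply: (call_seq (T1 := 1) (Q1 := fun g => g = h1)).
  rewrite /h1; case: (lin); first by apply: wp_run; rewrite /= height0.
  by apply: (run_weaken (T := 0) (wp_run (c := CSkip) (Q := fun g => g = h) _)).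
move=> _ -> _.
apply: (call_seq (run_fill_table e1)) => g1 t1 ag1.
have e2 : env g1 by apply: agree_env ag1 isT isT e1.
have lam0 : Lambda (vtx L 0).
  apply/lamP; exists 0%N, 0; split; rewrite // ?/in_range ?lexx ?ler01 ?orbT //.
  by rewrite /center !mul0r !addr0 -surjective_pairing.
apply: (call_seq (run_process_identity e2 t1 _ lam0)); first by rewrite sL.
move=> g2 [b2 v2] ag2.
have e3 : env g2 by apply: agree_env ag2 isT isT e2.
have t2 : table_ok g2 by apply: agree_table ag2 isT t1.
have s2 : na g2 vs 0%N = s by rewrite (proj1 ag2) // (proj1 ag1).
pose dir k := ((vtx L k.+1).1 - (vtx L k).1, (vtx L k.+1).2 - (vtx L k).2).
apply: (run_for (I := fun k g => [/\ best_ok g, (depth S P id <= na g vbest 0)%N &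
  forall j t w, (j < k)%N -> in_range lin t ->
    (depth S P (spin (center (vtx L j) (dir j) t) w) <= na g vbest 0)%N])) => //.
- by case: (lin).
- by move=> g ag; rewrite /= height0; split=> //; rewrite (proj1 ag) //; case: (lin).
- by split=> //; rewrite /= v2.
- move=> k g ks [bg vg dg] ek ag.
  have eg : env g by apply: (agree_env ag _ _ e3); case: (lin).
  have tg : table_ok g by apply: (agree_table ag _ t2); case: (lin).
  apply: run_weaken (run_process_segment sizes events_height n_gt0 simple _ _ eg tg bg ek _) _ _ => //.
  + by move=> t rt; apply/lamP; exists k, t; split.
  + have := dist k ks; case: (vtx L k) => [x1 x2]; case: (vtx L k.+1) => [y1 y2] /=.
    by rewrite !xpair_eqE !subr_eq0 !(eq_sym x1) !(eq_sym x2).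
  + by rewrite sL ltnS.
  + move=> g' [b' v' d'] _; split=> //; first exact: leq_trans vg v'.
    move=> j t w; rewrite ltnS leq_eqVlt => /orP[/eqP->|jk] rt; first exact: d'.
    exact: leq_trans (dg j t w jk rt) v'.
- move=> g [[lg ag cg] vg dg] _ _; split=> // r theta /lamP[k [t [ks rt ->]]] /andP[th0 th1].
  rewrite cg; move: th0; rewrite le_eqVlt => /orP[/eqP<-|th0]; first by rewrite captured0.
  have [|w [ec es]] := @angle_surj R theta; first by rewrite th0.
  by rewrite (captured_spin S simple _ ec es); exact: dg.
Qed.

End Solve.

(** * Running time *)

Section Domination.
Variables (T : Type) (D : T -> Prop).
Implicit Types (f g : T -> nat).

(** O-notation with one constant for all instances in [D]. The functions depend on whole instances,
    which lets the three sizes vary together. *)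
Definition dominated f g : Prop := exists K, forall x, D x -> (f x <= K * g x)%N.

Lemma dominated_le f g : (forall x, D x -> f x <= g x)%N -> dominated f g.
Proof. by move=> H; exists 1%N => x /H; rewrite mul1n. Qed.

Lemma dominated_const k g : (forall x, D x -> 0 < g x)%N -> dominated (fun=> k) g.
Proof. by move=> H; exists k => x /H ?; rewrite -{1}[k]muln1; exact: leq_mul. Qed.

Lemma dominated_add f f' g : dominated f g -> dominated f' g ->
  dominated (fun x => f x + f' x)%N g.
Proof.
move=> [K H] [K' H']; exists (K + K')%N => x Dx; rewrite mulnDl.
by apply: leq_add; [exact: H|exact: H'].
Qed.

Lemma dominated_mul f f' g g' : dominated f g -> dominated f' g' ->
  dominated (fun x => f x * f' x)%N (fun x => g x * g' x)%N.
Proof.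
move=> [K H] [K' H']; exists (K * K')%N => x Dx; rewrite mulnACA.
by apply: leq_mul; [exact: H|exact: H'].
Qed.

Lemma dominated_trans g f k : dominated f g -> dominated g k -> dominated f k.
Proof.
move=> [K H] [K' H']; exists (K * K')%N => x Dx; apply: leq_trans (H x Dx) _.
by rewrite -mulnA; apply: leq_mul => //; exact: H'.
Qed.

End Domination.

Section RunningTime.
Variable R : realType.

Let instance := (seq (R * R) * seq (R * R) * nat)%type.
Let D (x : instance) : Prop := [/\ (0 < size x.1.1)%N, (2 < size x.1.2)%N & (0 < x.2)%N].
Let n (x : instance) := size x.1.1.
Let m (x : instance) := size x.1.2.
Let s (x : instance) := x.2.
Let X x := (n x * m x)%N.
Let lg x := (trunc_log 2 (X x)).+1.
Local Notation dominated := (@dominated instance D).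

Let n_gt0 x : D x -> (0 < n x)%N. Proof. by case. Qed.
Let m_gt0 x : D x -> (0 < m x)%N. Proof. by case=> _ h _; exact: leq_trans h. Qed.
Let s_gt0 x : D x -> (0 < s x)%N. Proof. by case. Qed.
Let X_gt0 x : D x -> (0 < X x)%N. Proof. by move=> Dx; rewrite muln_gt0 n_gt0 // m_gt0. Qed.
Let Xlg_gt0 x : D x -> (0 < X x * lg x)%N. Proof. by move=> Dx; rewrite muln_gt0 X_gt0. Qed.
Let XXlg_gt0 x : D x -> (0 < X x * (X x * lg x))%N.
Proof. by move=> Dx; rewrite muln_gt0 X_gt0 // Xlg_gt0. Qed.
Let goal_gt0 x : D x -> (0 < s x * (X x * (X x * lg x)))%N.
Proof. by move=> Dx; rewrite muln_gt0 s_gt0 // XXlg_gt0. Qed.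

Let refl f : dominated f f. Proof. exact: dominated_le. Qed.
Let succ f g : dominated f g -> (forall x, D x -> (0 < g x)%N) -> dominated (fun x => (f x).+1) g.
Proof.
move=> H pos; have [K HK] := dominated_add (dominated_const 1 pos) H.
by exists K => x /HK; rewrite add1n.
Qed.
Let scale f k g : dominated f g -> dominated (fun x => f x * k)%N g.
Proof.
by move=> [K H]; exists (K * k)%N => x Dx; rewrite mulnAC; apply: leq_mul => //; exact: H.
Qed.
Let scalel f k g : dominated f g -> dominated (fun x => k * f x)%N g.
Proof. by move=> [K H]; exists (k * K)%N => x Dx; rewrite -mulnA; apply: leq_mul => //; exact: H. Qed.

Ltac pos := solve [exact: n_gt0 | exact: m_gt0 | exact: X_gt0 | exact: Xlg_gt0 | exact: XXlg_gt0 | exact: goal_gt0 | by []].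
Ltac dom := repeat match goal with
  | |- dominated (fun _ => ?k) _ => apply: dominated_const; pos
  | |- dominated (fun x => addn (@?f x) (@?g x)) _ => apply: dominated_add
  | |- dominated (fun x => S (@?f x)) _ => apply: succ; [|pos]
  | |- dominated (fun x => muln (@?f x) ?k) _ => apply: (@scale f k)
  | |- dominated (fun x => muln ?k (@?f x)) _ => apply: (@scalel f k)
  | |- dominated ?f ?f => exact: refl
  end; try exact: refl.

Let gen_dom : dominated (fun x => gen_time x.1.1 x.1.2) X.
Proof. by rewrite /gen_time /edge_loop_time; dom; apply: (dominated_mul (g := n) (g' := m)); dom. Qed.

Let init_dom : dominated (fun x => init_time x.1.1 x.1.2) X.
Proof.
rewrite /init_time /clear_time /update_all_time; dom; by apply: (dominated_mul (g := n) (g' := m)); dom.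
Qed.

Let identity_dom : dominated (fun x => identity_time x.1.1 x.1.2) X.
Proof. by rewrite /identity_time; dom; apply: (dominated_mul (g := n) (g' := m)); dom. Qed.

Let events_dom : dominated (fun x => max_events x.1.1 x.1.2) X.
Proof. by rewrite /max_events; dom. Qed.

Let log_dom : dominated (fun x => trunc_log 2 (max_events x.1.1 x.1.2)) lg.
Proof.
(* [24 + 30 X <= 54 X < 2^6 X], so the logarithm is below [6 + lg], and [lg] is at least 1. *)
exists 7%N => x Dx; have X1 := X_gt0 Dx.
suff : (trunc_log 2 (max_events x.1.1 x.1.2) < 6 + lg x)%N.
  by rewrite /lg; move: (trunc_log 2 _) (trunc_log 2 _) => u v; clear; lia.
rewrite -(@ltn_exp2l 2) //; apply: leq_ltn_trans (trunc_logP _ _) _ => //.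
have := trunc_log_ltn (X x) (isT : (1 < 2)%N); rewrite -/(lg x) expnD /max_events.
rewrite -/(n x) -/(m x) -/(X x); move: (X x) (2 ^ lg x)%N X1 => u v; clear; lia.
Qed.

Let X_Xlg : dominated X (fun x => X x * lg x)%N.
Proof. by apply: dominated_le => x Dx; rewrite leq_pmulr. Qed.

Let sort_dom : dominated (fun x => sort_time (max_events x.1.1 x.1.2)) (fun x => X x * lg x)%N.
Proof.
rewrite /sort_time /build_time /pop_time /climb_time /climb_step; dom.
- exact: dominated_trans events_dom X_Xlg.
- exact: dominated_trans events_dom X_Xlg.
- by apply: dominated_mul => //; dom.
Qed.

Let curve_dom : dominated (fun x => curve_time x.1.1 x.1.2) (fun x => X x * lg x)%N.
Proof.
rewrite /curve_time /sweep_time; dom; first [exact: sort_dom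
  | exact: dominated_trans gen_dom X_Xlg | exact: dominated_trans init_dom X_Xlg
  | exact: dominated_trans events_dom X_Xlg].
Qed.

Lemma solve_time_dominated :
  exists K, forall S P (k : nat), (0 < size S)%N -> (2 < size P)%N -> (0 < k)%N ->
  let x := (size S * size P)%N in
  (@solve_time R S P k <= K * (k * (x * (x * (trunc_log 2 x).+1))))%N.
Proof.
suff [K H] : dominated (fun x => solve_time x.1.1 x.1.2 x.2)
   (fun x => s x * (X x * (X x * lg x)))%N.
  by exists K => S P k nS mP k0; exact: (H (S, P, k)).
have XX : dominated X (fun x => s x * (X x * (X x * lg x)))%N.
  apply: dominated_le => x Dx; rewrite mulnCA leq_pmulr // muln_gt0 s_gt0 //; exact: Xlg_gt0.
rewrite /solve_time /table_time /segment_time; dom.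
- apply: (dominated_trans (g := fun x => m x * m x)%N); first by apply: dominated_mul; dom.
  apply: dominated_le => x Dx; rewrite (@leq_trans (X x * X x)) //.
    by apply: leq_mul; rewrite leq_pmull // n_gt0.
  apply: (@leq_trans (X x * (X x * lg x))); last by rewrite leq_pmull // s_gt0.
  by rewrite leq_mul // leq_pmulr.
- exact: dominated_trans identity_dom XX.
- apply: (dominated_mul (g := s) (g' := fun x => X x * (X x * lg x))%N); dom.
  + apply: (dominated_trans (g := fun x => n x * (m x * (X x * lg x)))%N); last first.
      by apply: dominated_le => x Dx; rewrite mulnA.
    apply: dominated_mul; dom; first [by apply: dominated_mul; dom
      | by apply: dominated_const => x Dx; rewrite muln_gt0 m_gt0 // Xlg_gt0].
  + apply: dominated_trans curve_dom _.
    by apply: dominated_le => x Dx; rewrite leq_pmull // X_gt0.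
Qed.

End RunningTime.

(** * The bounds of the theorem *)

Section Main.
Variable R : realType.
Implicit Types (S P L : seq (R * R)) (Lambda : set (R * R)).

Lemma exec_copy_in space (input : seq R) v st : (v < ntemp)%N -> (cell v 0 < space)%N ->
  exec space input (copy_in v) st 1 (nset st (cell v 0) (nmem st v)).
Proof.
move=> hv hc; apply: exec_do => /=.
have hs : (v < space)%N by apply: leq_ltn_trans hc; rewrite /cell; lia.
by rewrite nget_dir //= nput_dir.
Qed.

Lemma exec_copy_out space (input : seq R) v c st : (v < ntemp)%N -> (cell c 0 < space)%N ->
  exec space input (copy_out v c) st 1 (rset st v (rmem st (cell c 0))).
Proof.
move=> hv hc; apply: exec_do => /=.
have hs : (v < space)%N by apply: leq_ltn_trans hc; rewrite /cell; lia.
by rewrite rget_dir //= rput_dir.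
Qed.

Lemma main_program_correct lin S P L Lambda s ns height space :
  (0 < size S)%N -> simple_polygon P -> size L = s.+1 -> (0 < s)%N ->
  nth 0%N ns 0 = size S -> nth 0%N ns 1 = size P ->
  (if lin then s = 1%N else nth 0%N ns 2 = s) ->
  (forall k, (k < s)%N -> vtx L k != vtx L k.+1) ->
  (forall r, Lambda r <-> exists k t, [/\ (k < s)%N, in_range lin t &
     r = center (vtx L k) ((vtx L k.+1).1 - (vtx L k).1, (vtx L k.+1).2 - (vtx L k).2) t]) ->
  (size S * size P <= height)%N -> ((size P).+2 * (size P).+2 < height)%N ->
  (2 * max_events S P + 2 < height)%N -> (ntemp + ncol * height <= space)%N ->
  exists t (st : state R),
    [/\ exec space (coordinates (S ++ P ++ L)) (main_program lin) (init_state R ns) t st,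
        (t <= 6 + slowdown (solve lin) * solve_time S P s)%N &
        optimal_rotation Lambda S P (rmem st 0%N, rmem st 1%N) (rmem st 2%N)].
Proof.
move=> n0 simple sL s0 ns0 ns1 ns2 dist lamP h1 h2 h3 hs.
have c_lt v : (v < ncol)%N -> (cell v 0 < space)%N.
  by move=> hv; apply: leq_trans hs; rewrite /cell; move: hv h3; clear; lia.
set input := coordinates _.
set st0 := init_state R ns; set st1 := nset st0 (cell 0 0) (size S).
set st2 := nset st1 (cell 1 0) (size P); set st3 := nset st2 (cell 2 0) (nth 0%N ns 2).
have x1 : exec space input (copy_in 0) st0 1 st1 by rewrite /st1 -ns0; apply: exec_copy_in => //; exact: c_lt.
have x2 : exec space input (copy_in 1) st1 1 st2.
  have -> : st2 = nset st1 (cell 1 0) (nmem st1 1) by rewrite /st2 -ns1.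
  by apply: exec_copy_in => //; exact: c_lt.
have x3 : exec space input (copy_in 2) st2 1 st3 by apply: exec_copy_in => //; exact: c_lt.
have ev : env S P (view st3) by [].
have lv : if lin then s = 1%N else na (view st3) 2%N 0%N = s by move: ns2; case: (lin).
have [t [h' [hx tT opt]]] := run_solve h1 h2 h3 n0 simple ev sL lv dist lamP s0.
have [t' [st4 [x4 t't v4]]] := compile_correct hs hx (wf_solve lin) erefl.
set st5 := rset st4 0 (rmem st4 (cell ro1 0)).
set st6 := rset st5 1 (rmem st5 (cell ro2 0)).
set st7 := rset st6 2 (rmem st6 (cell rth 0)).
exists (1 + (1 + 1) + (t' + (1 + (1 + 1))))%N, st7; split.
- apply: exec_seq; first by apply: exec_seq x1 _; apply: exec_seq x2 x3.
  apply: exec_seq x4 _; apply: exec_seq; last apply: exec_seq.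
  + by apply: exec_copy_out => //; exact: c_lt.
  + by apply: exec_copy_out => //; exact: c_lt.
  + by apply: exec_copy_out => //; exact: c_lt.
- have le : (slowdown (solve lin) * t <= slowdown (solve lin) * solve_time S P s)%N by apply: leq_mul.
  by move: (leq_trans t't le); clear; lia.
- by move: opt; rewrite -v4.
Qed.

(** With X = n m >= 3 and m + 2 <= 2 X, each table fits into a multiple of X^2; the factor 120 is
    generous. The table of (m + 2)^2 entries is what needs a quadratic height. *)
Lemma height_bounds n m : (0 < n)%N -> (2 < m)%N ->
  let H := (120 * (n ^ 2 * m ^ 2))%N in
  [/\ (n * m <= H)%N, (m.+2 * m.+2 < H)%N & (2 * (24 + 30 * (n * m)) + 2 < H)%N].
Proof.
move=> n0 m2 /=; rewrite -expnMn.
have hX : (3 <= n * m)%N by apply: leq_trans m2 _; rewrite leq_pmull.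
have hm : (m <= n * m)%N by rewrite leq_pmull.
have mm : (m.+2 * m.+2 <= (2 * (n * m)) * (2 * (n * m)))%N by apply: leq_mul; move: hX hm m2; clear; lia.
move: (n * m)%N hX hm mm => X hX _ mm; have XX : (3 * X <= X * X)%N by apply: leq_mul.
rewrite expnS expn1; split; [|apply: leq_ltn_trans mm _|]; move: XX hX; clear; nia.
Qed.

Lemma log_bound x : (1 < x)%N -> (trunc_log 2 x)%:R * ln 2 <= ln (x%:R : R).
Proof.
move=> x1; rewrite mulr_natl -lnXn ?ltr0n //.
rewrite ler_ln ?posrE ?exprn_gt0 ?ltr0n //; last by apply: ltn_trans x1.
by rewrite -natrX ler_nat; apply: trunc_logP => //; apply: ltn_trans x1.
Qed.

(** Replaces [l.+1] by [2 * l] and absorbs the additive 6; it is applied to the truncated logarithm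
    of n m, which is positive because a polygon has at least three vertices. *)
Lemma time_bound sl K T Y l t : (0 < Y)%N -> (0 < l)%N -> (T <= K * (Y * l.+1))%N ->
  (t <= 6 + sl * T)%N -> (t <= (12 + 2 * (sl * K)) * (Y * l))%N.
Proof.
move=> Y0 l0 TK le; apply: leq_trans le _.
have h1 : (0 < Y * l)%N by rewrite muln_gt0 Y0.
have h2 : (sl * T <= sl * (K * (2 * (Y * l))))%N.
  apply: leq_mul => //; apply: leq_trans TK _; apply: leq_mul => //.
  by rewrite mulnCA; apply: leq_mul => //; move: l0; clear; lia.
have -> : ((12 + 2 * (sl * K)) * (Y * l) = 12 * (Y * l) + sl * (K * (2 * (Y * l))))%N by ring.
by apply: leq_add => //; move: h1; clear; lia.
Qed.

Lemma main_program_bounds lin : exists C : nat, forall S P L Lambda s ns,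
  (0 < size S)%N -> simple_polygon P -> size L = s.+1 -> (0 < s)%N ->
  nth 0%N ns 0 = size S -> nth 0%N ns 1 = size P ->
  (if lin then s = 1%N else nth 0%N ns 2 = s) ->
  (forall k, (k < s)%N -> vtx L k != vtx L k.+1) ->
  (forall r, Lambda r <-> exists k t, [/\ (k < s)%N, in_range lin t &
     r = center (vtx L k) ((vtx L k.+1).1 - (vtx L k).1, (vtx L k.+1).2 - (vtx L k).2) t]) ->
  computes_within (main_program lin)
    (C%:R * ((s * size S ^ 2 * size P ^ 2)%:R * ln ((size S * size P)%:R : R)))
    (C * (size S ^ 2 * size P ^ 2)) ns (coordinates (S ++ P ++ L))
    (optimal_rotation Lambda S P).
Proof.
have [K HK] := solve_time_dominated R.
pose K' := (12 + 2 * (slowdown (solve lin) * K))%N.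
have ln2 : 0 < ln 2 :> R by rewrite ln_gt0 // ltr1n.
(* Converts the binary logarithm of the tournament into the natural logarithm of the bound. *)
pose B := Num.bound (K'%:R / ln 2 : R).
have HB : K'%:R <= B%:R * ln 2 :> R.
  by rewrite -ler_pdivrMr //; apply/ltW/archi_boundP; rewrite divr_ge0 // ltW.
(* 4830 = 30 + 40 * 120 accounts for the temporaries and for the columns of height 120 (n m)^2, and
   [B] for the time. *)
exists (4830 + B)%N => S P L Lambda s ns n0 simple sL s0 ns0 ns1 ns2 dist lamP.
have [m2 _ _] := simple.
have [b1 b2 b3] := height_bounds n0 m2.
set n := size S in n0 ns0 b1 b3 *; set m := size P in m2 ns1 b1 b2 b3 *.
set H := (120 * _)%N in b1 b2 b3.
have space_ok : (ntemp + ncol * H <= (4830 + B) * (n ^ 2 * m ^ 2))%N.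
  rewrite mulnDl /H; have : (0 < n ^ 2 * m ^ 2)%N by rewrite muln_gt0 !expn_gt0 n0 (ltnW (ltnW m2)).
  by move: (n ^ 2 * m ^ 2)%N => Y; clear; nia.
have [t [st [x le opt]]] := main_program_correct n0 simple sL s0 ns0 ns1 ns2 dist lamP b1 b2 b3 space_ok.
exists t, st; split=> //.
have X1 : (2 <= n * m)%N by apply: leq_trans (ltnW m2) _; rewrite leq_pmull.
have := HK S P s n0 m2 s0; rewrite -/n -/m /= => tK.
set l := trunc_log 2 (n * m) in tK.
have l0 : (0 < l)%N by rewrite /l trunc_log_gt0.
set Y := (s * n ^ 2 * m ^ 2)%N.
have YE : (s * ((n * m) * ((n * m) * l.+1)) = Y * l.+1)%N by rewrite /Y; ring.
have Y0 : (0 < Y)%N.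
  by rewrite /Y -mulnA muln_gt0 s0 /= -expnMn expn_gt0 (ltnW X1).
have tY : (t <= K' * (Y * l))%N by apply: time_bound Y0 l0 _ le; rewrite -YE.
apply: le_trans (_ : K'%:R * (Y%:R * l%:R) <= _); first by rewrite -!natrM ler_nat.
have lln : l%:R * ln 2 <= ln ((n * m)%:R : R) by apply: log_bound.
have ln0 : 0 <= ln ((n * m)%:R : R) by apply: le_trans lln; rewrite mulr_ge0 // ltW.
apply: le_trans (_ : B%:R * (Y%:R * ln ((n * m)%:R : R)) <= _).
  apply: le_trans (_ : B%:R * ln 2 * (Y%:R * l%:R) <= _); first by rewrite ler_wpM2r // mulr_ge0.
  rewrite -mulrA ler_wpM2l // mulrCA ler_wpM2l // mulrC; exact: lln.
by rewrite ler_wpM2r ?mulr_ge0 // ler_nat leq_addl.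
Qed.

End Main.

Theorem mainTheorem5 (R : realType) :
  (exists (p : program) (C : nat),
     forall (n m : nat) (S P : seq (R * R)) (a b : R * R),
       (0 < n)%N -> size S = n -> uniq S ->
       size P = m -> simple_polygon P ->
       a != b ->
       computes_within p
         (C%:R * ((n ^ 2 * m ^ 2)%:R * ln ((n * m)%:R : R)))
         (C * (n ^ 2 * m ^ 2))%N
         [:: n; m] (coordinates (S ++ P ++ [:: a; b]))
         (optimal_rotation (line_through a b) S P)) /\
  (exists (p : program) (C : nat),
     forall (n m s : nat) (S P L : seq (R * R)),
       (0 < n)%N -> size S = n -> uniq S ->
       size P = m -> simple_polygon P ->
       polygonal_chain s L ->
       computes_within p
         (C%:R * ((s * n ^ 2 * m ^ 2)%:R * ln ((n * m)%:R : R)))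
         (C * (n ^ 2 * m ^ 2))%N
         [:: n; m; s] (coordinates (S ++ P ++ L))
         (optimal_rotation (chain_points s L) S P)).
Proof.
split.
  have [C HC] := main_program_bounds R true; exists (main_program true), C.
  move=> n m S P a b n0 eS uS eP simple ab; subst n m.
  have := HC S P [:: a; b] (line_through a b) 1%N [:: size S; size P]; rewrite mul1n; apply=> //.
  - by case.
  - move=> r; split=> [[t _ <-]|[k [t [ks _ ->]]]]; first by exists 0%N, t.
    by case: k ks => // _; exists t.
have [C HC] := main_program_bounds R false; exists (main_program false), C.
move=> n m s S P L n0 eS uS eP simple [s0 sL dist]; subst n m.
apply: HC => // r; split=> [[k /= ks [t]]|[k [t [ks rt ->]]]].
  by rewrite /= in_itv /= => rt <-; exists k, t.
by exists k => //; exists t.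
Qed.
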